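(* Let $\Bbbk$ be a field of prime characteristic $p$. In the following, $F,F_1,F_2$ are homogeneous strict polynomial functors over $\Bbbk$ and $n,n_1,n_2$ are positive integers. (i) For all $r\ge0$ and all $d\ge0$, $\Gamma^{d\,(r)}$ is $p^r$-resolved. (ii) If $F$ has degree $d\geq 1$ then $F$ is $d$-resolved. (iii) If $F_i$ is $n_i$-resolved for $i=1,2$, then $F_1\otimes F_2$ is $(n_1+n_2)$-resolved. (iv) If $F$ is $n$-resolved then $F$ is $(n+1)$-resolved. (v) If $F$ is $n$-resolved and $\ell$ is a positive integer, then $F(\Bbbk^\ell\otimes I):V\mapsto F(\Bbbk^\ell\otimes V)$ is $n\ell$-resolved.
   Context: $\mathcal{P}_\Bbbk$ is the category of strict polynomial functors of finite type over $\Bbbk$ (Friedlander–Suslin) and $\mathcal{P}_{\Bbbk,d}$ its full subcategory of homogeneous functors of degree $d$. $\Gamma^d$ is the $d$-th divided power, $I^{(r)}:V\mapsto V^{(r)}$ the $r$-th Frobenius twist functor, $F^{(r)}=F\circ I^{(r)}$, and $\Gamma^{d,n}$ is the functor $V\mapsto\Gamma^d(\mathrm{Hom}_\Bbbk(\Bbbk^n,V))$. For $F\in\mathcal{P}_{\Bbbk,d}$ and a positive integer $n$: $F$ is $n$-generated if the canonical map $\Gamma^{d,n}\otimes F(\Bbbk^n)\to F$, given on $V$ by $f\otimes x\mapsto F(f)(x)$, is an epimorphism. $F$ is $n$-resolved if it admits a resolution by $n$-generated projectives of $\mathcal{P}_{\Bbbk,d}$. *)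

(* Defs.v *)
From HB Require Import structures.
From mathcomp Require Import all_boot all_order all_fingroup all_algebra.
From mathcomp Require Import mxtens mpoly.

Set Implicit Arguments.
Unset Strict Implicit.
Unset Printing Implicit Defensive.

Import GRing.Theory VectorInternalTheory.
Local Open Scope ring_scope.

(* A finite-dimensional k-vector space V is a [vectType k]; its vector space
   structure carries a basis, hence an identification of V with row vectors of
   length [dim V].  For a commutative k-algebra A, the A-linear maps
   A (x) V -> A (x) W, i.e. the A-points of the affine space Hom_k(V, W), are
   thus the matrices 'M[A]_(dim V, dim W); they act on the right of row vectors,
   so that [X *m Y] is "first X, then Y".  For f : 'Hom(V, W), [f2mx f] is the
   matrix of f in these bases. *)

(* The space k^n, with dimension definitionally equal to n (the dimension of the
   vectType structure of 'rV[k]_n is [1 * n]). *)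
Definition row_space (k : fieldType) (n : nat) : Type := 'rV[k]_n.
HB.instance Definition _ (k : fieldType) n := GRing.Lmodule.on (row_space k n).
Fact row_space_vect_iso (k : fieldType) n : Vector.axiom n (row_space k n).
Proof. by exists id => //; exists id. Qed.
HB.instance Definition _ (k : fieldType) n :=
  Lmodule_hasFinDim.Build k (row_space k n) (row_space_vect_iso k n).
Definition kspace (k : fieldType) (n : nat) : vectType k := row_space k n.

(* The basis vector of index [mxtens_index (i, j)] stands for e_i (x) e_j. *)
Definition tens (k : fieldType) (V W : vectType k) : vectType k :=
  'M[k]_(dim V, dim W).

Section Category.
Variable k : fieldType.

(* Friedlander-Suslin: V |-> F(V) together with polynomial maps
   Hom(V, W) -> Hom(F(V), F(W)), i.e. morphisms of affine schemes over k, given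
   on A-points naturally in A, compatible with identities and compositions.
   F(V) is finite-dimensional, being a vectType. *)
Record spfunctor := SPFunctor {
  spf_ob :> vectType k -> vectType k;
  spf_mor : forall (A : comAlgType k) (V W : vectType k),
    'M[A]_(dim V, dim W) -> 'M[A]_(dim (spf_ob V), dim (spf_ob W));
  spf_natural : forall (A B : comAlgType k) (phi : {lrmorphism A -> B})
    (V W : vectType k) (X : 'M[A]_(dim V, dim W)),
    map_mx phi (@spf_mor A V W X) = @spf_mor B V W (map_mx phi X);
  spf_id : forall (A : comAlgType k) (V : vectType k),
    @spf_mor A V V 1%:M = 1%:M;
  spf_comp : forall (A : comAlgType k) (U V W : vectType k)
    (X : 'M[A]_(dim U, dim V)) (Y : 'M[A]_(dim V, dim W)),
    @spf_mor A U W (X *m Y) = @spf_mor A U V X *m @spf_mor A V W Y }.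

Definition homogeneous (d : nat) (F : spfunctor) : Prop :=
  forall (A : comAlgType k) (V W : vectType k) (a : A)
    (X : 'M[A]_(dim V, dim W)),
    spf_mor F (a *: X) = a ^+ d *: spf_mor F X.

(* The objects of P_{k,d}, the morphisms being those of [spf_hom]. *)
Record hspfunctor (d : nat) := HSPFunctor {
  hspf :> spfunctor;
  hspfP : homogeneous d hspf }.

Record spf_hom (F G : spfunctor) := SPFHom {
  hom_at :> forall V : vectType k, 'Hom(F V, G V);
  hom_natural : forall (A : comAlgType k) (V W : vectType k)
    (X : 'M[A]_(dim V, dim W)),
    spf_mor F X *m map_mx (in_alg A) (f2mx (hom_at W)) =
    map_mx (in_alg A) (f2mx (hom_at V)) *m spf_mor G X }.

(* Epimorphisms and projective objects of P_{k,d}.  Morphisms are compared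
   componentwise. *)
Definition spf_epi (d : nat) (F G : hspfunctor d) (f : spf_hom F G) : Prop :=
  forall (H : hspfunctor d) (u v : spf_hom G H),
    (forall V : vectType k, (u V \o f V)%VF = (v V \o f V)%VF) ->
    forall V : vectType k, u V = v V.

Definition projective (d : nat) (P : hspfunctor d) : Prop :=
  forall (F G : hspfunctor d) (e : spf_hom F G) (f : spf_hom P G),
    spf_epi e ->
    exists g : spf_hom P F, forall V : vectType k, (e V \o g V)%VF = f V.

End Category.

Section Constructions.
Variable k : fieldType.
Implicit Types F G : spfunctor k.

Lemma tens1mx (R : comPzRingType) m n : (1%:M : 'M[R]_m) *t (1%:M : 'M[R]_n) = 1%:M.
Proof.
apply/matrixP=> i j.
case: (mxtens_indexP i)=> i0 i1; case: (mxtens_indexP j)=> j0 j1.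
by rewrite tensmxE !mxE (can_eq (@mxtens_indexK _ _)) xpair_eqE -natrM mulnb.
Qed.

Program Definition spf_tensor F G : spfunctor k :=
  @SPFunctor k (fun V => tens (F V) (G V))
    (fun A V W X => spf_mor F X *t spf_mor G X) _ _ _.
Next Obligation. by rewrite map_mxT !spf_natural. Qed.
Next Obligation. by rewrite !spf_id tens1mx. Qed.
Next Obligation. by rewrite !spf_comp tensmx_mul. Qed.

Program Definition spf_o F G : spfunctor k :=
  @SPFunctor k (fun V => F (G V)) (fun A V W X => spf_mor F (spf_mor G X)) _ _ _.
Next Obligation. by rewrite !spf_natural. Qed.
Next Obligation. by rewrite !spf_id. Qed.
Next Obligation. by rewrite !spf_comp. Qed.

Program Definition spf_const (E : vectType k) : spfunctor k :=
  @SPFunctor k (fun=> E) (fun A V W _ => 1%:M) _ _ _.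
Next Obligation. exact: map_mx1. Qed.
Next Obligation. by rewrite mulmx1. Qed.

(* V |-> k^l (x) V *)
Program Definition spf_ktens (l : nat) : spfunctor k :=
  @SPFunctor k (fun V => tens (kspace k l) V)
    (fun A V W X => (1%:M : 'M[A]_(dim (kspace k l))) *t X) _ _ _.
Next Obligation. by rewrite map_mxT map_mx1. Qed.
Next Obligation. by rewrite tens1mx. Qed.
Next Obligation. by rewrite tensmx_mul mulmx1. Qed.

(* V |-> Hom(k^n, V).  The basis vector of index [mxtens_index (i, j)] stands for
   the elementary matrix E_ij; post-composition with X : V -> W is right
   multiplication by X, that is E_ij |-> sum_l X_jl E_il. *)
Program Definition spf_kHom (n : nat) : spfunctor k :=
  @SPFunctor k (fun V => 'Hom(kspace k n, V))
    (fun A V W X => (1%:M : 'M[A]_(dim (kspace k n))) *t X) _ _ _.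
Next Obligation. by rewrite map_mxT map_mx1. Qed.
Next Obligation. by rewrite tens1mx. Qed.
Next Obligation. by rewrite tensmx_mul mulmx1. Qed.

Section Twist.
Variables (p : nat) (charp : p \in [pchar k]) (r : nat).

Fact alg_pchar (A : comAlgType k) : p \in [pchar A].
Proof. exact: (rmorph_pchar (in_alg A)). Qed.

Fact frob_is_zmod (A : comAlgType k) :
  zmod_morphism (fun a : A => a ^+ (p ^ r)).
Proof.
move=> a b; elim: r => [|s IH]; first by rewrite !expr1.
rewrite expnSr !exprM IH -!(pFrobenius_autE (alg_pchar A)).
by rewrite pFrobenius_autB_comm //; apply: mulrC.
Qed.

Fact frob_is_monoid (A : comAlgType k) :
  monoid_morphism (fun a : A => a ^+ (p ^ r)).
Proof. by split=> [|a b]; [apply: expr1n | apply: exprMn]. Qed.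

Definition frob (A : comAlgType k) : {rmorphism A -> A} :=
  HB.pack (fun a : A => a ^+ (p ^ r))
    (GRing.isZmodMorphism.Build A A _ (@frob_is_zmod A))
    (GRing.isMonoidMorphism.Build A A _ (@frob_is_monoid A)).

(* I^(r) : V |-> V^(r).  The base change of V along the r-th power of Frobenius
   has the basis 1 (x) e_i, in which X^(r) has the entries of X raised to the
   power p^r. *)
Program Definition spf_frob : spfunctor k :=
  @SPFunctor k id (fun A V W X => map_mx (fun a : A => a ^+ (p ^ r)) X) _ _ _.
Next Obligation. by apply/matrixP=> i j; rewrite !mxE rmorphXn. Qed.
Next Obligation. exact: (map_mx1 (frob A)). Qed.
Next Obligation. exact: (map_mxM (frob A)). Qed.

Fact spf_frob_homogeneous : homogeneous (p ^ r) spf_frob.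
Proof. by move=> A V W a X; apply/matrixP=> i j; rewrite !mxE exprMn. Qed.
End Twist.

Fact spf_tensor_homogeneous d e F G :
  homogeneous d F -> homogeneous e G -> homogeneous (d + e) (spf_tensor F G).
Proof.
move=> hF hG A V W a X; apply/matrixP=> i j.
by rewrite /= hF hG !mxE exprD mulrACA.
Qed.

Fact spf_o_homogeneous d e F G :
  homogeneous d F -> homogeneous e G -> homogeneous (d * e) (spf_o F G).
Proof. by move=> hF hG A V W a X; rewrite /= hG hF -exprM mulnC. Qed.

Fact tensmxZr (R : comPzRingType) m n q s (a : R) (M : 'M_(m, n)) (N : 'M_(q, s)) :
  M *t (a *: N) = a *: (M *t N).
Proof. by apply/matrixP=> i j; rewrite !mxE mulrCA. Qed.

Fact spf_ktens_homogeneous l : homogeneous 1 (spf_ktens l).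
Proof. by move=> A V W a X; rewrite /= tensmxZr. Qed.
Fact spf_kHom_homogeneous l : homogeneous 1 (spf_kHom l).
Proof. by move=> A V W a X; rewrite /= tensmxZr. Qed.
Fact spf_const_homogeneous E : homogeneous 0 (spf_const E).
Proof. by move=> A V W a X; rewrite /= scale1r. Qed.

End Constructions.

(* Divided powers: Gamma^d(V) is the space of S_d-invariants of V^{(x) d}.  With
   (e_i) the basis of V, it has as basis the orbit sums
     e_b = sum of the e_{w_1} (x) ... (x) e_{w_d}, w a rearrangement of b,
   for b a weakly increasing d-tuple of indices. *)
Section Gamma.

Definition mset_tuple (d n : nat) :=
  {t : d.-tuple 'I_n | sorted leq [seq val i | i <- t]}.

Fact sort_mset_subproof d n (t : d.-tuple 'I_n) :
  sorted leq [seq val i | i <- sort_tuple (relpre val leq) t].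
Proof. by rewrite sorted_map sort_sorted // => i j; apply: leq_total. Qed.

Definition sort_mset d n (t : d.-tuple 'I_n) : mset_tuple d n :=
  Sub (sort_tuple (relpre val leq) t) (sort_mset_subproof t).

Lemma perm_sort_mset d n (t : d.-tuple 'I_n) (b : mset_tuple d n) :
  perm_eq t (val b) = (sort_mset t == b).
Proof.
have pt : perm_eq (val (sort_mset t)) t by rewrite perm_sort.
apply/idP/eqP=> [tb | <-]; last by rewrite perm_sym.
do 2 apply: val_inj; apply: (@sorted_eq _ (relpre val leq)).
- by move=> i j l; apply: leq_trans.
- by move=> i j /anti_leq/val_inj.
- by rewrite -sorted_map (valP (sort_mset t)).
- by rewrite -sorted_map (valP b).
- exact: perm_trans pt tb.
Qed.

(* [word_prod X w v] is the coefficient of e_v in X^{(x) d}(e_w), and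
   [gamma_coef X a v] the coefficient of e_v in X^{(x) d}(e_a). *)
Definition word_prod (R : comNzRingType) d m n (X : 'M[R]_(m, n))
  (w : d.-tuple 'I_m) (v : d.-tuple 'I_n) : R :=
  \prod_(i < d) X (tnth w i) (tnth v i).

Definition gamma_coef (R : comNzRingType) d m n (X : 'M[R]_(m, n))
  (a : mset_tuple d m) (v : d.-tuple 'I_n) : R :=
  \sum_(w : d.-tuple 'I_m | perm_eq w (val a)) word_prod X w v.

Definition gamma_mx (R : comNzRingType) d m n (X : 'M[R]_(m, n)) :
    'M[R]_(#|{: mset_tuple d m}|, #|{: mset_tuple d n}|) :=
  \matrix_(a, b) gamma_coef X (enum_val a) (val (enum_val b)).

Lemma gamma_coef_perm (R : comNzRingType) d m n (X : 'M[R]_(m, n)) a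
  (u v : d.-tuple 'I_n) : perm_eq u v -> gamma_coef X a u = gamma_coef X a v.
Proof.
case/tuple_permP=> s us; rewrite /gamma_coef.
pose h (w : d.-tuple 'I_m) := [tuple tnth w (s i) | i < d].
pose h' (w : d.-tuple 'I_m) := [tuple tnth w ((s^-1)%g i) | i < d].
have hK : cancel h' h by move=> w; apply: eq_from_tnth=> i; rewrite !tnth_mktuple permK.
have h'K : cancel h h' by move=> w; apply: eq_from_tnth=> i; rewrite !tnth_mktuple permKV.
rewrite (reindex h) /=; last by exists h'=> w _.
apply: eq_big=> [w | w _].
  have hw : perm_eq (h w) w by apply/tuple_permP; exists s.
  by rewrite (permPl hw).
have -> : u = [tuple tnth v (s i) | i < d] by apply: val_inj.
rewrite /word_prod [RHS](reindex_inj (@perm_inj _ s)).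
by apply: eq_bigr=> i _; rewrite !tnth_mktuple.
Qed.

Lemma word_prodM (R : comNzRingType) d m n q (X : 'M[R]_(m, n)) (Y : 'M[R]_(n, q))
  (w : d.-tuple 'I_m) (u : d.-tuple 'I_q) :
  word_prod (X *m Y) w u = \sum_(v : d.-tuple 'I_n) word_prod X w v * word_prod Y v u.
Proof.
rewrite /word_prod; under eq_bigr do rewrite mxE.
rewrite bigA_distr_bigA /= (reindex (fun v : d.-tuple 'I_n => [ffun i => tnth v i])) /=.
  apply: eq_bigr=> v _; rewrite -big_split /=.
  by apply: eq_bigr=> i _; rewrite ffunE.
exists (fun f : {ffun 'I_d -> 'I_n} => [tuple f i | i < d])=> [v _ | f _].
  by apply: eq_from_tnth=> i; rewrite tnth_mktuple ffunE.
by apply/ffunP=> i; rewrite ffunE tnth_mktuple.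
Qed.

Lemma gamma_coefM (R : comNzRingType) d m n q (X : 'M[R]_(m, n)) (Y : 'M[R]_(n, q))
  a (u : d.-tuple 'I_q) :
  gamma_coef (X *m Y) a u =
  \sum_(b : mset_tuple d n) gamma_coef X a (val b) * gamma_coef Y b u.
Proof.
rewrite {1}/gamma_coef; under eq_bigr do rewrite word_prodM.
rewrite exchange_big /= (partition_big (@sort_mset d n) predT) //=.
apply: eq_bigr=> b _; rewrite {2}/gamma_coef mulr_sumr.
apply: eq_big=> [v | v /eqP vb]; first by rewrite perm_sort_mset.
by rewrite -mulr_suml -/(gamma_coef X a v) (@gamma_coef_perm _ _ _ _ X a v (val b)) // perm_sort_mset vb.
Qed.

Lemma gamma_mxM (R : comNzRingType) d m n q (X : 'M[R]_(m, n)) (Y : 'M[R]_(n, q)) :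
  gamma_mx d (X *m Y) = gamma_mx d X *m gamma_mx d Y.
Proof.
apply/matrixP=> a c; rewrite !mxE gamma_coefM (reindex _ (onW_bij _ (@enum_val_bij _))) /=.
by apply: eq_bigr=> b _; rewrite !mxE.
Qed.

Lemma gamma_mx1 (R : comNzRingType) d n : gamma_mx d (1%:M : 'M[R]_n) = 1%:M.
Proof.
apply/matrixP=> a b; rewrite !mxE /gamma_coef.
have word1 (w v : d.-tuple 'I_n) : word_prod (1%:M : 'M[R]_n) w v = (w == v)%:R.
  rewrite /word_prod; have [->|] := eqVneq w v.
    by rewrite big1 // => i _; rewrite mxE eqxx.
  move=> wv; have [i wvi] : exists i, tnth w i != tnth v i.
    apply/existsP; rewrite -negb_forall; apply: contra wv => /forallP h.
    by apply/eqP/eq_from_tnth=> i; apply/eqP.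
  by rewrite (bigD1 i) //= mxE (negPf wvi) mul0r.
under eq_bigr do rewrite word1.
rewrite big_mkcond /= (bigD1 (val (enum_val b))) //= eqxx big1 ?addr0; last first.
  by move=> w /negPf->; rewrite if_same.
rewrite perm_sort_mset.
have -> : sort_mset (val (enum_val b)) = enum_val b by apply/eqP; rewrite -perm_sort_mset.
by rewrite (inj_eq enum_val_inj) eq_sym; case: eqP.
Qed.

Lemma map_gamma_mx (R S : comNzRingType) (phi : {rmorphism R -> S}) d m n
  (X : 'M[R]_(m, n)) : map_mx phi (gamma_mx d X) = gamma_mx d (map_mx phi X).
Proof.
apply/matrixP=> a b; rewrite !mxE rmorph_sum /=; apply: eq_bigr=> w _.
by rewrite rmorph_prod; apply: eq_bigr=> i _; rewrite mxE.
Qed.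

Lemma gamma_mxZ (R : comNzRingType) d m n (c : R) (X : 'M[R]_(m, n)) :
  gamma_mx d (c *: X) = c ^+ d *: gamma_mx d X.
Proof.
apply/matrixP=> a b; rewrite !mxE mulr_sumr; apply: eq_bigr=> w _.
rewrite /word_prod; under eq_bigr do rewrite mxE.
by rewrite big_split /= prodr_const card_ord.
Qed.

Variable k : fieldType.

Program Definition spf_gamma (d : nat) : spfunctor k :=
  @SPFunctor k (fun V => kspace k #|{: mset_tuple d (dim V)}|)
    (fun A V W X => gamma_mx d X) _ _ _.
Next Obligation. exact: map_gamma_mx. Qed.
Next Obligation. exact: gamma_mx1. Qed.
Next Obligation. exact: gamma_mxM. Qed.

Fact spf_gamma_homogeneous d : homogeneous d (spf_gamma d).
Proof. by move=> A V W a X; apply: gamma_mxZ. Qed.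
End Gamma.

(* {mpoly A[N]} as a k-algebra, for A a k-algebra. *)
Section KAlgMPoly.
Variables (k : fieldType) (A : comAlgType k) (N : nat).

Definition kmpoly : Type := {mpoly A[N]}.
HB.instance Definition _ := GRing.ComNzRing.on kmpoly.
Definition kmpoly_scale (c : k) (f : kmpoly) : kmpoly :=
  (c%:A : A) *: (f : {mpoly A[N]}).
Fact kmpoly_scaleA a b f :
  kmpoly_scale a (kmpoly_scale b f) = kmpoly_scale (a * b) f.
Proof. by rewrite /kmpoly_scale scalerA -scalerAl mul1r scalerA. Qed.
Fact kmpoly_scale1 : left_id 1 kmpoly_scale.
Proof. by move=> f; rewrite /kmpoly_scale !scale1r. Qed.
Fact kmpoly_scaleDr : right_distributive kmpoly_scale +%R.
Proof. by move=> a f g; rewrite /kmpoly_scale scalerDr. Qed.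
Fact kmpoly_scaleDl f : {morph kmpoly_scale^~ f : a b / a + b}.
Proof. by move=> a b; rewrite /kmpoly_scale !scalerDl. Qed.
HB.instance Definition _ := GRing.Zmodule_isLmodule.Build k kmpoly
  kmpoly_scaleA kmpoly_scale1 kmpoly_scaleDr kmpoly_scaleDl.
Fact kmpoly_scaleAl (c : k) (f g : kmpoly) : c *: (f * g) = c *: f * g.
Proof. exact: (@scalerAl _ {mpoly A[N]}). Qed.
HB.instance Definition _ :=
  GRing.Lmodule_isLalgebra.Build k kmpoly kmpoly_scaleAl.
HB.instance Definition _ := GRing.Lalgebra_isComAlgebra.Build k kmpoly.

Definition kmpolyC (a : A) : kmpoly := a%:MP.
Fact kmpolyC_zmod : zmod_morphism kmpolyC. Proof. exact: mpolyCB. Qed.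
Fact kmpolyC_monoid : monoid_morphism kmpolyC.
Proof. by split=> [|a b]; [exact: mpolyC1 | exact: mpolyCM]. Qed.
Fact kmpolyC_scalable : scalable kmpolyC.
Proof.
move=> c a; rewrite /kmpolyC -[RHS]/((c%:A : A) *: (a%:MP : {mpoly A[N]})).
by rewrite -mul_mpolyC -mpolyCM mulr_algl.
Qed.
HB.instance Definition _ := GRing.isZmodMorphism.Build A kmpoly kmpolyC kmpolyC_zmod.
HB.instance Definition _ := GRing.isMonoidMorphism.Build A kmpoly kmpolyC kmpolyC_monoid.
HB.instance Definition _ := GRing.isScalable.Build k A kmpoly *:%R kmpolyC kmpolyC_scalable.


Section EvalAlg.
Variable h : 'I_N -> A.
Definition eval_alg (f : {mpoly k[N]}) : A := mmap (in_alg A) h f.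
Fact eval_alg_zmod : zmod_morphism eval_alg.
Proof. by move=> a b; rewrite /eval_alg mmapB. Qed.
Fact eval_alg_monoid : monoid_morphism eval_alg.
Proof. by split=> [|a b]; rewrite /eval_alg ?rmorph1 ?rmorphM. Qed.
Fact eval_alg_scalable : scalable eval_alg.
Proof. by move=> c f; rewrite /eval_alg mmapZ /= mulr_algl. Qed.
HB.instance Definition _ :=
  GRing.isZmodMorphism.Build {mpoly k[N]} A eval_alg eval_alg_zmod.
HB.instance Definition _ :=
  GRing.isMonoidMorphism.Build {mpoly k[N]} A eval_alg eval_alg_monoid.
HB.instance Definition _ :=
  GRing.isScalable.Build k {mpoly k[N]} A *:%R eval_alg eval_alg_scalable.
Lemma eval_algX m : eval_alg 'X_[m] = mmap1 h m.
Proof. exact: mmapX. Qed.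
Lemma eval_algXU i : eval_alg 'X_i = h i.
Proof. by rewrite eval_algX mmap1U. Qed.
End EvalAlg.
End KAlgMPoly.

Section Canonical.
Variable k : fieldType.

Definition genmx (m n : nat) : 'M[{mpoly k[m * n]}]_(m, n) :=
  \matrix_(i, j) 'X_(mxtens_index (i, j)).

Definition vec_mxtens (R : Type) m n (X : 'M[R]_(m, n)) (l : 'I_(m * n)) : R :=
  X (mxtens_unindex l).1 (mxtens_unindex l).2.

(* The linear map Gamma^d(Hom(V, W)) -> Hom(F(V), F(W)) attached to a functor of
   degree d, on the basis of orbit sums: the value at e_b is the coefficient, in
   the value of F at the generic matrix, of the monomial of b.  By [spf_mor_lin]
   it sends f^{(x) d}, whose coordinate at e_b is the product of the coordinates
   f_(b_i), to F(f), over any A. *)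
Definition spf_lin (d : nat) (F : spfunctor k) (V W : vectType k)
  (b : mset_tuple d (dim V * dim W)) : 'M[k]_(dim (F V), dim (F W)) :=
  map_mx (mcoeff (s2m (val b))) (spf_mor F (genmx (dim V) (dim W))).
Arguments spf_lin [d] F V W b.

Lemma map_genmx (A : comAlgType k) m n (X : 'M[A]_(m, n)) :
  map_mx (eval_alg (vec_mxtens X)) (genmx m n) = X.
Proof.
by apply/matrixP=> i j; rewrite !mxE eval_algXU /vec_mxtens mxtens_indexK.
Qed.

Lemma spf_mor_eval (F : spfunctor k) (A : comAlgType k) (V W : vectType k)
  (X : 'M[A]_(dim V, dim W)) :
  spf_mor F X =
  map_mx (eval_alg (vec_mxtens X)) (spf_mor F (genmx (dim V) (dim W))).
Proof. by rewrite spf_natural map_genmx. Qed.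

Lemma spf_mor_deg (d : nat) (F : spfunctor k) (V W : vectType k) i j
    (m : 'X_{1..dim V * dim W}) : homogeneous d F -> mdeg m != d ->
  (spf_mor F (genmx (dim V) (dim W)) i j)@_m = 0.
Proof.
set N := (dim V * dim W)%N in m *; set f := spf_mor F _ i j => hF md.
pose B : comAlgType k := kmpoly {mpoly k[N]} 1.
pose T : B := ('X_ord0 : {mpoly {mpoly k[N]}[1]}).
pose C : {mpoly k[N]} -> B := @kmpolyC k {mpoly k[N]} 1.
have := hF B V W T (map_mx C (genmx (dim V) (dim W))).
rewrite -(spf_natural F (@kmpolyC k {mpoly k[N]} 1)) => /matrixP/(_ i j).
rewrite spf_mor_eval !mxE -/f.
set h := vec_mxtens _; rewrite {1}(mpolyE f) rmorph_sum /=.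
have hX l : h l = T * C 'X_l.
  rewrite /h /vec_mxtens !mxE; congr (_ * C 'X_ _).
  by rewrite -[RHS]mxtens_unindexK; case: mxtens_unindex.
have hm (q : 'X_{1..N}) : mmap1 h q = T ^+ mdeg q * C 'X_[q].
  rewrite /mmap1; under eq_bigr do rewrite hX exprMn.
  rewrite big_split /= mdegE -expr_sum; congr (_ * _).
  rewrite mpolyXE_id /C rmorph_prod /=; apply: eq_bigr=> l _; exact/esym/rmorphXn.
move/(congr1 (fun g : {mpoly {mpoly k[N]}[1]} => (g@_(U_(ord0) *+ mdeg m))@_m)).
have CT (g : {mpoly k[N]}) e : (T ^+ e * C g : {mpoly {mpoly k[N]}[1]})@_(U_(ord0) *+ mdeg m)
    = g *+ (e == mdeg m).
  rewrite /T /C /kmpolyC mulrC mcoeffCM mpolyXn mcoeffX.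
  have -> : (U_(ord0) *+ e == U_(ord0) *+ mdeg m :> 'X_{1..1})%MM = (e == mdeg m).
    apply/eqP/eqP=> [/mnmP/(_ ord0)|-> //]; rewrite !mulmnE mnmE eqxx !mul1n //.
  by rewrite mulr_natr.
rewrite -/(C f) CT eq_sym (negPf md) mulr0n mcoeff0 => <-.
rewrite (raddf_sum (mcoeff (U_(ord0) *+ mdeg m))) (raddf_sum (mcoeff m)) /=.
rewrite {1}(mpolyE f) (raddf_sum (mcoeff m)) /=; apply: eq_bigr=> q _.
have -> : eval_alg h (f@_q *: 'X_[q]) = f@_q *: (T ^+ mdeg q * C 'X_[q]).
  by rewrite linearZ; congr (_ *: _); rewrite -hm; exact: (eval_algX h q).
rewrite -[X in (X : {mpoly _[1]})@__]/((f@_q)%:A *: (T ^+ mdeg q * C 'X_[q] : {mpoly {mpoly k[N]}[1]})).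
rewrite [LHS]mcoeffZ mcoeffX [X in _ = X@_m]mcoeffZ CT alg_mpolyC mcoeffCM mcoeffMn mcoeffX.
by have [->|] := eqVneq q m; rewrite ?eqxx ?mul0rn.
Qed.

Lemma spf_mor_lin (d : nat) (F : spfunctor k) (A : comAlgType k)
    (V W : vectType k) (X : 'M[A]_(dim V, dim W)) : homogeneous d F ->
  spf_mor F X =
  \sum_(b : mset_tuple d (dim V * dim W))
    (\prod_(i < d) vec_mxtens X (tnth (val b) i)) *:
    map_mx (in_alg A) (spf_lin F V W b).
Proof.
move=> hF; apply/matrixP=> i j; rewrite spf_mor_eval !mxE summxE.
set f := spf_mor F _ i j; rewrite {1}/eval_alg /mmap.
pose t (b : mset_tuple d (dim V * dim W)) := s2m (val b).
have t_inj : injective t.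
  by move=> b c bc; apply/val_inj/(@inj_s2m _ d); rewrite ?inE ?(valP b) ?(valP c).
transitivity (\sum_(m <- [seq t b | b : mset_tuple d (dim V * dim W)])
    in_alg A f@_m * mmap1 (vec_mxtens X) m); last first.
  rewrite big_map big_enum /=; apply: eq_bigr=> b _; rewrite !mxE mulrC.
  congr (_ * _); rewrite /mmap1 -(big_tuple _ _ (val b) predT) /=.
  rewrite [RHS](partition_big id predT) //=. apply: eq_bigr=> l _.
  rewrite (eq_bigr (fun=> vec_mxtens X l)) => [|x /eqP-> //].
  by rewrite big_const_seq iter_mulr_1 mnmE.
have t_uniq : uniq [seq t b | b : mset_tuple d (dim V * dim W)].
  by rewrite map_inj_uniq // enum_uniq.
rewrite [RHS](bigID (mem (msupp f))) /= [X in _ + X]big1 ?addr0; last first.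
  by move=> m /memN_msupp_eq0->; rewrite /= scale0r mul0r.
rewrite -[RHS]big_filter; apply/perm_big/uniq_perm; rewrite ?filter_uniq //.
move=> m; rewrite mem_filter andbC /=; apply/idP/andP=> [fm | [] //].
have md : mdeg m = d.
  by apply/eqP; apply: contraLR fm => md; rewrite -mcoeff_eq0 (spf_mor_deg _ _ hF md).
have sz : size (m2s m) == d by rewrite size_m2s md.
split=> //; apply/mapP.
by exists (Sub (Tuple sz) (srt_m2s m)); rewrite ?mem_enum // /t /= s2mK.
Qed.

Variables (d : nat) (F : hspfunctor k d) (n : nat).

Lemma eq_s2m N (w : d.-tuple 'I_N) (a : mset_tuple d N) :
  (s2m w == s2m (val a)) = perm_eq w (val a).
Proof.
apply/eqP/idP=> [/mnmP h | /seq.permP h]; last by apply/mnmP=> l; rewrite !mnmE.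
by apply/allP=> l _; move: (h l); rewrite !mnmE => /= ->.
Qed.

Lemma mpolyX_word (R : comNzRingType) N (w : d.-tuple 'I_N) :
  \prod_(i < d) ('X_(tnth w i) : {mpoly R[N]}) = 'X_[s2m w].
Proof.
rewrite -(big_tuple _ _ w predT (fun l => 'X_l : {mpoly R[N]})) /=.
rewrite mpolyXE_id (partition_big id predT) //=; apply: eq_bigr=> l _.
rewrite (eq_bigr (fun=> 'X_l)) => [|x /eqP-> //].
by rewrite big_const_seq iter_mulr_1 mnmE.
Qed.

Lemma spf_lin_comp (A : comAlgType k) (V W : vectType k)
    (X : 'M[A]_(dim V, dim W))
    (a : mset_tuple d (dim (kspace k n) * dim V)) :
  map_mx (in_alg A) (spf_lin F (kspace k n) V a) *m spf_mor F X =
  \sum_(c : mset_tuple d (dim (kspace k n) * dim W))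
    gamma_coef ((1%:M : 'M[A]_n) *t X) a (val c) *:
    map_mx (in_alg A) (spf_lin F (kspace k n) W c).
Proof.
pose N := (n * dim V)%N; pose B : comAlgType k := kmpoly A N.
pose C : {lrmorphism A -> B} := @kmpolyC k A N.
pose Z : 'M[B]_(dim (kspace k n), dim V) :=
  \matrix_(i, j) ('X_(mxtens_index (i, j)) : {mpoly A[N]}).
have CA (x : k) : in_alg B x = C (in_alg A x).
  by rewrite /= linearZ /= rmorph1.
have vZ l : vec_mxtens Z l = ('X_l : {mpoly A[N]}).
  by rewrite /vec_mxtens mxE; congr 'X_ _; rewrite -[RHS]mxtens_unindexK; case: mxtens_unindex.
have vZX l : vec_mxtens (Z *m map_mx C X) l =
    \sum_(w < N) ('X_w : {mpoly A[N]}) * C (((1%:M : 'M[A]_n) *t X) w l).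
  rewrite (reindex (@mxtens_index n (dim V))) /=; last first.
    by exists (@mxtens_unindex _ _)=> x _; rewrite ?mxtens_indexK ?mxtens_unindexK.
  case: (mxtens_indexP l)=> l1 l2; rewrite /vec_mxtens mxtens_indexK /= mxE.
  transitivity (\sum_x \sum_y ('X_(mxtens_index (x, y)) : {mpoly A[N]}) *
      C (((1%:M : 'M[A]_n) *t X) (mxtens_index (x, y)) (mxtens_index (l1, l2)))).
    rewrite (bigD1 l1) //=.
    rewrite [X in _ = _ + X]big1 ?addr0 => [|x xl1].
      by apply: eq_bigr=> y _; rewrite tensmxE !mxE eqxx mul1r.
    by rewrite big1 // => y _; rewrite tensmxE mxE (negPf xl1) mul0r rmorph0 mulr0.
  by rewrite pair_bigA; apply: eq_bigr=> -[x y] _.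
have prodZX (c : mset_tuple d (n * dim W)) :
    \prod_(i < d) vec_mxtens (Z *m map_mx C X) (tnth (val c) i) =
    \sum_(w : d.-tuple 'I_N) ('X_[s2m w] : {mpoly A[N]}) *
      C (word_prod ((1%:M : 'M[A]_n) *t X) w (val c)).
  under eq_bigr do rewrite vZX.
  rewrite bigA_distr_bigA /= (reindex (fun v : d.-tuple 'I_N => [ffun i => tnth v i])) /=.
    apply: eq_bigr=> v _; rewrite big_split /=; congr (_ * _).
      by rewrite -mpolyX_word; apply: eq_bigr=> i _; rewrite ffunE.
    by rewrite rmorph_prod; apply: eq_bigr=> i _; rewrite ffunE.
  exists (fun f : {ffun 'I_d -> 'I_N} => [tuple f i | i < d])=> [v _ | f _].
    by apply: eq_from_tnth=> i; rewrite tnth_mktuple ffunE.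
  by apply/ffunP=> i; rewrite ffunE tnth_mktuple.
have prodZ (b : mset_tuple d N) :
    \prod_(i < d) vec_mxtens Z (tnth (val b) i) = ('X_[s2m (val b)] : {mpoly A[N]}).
  by rewrite -mpolyX_word; apply: eq_bigr=> i _; rewrite vZ.
apply/matrixP=> i j.
have := congr1 (fun M : 'M_(_, _) => M i j) (spf_comp F Z (map_mx C X)).
rewrite (spf_mor_lin Z (hspfP F)) (spf_mor_lin (_ *m _) (hspfP F)) -(spf_natural F C).
have cX m q c : (('X_[q] : {mpoly A[N]}) * C c)@_m = c *+ (q == m).
  by rewrite mulrC mcoeffCM mcoeffX mulr_natr.
have CAM p q (M : 'M[k]_(p, q)) :
    map_mx (in_alg B) M = map_mx C (map_mx (in_alg A) M).
  by apply/matrixP=> x y; rewrite !mxE CA.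
rewrite mulmx_suml !summxE.
under [X in X = _ -> _]eq_bigr do rewrite prodZX CAM mxE.
under [X in _ = X -> _]eq_bigr do rewrite prodZ CAM -scalemxAl -map_mxM mxE.
move/(congr1 (mcoeff (s2m (val a)) : {mpoly A[N]} -> A)).
rewrite !raddf_sum /= => hE.
transitivity (\sum_(b : mset_tuple d N)
   ((('X_[s2m (val b)] : {mpoly A[N]}) *
     C ((map_mx (in_alg A) (spf_lin F (kspace k n) V b) *m spf_mor F X) i j))@_(s2m (val a)))).
  rewrite (bigD1 a) //= cX eqxx mulr1n big1 ?addr0 // => b ba.
  rewrite cX eq_s2m perm_sort_mset.
  have -> : sort_mset (val b) = b by apply/eqP; rewrite -perm_sort_mset.
  by rewrite (negPf ba).
transitivity (\sum_(c : mset_tuple d (n * dim W))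
   ((\sum_(w : d.-tuple 'I_N) ('X_[s2m w] : {mpoly A[N]}) *
      C (word_prod ((1%:M : 'M[A]_n) *t X) w (val c))) *
     C (map_mx (in_alg A) (spf_lin F (kspace k n) W c) i j) : {mpoly A[N]})@_(s2m (val a))).
  symmetry; move: hE; under eq_bigr do rewrite mxE.
  under [X in _ = X -> _]eq_bigr do rewrite mxE.
  exact.
apply: eq_bigr=> c _; rewrite [RHS]mxE mulrC mcoeffCM mulrC; congr (_ * _).
rewrite raddf_sum /= /gamma_coef [RHS]big_mkcond /=; apply: eq_bigr=> w _.
by rewrite cX eq_s2m mulrb.
Qed.

(* Gamma^{d,n} : V |-> Gamma^d(Hom(k^n, V)) *)
Definition gamma_kHom : spfunctor k := spf_o (spf_gamma k d) (spf_kHom k n).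

Fact canon_src_homogeneous :
  homogeneous d (spf_tensor gamma_kHom (spf_const (F (kspace k n)))).
Proof.
have := spf_tensor_homogeneous
  (spf_o_homogeneous (@spf_gamma_homogeneous k d) (@spf_kHom_homogeneous k n))
  (@spf_const_homogeneous k (F (kspace k n))).
by rewrite muln1 addn0.
Qed.

(* Gamma^{d,n} (x) F(k^n) *)
Definition canon_src : hspfunctor k d := HSPFunctor canon_src_homogeneous.

(* e_a (x) x |-> F(e_a)(x) *)
Definition canon_mx (V : vectType k) : 'M[k]_(dim (canon_src V), dim (F V)) :=
  \matrix_(a, j) spf_lin F (kspace k n) V
    (enum_val (mxtens_unindex a).1) (mxtens_unindex a).2 j.

Fact canon_natural (A : comAlgType k) (V W : vectType k)
    (X : 'M[A]_(dim V, dim W)) :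
  spf_mor canon_src X *m map_mx (in_alg A) (canon_mx W) =
  map_mx (in_alg A) (canon_mx V) *m spf_mor F X.
Proof.
apply/matrixP=> a j; case: (mxtens_indexP a)=> {}a i.
have := congr1 (fun M : 'M_(_, _) => M i j) (spf_lin_comp X (enum_val a)).
rewrite !mxE => hE.
transitivity (\sum_l
    map_mx (in_alg A) (spf_lin F (kspace k n) V (enum_val a)) i l * spf_mor F X l j);
  last first.
  by apply: eq_bigr=> l _; rewrite !mxE mxtens_indexK.
rewrite hE summxE (reindex (@mxtens_index _ _)) /=; last first.
  by exists (@mxtens_unindex _ _)=> x _; rewrite ?mxtens_indexK ?mxtens_unindexK.
transitivity (\sum_c \sum_l
   (gamma_mx d ((1%:M : 'M[A]_n) *t X) *t 1%:M)
     (mxtens_index (a, i)) (mxtens_index (c, l)) *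
   (map_mx (in_alg A) (canon_mx W)) (mxtens_index (c, l)) j).
  by rewrite pair_bigA; apply: eq_bigr=> -[x y] _.
rewrite [RHS](reindex _ (onW_bij _ (@enum_val_bij _))) /=.
apply: eq_bigr=> c _; rewrite (bigD1 i) //= [X in _ + X]big1 ?addr0 => [|l li].
  by rewrite tensmxE !mxE mxtens_indexK eqxx mulr1.
by rewrite tensmxE !mxE eq_sym (negPf li) mulr0 mul0r.
Qed.

Definition canon : spf_hom canon_src F :=
  @SPFHom k canon_src F (fun V => Hom (canon_mx V)) canon_natural.

Definition n_generated : Prop := spf_epi (F := canon_src) (G := F) canon.

End Canonical.
Arguments spf_lin {k d} F V W b.

Section Resolved.
Variables (k : fieldType) (d : nat).

(* Exactness of a sequence of strict polynomial functors is exactness at each V;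
   P_i sits in homological degree i. *)
Record resolution (F : hspfunctor k d) := Resolution {
  res_ob :> nat -> hspfunctor k d;
  res_diff : forall i, spf_hom (res_ob i.+1) (res_ob i);
  res_aug : spf_hom (res_ob 0) F;
  res_aug_onto : forall V : vectType k, limg (res_aug V) = fullv;
  res_exact0 : forall V : vectType k, limg (res_diff 0 V) = lker (res_aug V);
  res_exactS : forall i (V : vectType k),
    limg (res_diff i.+1 V) = lker (res_diff i V) }.

Definition n_resolved (F : hspfunctor k d) (n : nat) : Prop :=
  exists P : resolution F, forall i, projective (P i) /\ n_generated (P i) n.

End Resolved.

Section HomogeneousConstructions.
Variable k : fieldType.

Definition Gamma d : hspfunctor k d := HSPFunctor (@spf_gamma_homogeneous k d).

Definition tensor d e (F : hspfunctor k d) (G : hspfunctor k e) :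
    hspfunctor k (d + e) :=
  HSPFunctor (spf_tensor_homogeneous (hspfP F) (hspfP G)).

(* F^(r) = F o I^(r) *)
Definition twist p (charp : p \in [pchar k]) r d (F : hspfunctor k d) :
    hspfunctor k (d * p ^ r) :=
  HSPFunctor (spf_o_homogeneous (hspfP F) (@spf_frob_homogeneous k p charp r)).

Fact precomp_ktens_homogeneous l d (F : hspfunctor k d) :
  homogeneous d (spf_o F (spf_ktens k l)).
Proof.
by have := spf_o_homogeneous (hspfP F) (@spf_ktens_homogeneous k l); rewrite muln1.
Qed.

(* V |-> F(k^l (x) V) *)
Definition precomp_ktens l d (F : hspfunctor k d) : hspfunctor k d :=
  HSPFunctor (@precomp_ktens_homogeneous l d F).

End HomogeneousConstructions.

(* Main.v *)
Require Import Defs.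
From HB Require Import structures.
From mathcomp Require Import all_boot all_order all_fingroup all_algebra.
From mathcomp Require Import mxtens mpoly zify.
From Stdlib Require Import IndefiniteDescription.

(** All five parts rest on three facts about functors of a fixed degree.

- Evaluation at [k^n]: the functor [gamE n E], that is
[V |-> Gamma^d(Hom(k^n, V)) (x) E], represents linear maps out of [E] (the Yoneda
lemma, [ev]). Hence the [n]-generated projectives are exactly the direct summands of
the [gamE n E] ([genproj_retract]), and to prove that an operation preserves them it
is enough to treat these.

- Construction of resolutions: a class of functors, each covered by a suitable
projective with kernel in the class, consists of resolved functors
([resolved_by_coind]).

- Splicing: a functor resolved by [n]-resolved functors is [n]-resolved
([resolved_by_trans], [n_resolved_trans]).

Part (ii): a monomial of degree [d] in the entries of a matrix involves at most [d]
rows, so every functor of degree [d] is [d]-generated ([homogeneous_generated]); the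
kernels of the covers have degree [d] again. Part (iv) holds because [k^n] is a
direct summand of [k^(n+1)]. Part (v): precomposition with [k^l (x) -] is exact and
sends [gamE n E] to [gamE (n l) E], as [Hom(k^n, k^l (x) V)] is [Hom(k^(n l), V)].
Part (iii): in [Gamma^(d1+d2)] of a direct sum, the component of bidegree [(d1, d2)]
is [Gamma^d1 (x) Gamma^d2], so the tensor product of [gamE n1 E1] and [gamE n2 E2]
is a direct summand of [gamE (n1+n2) (E1 (x) E2)] ([tensor_gamE]); splicing treats
the two factors in turn.

Part (i) is by induction on the number of twists, and starts with the representable
functor [Gamma^d]. The induction step is an exact sequence in the manner of Troesch.
Linear forms on [Gamma^(d p)(k^p (x) V)] are homogeneous polynomials of degree [d p]
in variables [x_(i, j)], with [i < p] and [j] ranging over a basis of [V]. The shift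
[x_(i, j) |-> x_(i+1, j)] extends to a derivation [D], natural in [V], with [D^p = 0]
in characteristic [p], which raises by one the weight in which [x_(i, j)] counts for
[i]. The quotients [ker D^e / im D^(p-e)] vanish in positive weight, and the kernel
of [D] in weight zero consists of the polynomials in the [x_(0, j)^p], which form the
dual of the twisted [Gamma^d(V)] ([graded_acyclic], [graded_cycle0]). Alternating [D]
and [D^(p-1)] from weight zero upwards gives a resolution of the twist of [Gamma^d] by
direct summands of [Gamma^(d p)(k^p (x) -)], which remains a resolution after [r]
further twists. By part (v) and the induction hypothesis its terms are
[p^(r+1)]-resolved, and splicing concludes.

The acyclicity of [D] is proved one block [x_(0, j), ..., x_(p-1, j)] at a time. The
powers [x_(0, j)^p] are invariants that are divided out ([cycle_block]), which leaves
the quotients of the polynomials by [x_(0, j)^p, x_(s, j), ..., x_(p-1, j)]. Their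
acyclicity in large degree is by induction on [s] ([acyclic_block]): with
[z = x_(s, j)] and [y = x_(s-1, j)], the element [y/z] has derivative one away from
[z = 0], so a cycle becomes a boundary after multiplication by [z^(p-1)]; the locus
[z = 0] is governed by the induction hypothesis, which allows to divide by [z]
([acyclic_step]). *)

Set Implicit Arguments.
Unset Strict Implicit.
Unset Printing Implicit Defensive.

Import GRing.Theory VectorInternalTheory.
Local Open Scope ring_scope.

(** * Exact sequences of strict polynomial functors *)

Section Exactness.
Variable k : fieldType.

Section Matrices.

Definition mexact m n q (G : 'M[k]_(m, n)) (F : 'M[k]_(n, q)) : Prop :=
  G *m F = 0 /\
  forall r (x : 'M[k]_(r, n)), x *m F = 0 -> exists y, x = y *m G.

Lemma mexactP m n q (G : 'M[k]_(m, n)) (F : 'M[k]_(n, q)) :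
  mexact G F <-> (G :=: kermx F)%MS.
Proof.
split=> [[GF ex] | eGF]; last first.
  split; first by apply/sub_kermxP; rewrite eGF.
  by move=> r x /sub_kermxP; rewrite -eGF => /submxP.
apply/eqmxP/andP; split; first exact/sub_kermxP.
by have [|y e] := ex _ (kermx F); [apply: mulmx_ker | apply/submxP; exists y].
Qed.

Lemma row_freeP2 m n (G : 'M[k]_(m, n)) :
  row_free G <-> forall r (x : 'M[k]_(r, m)), x *m G = 0 -> x = 0.
Proof.
split=> [fG r x xG | h]; first by apply: (row_free_inj fG); rewrite mul0mx.
by rewrite -kermx_eq0; apply/eqP/h/mulmx_ker.
Qed.

Lemma row_full_lift m n (F : 'M[k]_(m, n)) r (x : 'M_(r, n)) :
  row_full F -> exists y, x = y *m F.
Proof. by move=> fF; apply/submxP/submx_full. Qed.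

Lemma row_full_id m n (F : 'M[k]_(m, n)) y : 1%:M = y *m F -> row_full F.
Proof. by move=> e; rewrite -sub1mx; apply/submxP; exists y. Qed.

Lemma row_full_left m n (F : 'M[k]_(m, n)) :
  row_full F <-> forall r (x : 'M[k]_(n, r)), F *m x = 0 -> x = 0.
Proof.
split=> [fF r x Fx | h]; first by rewrite -[x]mul1mx -(mulVpmx fF) -mulmxA Fx mulmx0.
rewrite /row_full -mxrank_tr -/(row_free F^T); apply/row_freeP2=> r x xF.
by apply: trmx_inj; rewrite trmx0; apply: h; apply: trmx_inj; rewrite trmx_mul trmxK xF trmx0.
Qed.

(** Over a field, exactness is a rank condition, hence self-dual: it may be
checked on column vectors instead of row vectors. *)
Lemma mexact_col m n q (G : 'M[k]_(m, n)) (F : 'M[k]_(n, q)) :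
  G *m F = 0 -> (forall c : 'cV[k]_n, G *m c = 0 -> exists c', c = F *m c') ->
  mexact G F.
Proof.
move=> GF ex; split=> // r x xF.
apply/submxP; rewrite submxE; apply/eqP.
apply/matrixP=> i j; have [|c' e] := ex (col j (cokermx G)).
  by rewrite colE mulmxA mulmx_coker mul0mx.
have : col j (x *m cokermx G) = 0.
  by rewrite colE -mulmxA -colE e mulmxA xF mul0mx.
by move/matrixP/(_ i ord0); rewrite [LHS]mxE => ->; rewrite !mxE.
Qed.

End Matrices.

Implicit Types F G H K P : spfunctor k.

Definition hmx F G (f : spf_hom F G) (V : vectType k) : 'M[k]_(dim (F V), dim (G V)) :=
  f2mx (f V).

Definition natural_mx F G (M : forall V : vectType k, 'M[k]_(dim (F V), dim (G V))) :=
  forall (A : comAlgType k) (V W : vectType k) (X : 'M[A]_(dim V, dim W)),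
    spf_mor F X *m map_mx (in_alg A) (M W) = map_mx (in_alg A) (M V) *m spf_mor G X.

Definition mkhom F G M (natM : @natural_mx F G M) : spf_hom F G :=
  @SPFHom k F G (fun V => Hom (M V)) natM.

Lemma hmx_nat F G (f : spf_hom F G) : natural_mx (hmx f).
Proof. by case: f. Qed.

Lemma comp_lfun_mx (U V W : vectType k) (g : 'Hom(V, W)) (f : 'Hom(U, V)) :
  f2mx (g \o f)%VF = f2mx f *m f2mx g.
Proof.
apply/row_matrixP=> i; rewrite !rowE.
have e (U' V' : vectType k) (h : 'Hom(U', V')) (u : 'rV_(dim U')) :
    u *m f2mx h = v2r (h (r2v u)) by rewrite unlock /fun_of_lfun_def /= !r2vK.
by rewrite mulmxA !e comp_lfunE v2rK.
Qed.

Fact hid_nat F : @natural_mx F F (fun=> 1%:M).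
Proof. by move=> A V W X; rewrite !map_mx1 mulmx1 mul1mx. Qed.
Definition hid F : spf_hom F F := mkhom (@hid_nat F).

Fact hcomp_nat F G H (f : spf_hom F G) (g : spf_hom G H) :
  @natural_mx F H (fun V => hmx f V *m hmx g V).
Proof. by move=> A V W X; rewrite !map_mxM mulmxA hmx_nat -!mulmxA hmx_nat. Qed.
Definition hcomp F G H (f : spf_hom F G) (g : spf_hom G H) := mkhom (hcomp_nat f g).

Fact hzero_nat F G : @natural_mx F G (fun=> 0).
Proof. by move=> A V W X; rewrite !map_mx0 mulmx0 mul0mx. Qed.
Definition hzero F G : spf_hom F G := mkhom (@hzero_nat F G).

Definition surj F G (f : spf_hom F G) := forall V, row_full (hmx f V).

Definition ses K P F (i : spf_hom K P) (e : spf_hom P F) : Prop :=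
  forall V, [/\ row_free (hmx i V), mexact (hmx i V) (hmx e V) & row_full (hmx e V)].

Lemma mem_mx2vs (V : vectType k) m (M : 'M[k]_(m, dim V)) v :
  (v \in mx2vs M) = (v2r v <= M)%MS.
Proof. by rewrite -[LHS]/(<<v2r v>> <= <<M>>)%MS !genmxE. Qed.

Lemma mx2vs_eq (V : vectType k) m n (M : 'M[k]_(m, dim V)) (N : 'M[k]_(n, dim V)) :
  mx2vs M = mx2vs N <-> (M :=: N)%MS.
Proof.
split=> [/vspaceP e | e]; last by apply/vspaceP=> v; rewrite !mem_mx2vs e.
apply/eqmxP/andP; split; apply/row_subP=> i; rewrite -[row i _]r2vK -mem_mx2vs.
  by rewrite -e mem_mx2vs r2vK row_sub.
by rewrite e mem_mx2vs r2vK row_sub.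
Qed.

Lemma limg_mx2vs (V W : vectType k) (f : 'Hom(V, W)) : limg f = mx2vs (f2mx f).
Proof.
rewrite unlock /lfun_img_def; apply/mx2vs_eq => /=.
by apply/(eqmx_trans (eqmxMr _ (genmxE _))); rewrite mul1mx.
Qed.

Lemma limg_lkerP (U V W : vectType k) (g : 'Hom(U, V)) (f : 'Hom(V, W)) :
  limg g = lker f <-> mexact (f2mx g) (f2mx f).
Proof. by rewrite mexactP limg_mx2vs mx2vs_eq. Qed.

Lemma limg_fullP (V W : vectType k) (f : 'Hom(V, W)) :
  limg f = fullv <-> row_full (f2mx f).
Proof.
rewrite limg_mx2vs mx2vs_eq; split=> [e | fF]; first by rewrite -sub1mx e.
by apply/eqmxP; rewrite submx1 sub1mx.
Qed.

Lemma homogeneousE d (F : hspfunctor k d) (A : comAlgType k) (V W : vectType k) (a : A)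
  (X : 'M[A]_(dim V, dim W)) : spf_mor F (a *: X) = a ^+ d *: spf_mor F X.
Proof. exact: hspfP. Qed.

Lemma map_mx_alg (A B : comAlgType k) (phi : {lrmorphism A -> B}) m n (M : 'M[k]_(m, n)) :
  map_mx phi (map_mx (in_alg A) M) = map_mx (in_alg B) M.
Proof. by apply/matrixP=> i j; rewrite !mxE; exact: rmorph_alg. Qed.

Section Compression.
Variables (d : nat) (F : hspfunctor k d) (n : vectType k -> nat).
Variables (ci : forall V, 'M[k]_(n V, dim (F V))) (cr : forall V, 'M[k]_(dim (F V), n V)).

Definition compress_mor (A : comAlgType k) (V W : vectType k) (X : 'M[A]_(dim V, dim W)) :=
  map_mx (in_alg A) (ci V) *m spf_mor F X *m map_mx (in_alg A) (cr W).

Hypothesis cirK : forall V, ci V *m cr V = 1%:M.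
Hypothesis ciM : forall (A : comAlgType k) (U V W : vectType k)
  (X : 'M[A]_(dim U, dim V)) (Y : 'M[A]_(dim V, dim W)),
  compress_mor (X *m Y) = compress_mor X *m compress_mor Y.

Fact compress_natural (A B : comAlgType k) (phi : {lrmorphism A -> B}) (V W : vectType k)
  (X : 'M[A]_(dim V, dim W)) : map_mx phi (compress_mor X) = compress_mor (map_mx phi X).
Proof. by rewrite /compress_mor !map_mxM !map_mx_alg spf_natural. Qed.

Fact compress_id (A : comAlgType k) (V : vectType k) : @compress_mor A V V 1%:M = 1%:M.
Proof. by rewrite /compress_mor spf_id mulmx1 -map_mxM cirK map_mx1. Qed.

Definition compress_spf : spfunctor k :=
  @SPFunctor k (fun V => kspace k (n V)) compress_mor compress_natural compress_id ciM.

Fact compress_homogeneous : homogeneous d compress_spf.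
Proof. by move=> A V W a X; rewrite /= /compress_mor homogeneousE -scalemxAr -scalemxAl. Qed.

(** Kernels and cokernels are split off from the spaces [F V] by matrices [ci] and
[cr] over [k] that are not natural in [V]; the action of [F], compressed along
them, is that of the kernel or cokernel. *)
Definition compress : hspfunctor k d := HSPFunctor compress_homogeneous.

End Compression.

Section Kernel.
Variables (d : nat) (F : hspfunctor k d) (G : spfunctor k) (f : spf_hom F G).

Lemma kernel_split m n (M : 'M[k]_(m, n)) (i := row_base (kermx M)) (r := pinvmx i) :
  [/\ i *m M = 0, i *m r = 1%:M & exists T, 1%:M - r *m i = M *m T].
Proof.
have iM : i *m M = 0 by apply/sub_kermxP; rewrite eq_row_base.
have ir : i *m r = 1%:M by apply/mulmxVp/row_base_free.
split=> //; exists (pinvmx M *m (1%:M - r *m i)).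
pose N := 1%:M - r *m i; have kN (x : 'M_m) : x *m M = 0 -> x *m N = 0.
  move/sub_kermxP; rewrite -(eq_row_base (kermx M)) => /submxP[y ->].
  by rewrite -mulmxA mulmxBr mulmx1 mulmxA ir mul1mx subrr mulmx0.
rewrite mulmxA; apply/eqP; rewrite -subr_eq0 -/N -{1}[N]mul1mx -mulmxBl; apply/eqP/kN.
by rewrite mulmxBl mul1mx mulmxKpV // subrr.
Qed.

(** The defect of [r i] from the identity factors through [f]; unlike an
inclusion of kernels, this is stable under extension of scalars. *)
Lemma compress_kernel (n : vectType k -> nat) (i : forall V, 'M[k]_(n V, dim (F V)))
    (r : forall V, 'M[k]_(dim (F V), n V)) :
    (forall V, i V *m hmx f V = 0) ->
    (forall V, exists T, 1%:M - r V *m i V = hmx f V *m T) ->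
  forall (A : comAlgType k) (V W : vectType k) (X : 'M[A]_(dim V, dim W)),
    compress_mor i r X *m map_mx (in_alg A) (i W) = map_mx (in_alg A) (i V) *m spf_mor F X.
Proof.
move=> i0 ri A V W X.
have kX0 : map_mx (in_alg A) (i V) *m spf_mor F X *m map_mx (in_alg A) (hmx f W) = 0.
  by rewrite -mulmxA (hmx_nat f) mulmxA -map_mxM i0 map_mx0 mul0mx.
have [T hT] := ri W; apply/eqP; rewrite eq_sym -subr_eq0 /compress_mor.
rewrite -[X in X - _]mulmx1 -[_ *m _ *m map_mx _ (i W)]mulmxA -map_mxM -mulmxBr.
by rewrite -(map_mx1 (in_alg A)) -map_mxB hT map_mxM mulmxA kX0 mul0mx.
Qed.

Let ki V := row_base (kermx (hmx f V)).
Let kr V := pinvmx (ki V).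

Let ki0 V : ki V *m hmx f V = 0. Proof. by case: (kernel_split (hmx f V)). Qed.
Let kir V : ki V *m kr V = 1%:M. Proof. by case: (kernel_split (hmx f V)). Qed.
Let kri V : exists T, 1%:M - kr V *m ki V = hmx f V *m T.
Proof. by case: (kernel_split (hmx f V)). Qed.

Let kM (A : comAlgType k) (U V W : vectType k)
  (X : 'M[A]_(dim U, dim V)) (Y : 'M[A]_(dim V, dim W)) :
  compress_mor ki kr (X *m Y) = compress_mor ki kr X *m compress_mor ki kr Y.
Proof.
by rewrite {3}/compress_mor !mulmxA (compress_kernel ki0 kri) /compress_mor spf_comp !mulmxA.
Qed.

Definition hker : hspfunctor k d := compress kir kM.

Fact ker_inc_nat : @natural_mx hker F ki.
Proof. by move=> A V W X; apply: compress_kernel. Qed.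

Definition ker_inc : spf_hom hker F := mkhom ker_inc_nat.

Lemma ker_inc_free V : row_free (hmx ker_inc V).
Proof. exact: row_base_free. Qed.

Lemma ker_inc_exact V : mexact (hmx ker_inc V) (hmx f V).
Proof. by apply/mexactP; apply: eq_row_base. Qed.

Lemma ker_ses : surj f -> ses ker_inc f.
Proof. by move=> sf V; split; [apply: ker_inc_free | apply: ker_inc_exact | apply: sf]. Qed.

End Kernel.

Section Cokernel.
Variables (d : nat) (F : spfunctor k) (G : hspfunctor k d) (f : spf_hom F G).

(* The cokernel is built from the kernel of the transposed matrices. *)
Let cp V := (row_base (kermx (hmx f V)^T))^T.
Let cs V := (pinvmx (row_base (kermx (hmx f V)^T)))^T.

Let cp0 V : hmx f V *m cp V = 0.
Proof.
have [h _ _] := kernel_split (hmx f V)^T.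
by apply: trmx_inj; rewrite trmx_mul trmxK h trmx0.
Qed.

Let csp V : cs V *m cp V = 1%:M.
Proof.
have [_ h _] := kernel_split (hmx f V)^T.
by rewrite -trmx_mul h trmx1.
Qed.

Let cps V : exists T, 1%:M - cp V *m cs V = T *m hmx f V.
Proof.
have [_ _ [T h]] := kernel_split (hmx f V)^T.
by exists T^T; apply: trmx_inj; rewrite raddfB /= !trmx_mul !trmxK trmx1 h.
Qed.

Lemma compress_cokernel (n : vectType k -> nat) (s : forall V, 'M[k]_(n V, dim (G V)))
    (p : forall V, 'M[k]_(dim (G V), n V)) :
    (forall V, hmx f V *m p V = 0) ->
    (forall V, exists T, 1%:M - p V *m s V = T *m hmx f V) ->
  forall (A : comAlgType k) (V W : vectType k) (X : 'M[A]_(dim V, dim W)),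
    map_mx (in_alg A) (p V) *m compress_mor s p X = spf_mor G X *m map_mx (in_alg A) (p W).
Proof.
move=> p0 ps A V W X.
have kX0 : map_mx (in_alg A) (hmx f V) *m (spf_mor G X *m map_mx (in_alg A) (p W)) = 0.
  by rewrite mulmxA -(hmx_nat f) -mulmxA -map_mxM p0 map_mx0 mulmx0.
have [T hT] := ps V; apply/eqP; rewrite eq_sym -subr_eq0 /compress_mor.
rewrite -[map_mx _ (s V) *m _ *m _]mulmxA; set Y := _ *m map_mx _ (p W) in kX0 *.
rewrite mulmxA -map_mxM -[X in X - _]mul1mx -mulmxBl.
by rewrite -(map_mx1 (in_alg A)) -map_mxB hT map_mxM -mulmxA kX0 mulmx0.
Qed.

Let cM (A : comAlgType k) (U V W : vectType k)
  (X : 'M[A]_(dim U, dim V)) (Y : 'M[A]_(dim V, dim W)) :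
  compress_mor cs cp (X *m Y) = compress_mor cs cp X *m compress_mor cs cp Y.
Proof.
by rewrite {2}/compress_mor -mulmxA (compress_cokernel cp0 cps) /compress_mor spf_comp !mulmxA.
Qed.

Definition hcoker : hspfunctor k d := compress csp cM.

Fact coker_proj_nat : @natural_mx G hcoker cp.
Proof. by move=> A V W X; rewrite (compress_cokernel cp0 cps). Qed.

Definition coker_proj : spf_hom G hcoker := mkhom coker_proj_nat.

Lemma coker_proj0 V : hmx f V *m hmx coker_proj V = 0.
Proof. exact: cp0. Qed.

Lemma coker_proj_eq0 V : hmx coker_proj V = 0 -> row_full (hmx f V).
Proof.
move=> p0; have [T h] := cps V.
rewrite -sub1mx; apply/submxP; exists T.
by rewrite -h [cp V]p0 mul0mx subr0.
Qed.

End Cokernel.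

(** Testing an epimorphism against its cokernel shows that it is pointwise
surjective. *)
Lemma spf_epiP d (F G : hspfunctor k d) (f : spf_hom F G) : spf_epi f <-> surj f.
Proof.
split=> [ef V | sf H u v uv V].
  have /(congr1 f2mx) : coker_proj f V = hzero G (hcoker f) V; last exact: coker_proj_eq0.
  apply: ef => W; apply: val_inj.
  by rewrite /= !comp_lfun_mx [LHS]coker_proj0 mulmx0.
by apply/val_inj/(row_full_inj (sf V)); have := congr1 f2mx (uv V); rewrite !comp_lfun_mx.
Qed.

Lemma kernel_lift d K P F (i : spf_hom K P) (e : spf_hom P F) (X : hspfunctor k d)
    (h : spf_hom X P) : (forall V, row_free (hmx i V)) -> (forall V, mexact (hmx i V) (hmx e V)) ->
    (forall V, hmx h V *m hmx e V = 0) ->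
  exists h' : spf_hom X K, forall V, hmx h' V *m hmx i V = hmx h V.
Proof.
move=> fi ei he; pose M V := hmx h V *m pinvmx (hmx i V).
have hM V : M V *m hmx i V = hmx h V.
  have [_ ex] := ei V; have [y hy] := ex _ _ (he V).
  by rewrite /M hy mulmxKpV ?submxMl.
have natM : @natural_mx X K M.
  move=> A V W Y; have [j ij] := row_freeP (fi W).
  have inj q (u v : 'M[A]_(q, _)) :
      u *m map_mx (in_alg A) (hmx i W) = v *m map_mx (in_alg A) (hmx i W) -> u = v.
    move/(congr1 (mulmx^~ (map_mx (in_alg A) j))).
    by rewrite -!mulmxA -map_mxM ij map_mx1 !mulmx1.
  by apply: inj; rewrite -!mulmxA -map_mxM hM (hmx_nat i) mulmxA -map_mxM hM hmx_nat.
by exists (mkhom natM).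
Qed.

Lemma ses_lift d K P F (i : spf_hom K P) (e : spf_hom P F) (X : hspfunctor k d)
    (h : spf_hom X P) : ses i e -> (forall V, hmx h V *m hmx e V = 0) ->
  exists h' : spf_hom X K, forall V, hmx h' V *m hmx i V = hmx h V.
Proof. by move=> se; apply: kernel_lift => V; have [] := se V. Qed.

Lemma projective_lift d (P F G : hspfunctor k d) (e : spf_hom F G) (f : spf_hom P G) :
  projective P -> surj e -> exists g : spf_hom P F, forall V, hmx g V *m hmx e V = hmx f V.
Proof.
move=> pP /spf_epiP; move=> se; have [g hg] := pP F G e f se.
by exists g => V; rewrite /hmx -comp_lfun_mx hg.
Qed.

Lemma projectiveP d (P : hspfunctor k d) :
  (forall (F G : hspfunctor k d) (e : spf_hom F G) (f : spf_hom P G), surj e ->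
     exists g : spf_hom P F, forall V, hmx g V *m hmx e V = hmx f V) -> projective P.
Proof.
move=> h F G e f /spf_epiP/h => /(_ f)[g hg]; exists g => V.
by apply: val_inj; rewrite /= comp_lfun_mx; apply: hg.
Qed.

Section DirectSum.
Variables (d : nat) (F G : hspfunctor k d).

Let dmor (A : comAlgType k) (V W : vectType k) (X : 'M[A]_(dim V, dim W)) :=
  block_mx (spf_mor F X) 0 0 (spf_mor G X).

Fact dsum_natural (A B : comAlgType k) (phi : {lrmorphism A -> B}) (V W : vectType k)
  (X : 'M[A]_(dim V, dim W)) : map_mx phi (dmor X) = dmor (map_mx phi X).
Proof. by rewrite /dmor map_block_mx !map_mx0 !spf_natural. Qed.

Fact dsum_id (A : comAlgType k) (V : vectType k) : @dmor A V V 1%:M = 1%:M.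
Proof. by rewrite /dmor !spf_id -scalar_mx_block. Qed.

Fact dsum_comp (A : comAlgType k) (U V W : vectType k)
  (X : 'M[A]_(dim U, dim V)) (Y : 'M[A]_(dim V, dim W)) :
  dmor (X *m Y) = dmor X *m dmor Y.
Proof.
by rewrite /dmor mulmx_block !mulmx0 !mul0mx !addr0 !add0r !spf_comp.
Qed.

Definition dsum_spf : spfunctor k :=
  @SPFunctor k (fun V => kspace k (dim (F V) + dim (G V))) dmor
    dsum_natural dsum_id dsum_comp.

Fact dsum_homogeneous : homogeneous d dsum_spf.
Proof. by move=> A V W a X; rewrite /= /dmor !homogeneousE scale_block_mx !scaler0. Qed.

Definition dsum : hspfunctor k d := HSPFunctor dsum_homogeneous.

Fact dsum_in1_nat : @natural_mx F dsum (fun V => row_mx 1%:M 0).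
Proof.
move=> A V W X; rewrite !map_row_mx !map_mx0 !map_mx1 -[spf_mor dsum X]/(block_mx _ _ _ _).
by rewrite mul_mx_row mulmx1 mulmx0 mul_row_block !mul1mx !mulmx0 !mul0mx !addr0.
Qed.
Definition dsum_in1 : spf_hom F dsum := mkhom dsum_in1_nat.

Fact dsum_in2_nat : @natural_mx G dsum (fun V => row_mx 0 1%:M).
Proof.
move=> A V W X; rewrite !map_row_mx !map_mx0 !map_mx1 -[spf_mor dsum X]/(block_mx _ _ _ _).
by rewrite mul_mx_row mulmx1 mulmx0 mul_row_block !mul1mx !mulmx0 !mul0mx !add0r.
Qed.
Definition dsum_in2 : spf_hom G dsum := mkhom dsum_in2_nat.

Section Case.
Variables (H : spfunctor k) (f : spf_hom F H) (g : spf_hom G H).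
Fact dsum_case_nat : @natural_mx dsum H (fun V => col_mx (hmx f V) (hmx g V)).
Proof.
move=> A V W X; rewrite !map_col_mx -[spf_mor dsum X]/(block_mx _ _ _ _) mul_block_col mul_col_mx.
by rewrite !mul0mx addr0 add0r !hmx_nat.
Qed.
Definition dsum_case : spf_hom dsum H := mkhom dsum_case_nat.
End Case.

Definition dsum_pr1 := dsum_case (hid F) (hzero G F).
Definition dsum_pr2 := dsum_case (hzero F G) (hid G).

Lemma dsum_projective : projective F -> projective G -> projective dsum.
Proof.
move=> pF pG; apply: projectiveP => H K e f se.
have [g1 h1] := projective_lift (hcomp dsum_in1 f) pF se.
have [g2 h2] := projective_lift (hcomp dsum_in2 f) pG se.
exists (dsum_case g1 g2) => V.
rewrite [LHS]mul_col_mx h1 h2 -[hmx f V]mul1mx (@scalar_mx_block _ (dim (F V)) (dim (G V))).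
by rewrite /block_mx mul_col_mx.
Qed.

End DirectSum.

End Exactness.

(** * Resolutions by a class of functors *)

Section Resolutions.
Variables (k : fieldType) (d : nat).
Local Notation hsp := (hspfunctor k d).
Implicit Types A F G H K P Z : hsp.

Definition covered_by (Q C : hsp -> Prop) F : Prop :=
  exists K P (i : spf_hom K P) (e : spf_hom P F), [/\ Q P, C K & ses i e].

Definition resolved_by (Q : hsp -> Prop) F : Prop :=
  exists R : resolution F, forall i, Q (R i).

Lemma res_augP F (R : resolution F) : surj (res_aug R).
Proof. by move=> V; apply/limg_fullP/res_aug_onto. Qed.

Lemma res_diff0P F (R : resolution F) V : mexact (hmx (res_diff R 0) V) (hmx (res_aug R) V).
Proof. exact/limg_lkerP/res_exact0. Qed.

Lemma res_diffSP F (R : resolution F) i V :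
  mexact (hmx (res_diff R i.+1) V) (hmx (res_diff R i) V).
Proof. exact/limg_lkerP/res_exactS. Qed.

Lemma resolved_by_cover Q F : resolved_by Q F -> covered_by Q (resolved_by Q) F.
Proof.
case=> R QR; pose e := res_aug R; have se := ker_ses (@res_augP F R).
have [a ha] : exists a : spf_hom (R 1) (hker e),
    forall V, hmx a V *m hmx (ker_inc e) V = hmx (res_diff R 0) V.
  by apply: ses_lift se _ => V; case: (res_diff0P R V).
exists (hker e), (R 0%N), (ker_inc e), e; split=> //.
have a0 V r (x : 'M_(r, _)) : x *m hmx a V = 0 <-> x *m hmx (res_diff R 0) V = 0.
  rewrite -ha; split=> [|h]; first by rewrite mulmxA => ->; rewrite mul0mx.
  by apply: (row_free_inj (ker_inc_free e V)); rewrite -mulmxA h mul0mx.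
have aug V : limg (a V) = fullv.
  apply/limg_fullP; have [ie _] := ker_inc_exact e V.
  have [y hy] := (res_diff0P R V).2 _ _ ie; rewrite -sub1mx; apply/submxP; exists y.
  by apply: (row_free_inj (ker_inc_free e V)); rewrite -mulmxA [f2mx _ *m _]ha mul1mx.
have ex0 V : limg (res_diff R 1 V) = lker (a V).
  apply/limg_lkerP; have [h1 h2] := res_diffSP R 0 V; split; first exact/a0.
  by move=> r x /a0; apply: h2.
exists (@Resolution _ _ _ (fun i => R i.+1) (fun i => res_diff R i.+1) a aug ex0
  (fun i => @res_exactS _ _ _ R i.+1)) => i; exact: QR.
Qed.

(** The covers of the successive kernels splice into a resolution. The class [C] is
an invariant of the kernels, as in a proof by coinduction; exhibiting one replaces
the construction of a complex. *)
Lemma resolved_by_coind (Q C : hsp -> Prop) :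
  (forall F, C F -> covered_by Q C F) -> forall F, C F -> resolved_by Q F.
Proof.
move=> step F0 CF0.
have pick (F : {F | C F}) : {x : {K : {K | C K} & {P : hsp & (spf_hom (sval K) P * spf_hom P (sval F))%type}}
    | Q (projT1 (projT2 x)) /\ ses (projT2 (projT2 x)).1 (projT2 (projT2 x)).2}.
  apply: constructive_indefinite_description.
  have [K [P [i [e [QP CK se]]]]] := step _ (svalP F).
  by exists (existT _ (exist _ K CK) (existT _ P (i, e))).
pose st := fix st n : {F | C F} :=
  if n is m.+1 then projT1 (sval (pick (st m))) else exist _ F0 CF0.
pose P n := projT1 (projT2 (sval (pick (st n)))).
pose inc n : spf_hom (sval (st n.+1)) (P n) := (projT2 (projT2 (sval (pick (st n))))).1.
pose cov n : spf_hom (P n) (sval (st n)) := (projT2 (projT2 (sval (pick (st n))))).2.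
have QP n : Q (P n) by case: (svalP (pick (st n))).
have se n : ses (inc n) (cov n) by case: (svalP (pick (st n))).
pose diff n := hcomp (cov n.+1) (inc n).
have diffE n V r (x : 'M_(r, _)) : x *m hmx (diff n) V = 0 -> x *m hmx (cov n.+1) V = 0.
  move=> h; have [fi _ _] := se n V; apply: (row_free_inj fi).
  by rewrite -mulmxA h mul0mx.
have onto V : limg (cov 0%N V) = fullv by apply/limg_fullP; case: (se 0%N V).
have exc n V : mexact (hmx (diff n) V) (hmx (cov n) V).
  have [_ [ic ex] _] := se n V; have [_ _ fc] := se n.+1 V.
  split; first by rewrite -mulmxA ic mulmx0.
  move=> r x /ex[y ->]; exists (y *m pinvmx (hmx (cov n.+1) V)).
  by rewrite -mulmxA [_ *m hmx (diff n) V]mulmxA mulVpmx // mul1mx.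
have ex0 V : limg (diff 0%N V) = lker (cov 0%N V) by apply/limg_lkerP/exc.
have exS n V : limg (diff n.+1 V) = lker (diff n V).
  apply/limg_lkerP; have [h1 h2] := exc n.+1 V.
  split; first by rewrite -[f2mx (diff n V)]/(_ *m _) mulmxA h1 mul0mx.
  by move=> r x /diffE; apply: h2.
by exists (@Resolution _ _ F0 P diff (cov 0%N) onto ex0 exS).
Qed.

Section Splicing.
Variable Q : hsp -> Prop.
Hypothesis Q_projective : forall P, Q P -> projective P.
Hypothesis Q_dsum : forall P P', Q P -> Q P' -> Q (dsum P P').

Inductive extension_closure (B : hsp -> Prop) : hsp -> Prop :=
| ExtBase F : B F -> extension_closure B F
| Ext A F Z (i : spf_hom A F) (e : spf_hom F Z) : ses i e ->
    extension_closure B A -> extension_closure B Z -> extension_closure B F.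

(** Two consecutive covers make one, at the price of an extension of kernels: this
is how a resolution by resolved functors is compared with one by members of [Q]. *)
Lemma ses_comp (K0 P G Z F : hsp) (j : spf_hom K0 P) (a : spf_hom P G)
    (i : spf_hom Z G) (b : spf_hom G F) : ses j a -> ses i b ->
  exists K (u : spf_hom K0 K) (v : spf_hom K Z) (c : spf_hom K P),
    ses u v /\ ses c (hcomp a b).
Proof.
move=> sja sib; pose ab := hcomp a b.
have abE V : hmx ab V = hmx a V *m hmx b V by [].
have sab : surj ab.
  move=> V; have [_ _ fa] := sja V; have [_ _ fb] := sib V.
  by apply/row_full_left=> r x; rewrite abE -mulmxA => /((row_full_left _).1 fa)/((row_full_left _).1 fb).
pose c := ker_inc ab; have sc := ker_ses sab.
have c0 V : hmx c V *m (hmx a V *m hmx b V) = 0 by case: (ker_inc_exact ab V).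
have [u hu] : exists u : spf_hom K0 (hker ab), forall V, hmx u V *m hmx c V = hmx j V.
  apply: ses_lift sc _ => V; have [_ [ja _] _] := sja V.
  by rewrite abE mulmxA ja mul0mx.
have [v hv] : exists v : spf_hom (hker ab) Z,
    forall V, hmx v V *m hmx i V = hmx (hcomp c a) V.
  by apply: ses_lift sib _ => V; rewrite -mulmxA c0.
exists (hker ab), u, v, c; split=> // V.
have [fj [ja exj] fa] := sja V; have [fi [ib exi] fb] := sib V.
have [fc [_ exc] _] := sc V.
have hvV : hmx v V *m hmx i V = hmx c V *m hmx a V := hv V.
split.
- apply/row_freeP2=> r x xu; apply: (row_free_inj fj).
  by rewrite -hu mulmxA xu !mul0mx.
- split; first by apply: (row_free_inj fi); rewrite -mulmxA hvV mulmxA hu ja mul0mx.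
  move=> r x xv; have /exj[y hy] : (x *m hmx c V) *m hmx a V = 0.
    by rewrite -mulmxA -hvV mulmxA xv mul0mx.
  by exists y; apply: (row_free_inj fc); rewrite hy -mulmxA hu.
- pose s := hmx i V *m pinvmx (hmx a V).
  have sa : s *m hmx a V = hmx i V by rewrite -mulmxA mulVpmx // mulmx1.
  have /exc[y hy] : s *m (hmx a V *m hmx b V) = 0 by rewrite mulmxA sa ib.
  rewrite -sub1mx; apply/submxP; exists y; apply: (row_free_inj fi).
  by rewrite -mulmxA hvV mulmxA -hy sa mul1mx.
Qed.

(** The horseshoe lemma: the cover of [Z] lifts to [F] because [PZ] is projective,
and together with the cover of [A] it covers [F]. *)
Lemma ses_horseshoe (KA PA A F Z PZ KZ : hsp) (ja : spf_hom KA PA) (a : spf_hom PA A)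
    (i : spf_hom A F) (e : spf_hom F Z) (jz : spf_hom KZ PZ) (c : spf_hom PZ Z) :
    projective PZ -> ses ja a -> ses i e -> ses jz c ->
  exists K (u : spf_hom KA K) (v : spf_hom K KZ) (x : spf_hom K (dsum PA PZ))
      (f : spf_hom (dsum PA PZ) F), ses u v /\ ses x f.
Proof.
move=> pZ sa sie sc.
have [g hg] : exists g : spf_hom PZ F, forall V, hmx g V *m hmx e V = hmx c V.
  by apply: projective_lift pZ _ => V; case: (sie V).
pose f := dsum_case (hcomp a i) g.
have fE V m (x : 'M_(m, _)) (y : 'M_(m, _)) : row_mx x y *m hmx f V =
    x *m hmx a V *m hmx i V + y *m hmx g V.
  by rewrite [LHS]mul_row_col mulmxA.
have r1 V m (y : 'M_(m, _)) z : row_mx y z *m hmx (dsum_pr1 PA PZ) V = y.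
  by rewrite [LHS]mul_row_col mulmx0 addr0 mulmx1.
have r2 V m (y : 'M_(m, _)) z : row_mx y z *m hmx (dsum_pr2 PA PZ) V = z.
  by rewrite [LHS]mul_row_col mulmx0 add0r mulmx1.
have rowE V m (x : 'M_(m, dim (dsum PA PZ V))) :
    x = row_mx (x *m hmx (dsum_pr1 PA PZ) V) (x *m hmx (dsum_pr2 PA PZ) V).
  by rewrite -[x](@hsubmxK _ _ (dim (PA V)) (dim (PZ V))) r1 r2.
have sf : surj f.
  move=> V; have [_ [ie exi] fe] := sie V; have [_ _ fa] := sa V; have [_ _ fc] := sc V.
  have [y hy] := row_full_lift (hmx e V) fc.
  have [z hz] : exists z, 1%:M - y *m hmx g V = z *m hmx i V.
    by apply: exi; rewrite mulmxBl mul1mx -mulmxA hg hy subrr.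
  have [w hw] := row_full_lift z fa.
  by apply: (@row_full_id _ _ _ _ (row_mx w y)); rewrite fE -hw -hz subrK.
pose x := ker_inc f; have sx := ker_ses sf.
have x0 V : hmx x V *m hmx f V = 0 by case: (ker_inc_exact f V).
have pr2c V : hmx f V *m hmx e V = hmx (hcomp (dsum_pr2 PA PZ) c) V.
  have [_ [ie _] _] := sie V.
  by rewrite [LHS]mul_col_mx [RHS]mul_col_mx hg -mulmxA ie mulmx0 mul0mx mul1mx.
have [u hu] : exists u : spf_hom KA (hker f),
    forall V, hmx u V *m hmx x V = hmx (hcomp ja (dsum_in1 PA PZ)) V.
  apply: ses_lift sx _ => V; have [_ [ja0 _] _] := sa V.
  by rewrite -[LHS]mulmxA fE mul0mx addr0 mul1mx mulmxA ja0 mul0mx.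
have [v hv] : exists v : spf_hom (hker f) KZ,
    forall V, hmx v V *m hmx jz V = hmx (hcomp x (dsum_pr2 PA PZ)) V.
  by apply: ses_lift sc _ => V; rewrite -[LHS]mulmxA -[_ *m hmx c V]pr2c mulmxA x0 mul0mx.
exists (hker f), u, v, x, f; split=> // V.
have [fja [ja0 exja] fa] := sa V; have [fi [ie exi] fe] := sie V.
have [fjz [jzc exjz] fc] := sc V; have [fx [_ exx] _] := sx V.
have hvV : hmx v V *m hmx jz V = hmx x V *m hmx (dsum_pr2 PA PZ) V := hv V.
have huV : hmx u V *m hmx x V = row_mx (hmx ja V) 0.
  by rewrite hu [LHS]mul_mx_row mulmx1 mulmx0.
split.
- apply/row_freeP2=> r y yu; apply: (row_free_inj fja).
  have := congr1 (mulmx y) huV; rewrite mulmxA yu mul0mx mul_mx_row => /esym.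
  by move/(congr1 (mulmx^~ (hmx (dsum_pr1 PA PZ) V))); rewrite mulmx0 r1 !mul0mx.
- split; first by apply: (row_free_inj fjz); rewrite -mulmxA hvV mulmxA huV r2 mul0mx.
  move=> r y yv; pose t := y *m hmx x V.
  have t2 : t *m hmx (dsum_pr2 PA PZ) V = 0 by rewrite -mulmxA -hvV mulmxA yv mul0mx.
  have tE := rowE V r t; rewrite t2 in tE.
  have /exja[w hw] : t *m hmx (dsum_pr1 PA PZ) V *m hmx a V = 0.
    apply: (row_free_inj fi); have := fE V r (t *m hmx (dsum_pr1 PA PZ) V) 0.
    by rewrite -tE mul0mx addr0 mul0mx => <-; rewrite -mulmxA x0 mulmx0.
  exists w; apply: (row_free_inj fx).
  by rewrite -/t tE hw -mulmxA huV mul_mx_row mulmx0.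
- have [w hw] : exists w, - (hmx jz V *m hmx g V) = w *m hmx i V.
    by apply: exi; rewrite mulNmx -mulmxA hg jzc oppr0.
  have [t ht] := row_full_lift w fa.
  have /exx[y hy] : row_mx t (hmx jz V) *m hmx f V = 0.
    by rewrite fE -ht -hw addNr.
  apply: (@row_full_id _ _ _ _ y); apply: (row_free_inj fjz).
  by rewrite -mulmxA hvV mulmxA -hy r2 mul1mx.
Qed.

Lemma extension_cover (B : hsp -> Prop) :
  (forall F, B F -> covered_by Q (extension_closure B) F) ->
  forall F, extension_closure B F -> covered_by Q (extension_closure B) F.
Proof.
move=> step F; elim=> {F} [F /step // | A F Z i e se _ [KA [PA [ja [a [QA CA sa]]]]]].
move=> _ [KZ [PZ [jz [c [QZ CZ sc]]]]].
have [K [u [v [x [f [suv sxf]]]]]] := ses_horseshoe (Q_projective QZ) sa se sc.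
by exists K, (dsum PA PZ), x, f; split=> //; [apply: Q_dsum | apply: Ext suv CA CZ].
Qed.

(** The kernels met while resolving [F] are iterated extensions of functors
resolved by [Q] and of functors resolved by those; by the horseshoe, this class is
closed under passing to kernels of suitable covers. *)
Theorem resolved_by_trans F : resolved_by (resolved_by Q) F -> resolved_by Q F.
Proof.
pose B G := resolved_by Q G \/ resolved_by (resolved_by Q) G.
move=> rF; apply: (resolved_by_coind (C := extension_closure B)); last by apply: ExtBase; right.
apply: extension_cover => G [/resolved_by_cover | /resolved_by_cover].
  by case=> K [P [i [e [QP QK se]]]]; exists K, P, i, e; split=> //; apply: ExtBase; left.
case=> Z [G0 [i [b [/resolved_by_cover[K0 [P [j [a [QP QK0 sja]]]]] QZ sib]]]].
have [K [u [v [c [suv sc]]]]] := ses_comp sja sib.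
exists K, P, c, (hcomp a b); split=> //.
by apply: Ext suv _ _; apply: ExtBase; [left | right].
Qed.

End Splicing.
End Resolutions.

(** * Generation and the Yoneda lemma *)

Section Generation.
Variables (k : fieldType) (d : nat).
Implicit Types F G H : hspfunctor k d.

(** A map is onto when its transpose is injective, and the coefficients
[spf_lin] of [F] are recovered from the value of [F] at the generic matrix, which
lives over a polynomial algebra. In this form the condition passes to quotients,
direct sums and larger [n]. *)
Lemma n_generatedP F n : n_generated F n <->
  forall (V : vectType k) (c : 'cV[k]_(dim (F V))),
    (forall (A : comAlgType k) (X : 'M[A]_(dim (kspace k n), dim V)),
       spf_mor F X *m map_mx (in_alg A) c = 0) -> c = 0.
Proof.
have canonE V (c : 'cV[k]_(dim (F V))) :
    canon_mx F n V *m c = 0 <-> forall b : mset_tuple d (dim (kspace k n) * dim V), spf_lin F (kspace k n) V b *m c = 0.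
  split=> h.
    move=> b; apply/matrixP=> i j.
    have := congr1 (fun M : 'M_(dim (canon_src F n V), 1) => M (mxtens_index (enum_rank b, i)) j) h.
    rewrite mxE [RHS]mxE => e; rewrite mxE [RHS]mxE -[RHS]e; apply: eq_bigr => l _; congr (_ * _).
    by rewrite [RHS]mxE mxtens_indexK /= enum_rankK.
  apply/matrixP=> a j; case: (mxtens_indexP a)=> {}a i.
  have := congr1 (fun M : 'M_(_, _) => M i j) (h (enum_val a)).
  rewrite mxE [RHS]mxE => e; rewrite mxE [RHS]mxE -[RHS]e; apply: eq_bigr => l _; congr (_ * _).
  by rewrite [LHS]mxE mxtens_indexK.
have genE V (c : 'cV[k]_(dim (F V))) :
    (forall b : mset_tuple d (dim (kspace k n) * dim V), spf_lin F (kspace k n) V b *m c = 0) <->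
    forall (A : comAlgType k) (X : 'M[A]_(dim (kspace k n), dim V)),
      spf_mor F X *m map_mx (in_alg A) c = 0.
  split=> h.
    move=> A X; rewrite (spf_mor_lin X (hspfP F)) mulmx_suml big1 // => b _.
    by rewrite -scalemxAl -map_mxM h map_mx0 scaler0.
  move=> b; have := h {mpoly k[dim (kspace k n) * dim V]} (Defs.genmx k (dim (kspace k n)) (dim V)).
  move/(congr1 (map_mx (mcoeff (s2m (val b))))); rewrite raddf0 => <-.
  apply/matrixP=> i j; rewrite !mxE raddf_sum /=; apply: eq_bigr=> l _.
  by rewrite !mxE [in RHS]mulrC mulr_algl mcoeffZ mulrC.
rewrite /n_generated spf_epiP; split=> [gF V c hc | h V].
  have /row_full_left fc := gF V; apply: fc; exact/canonE/genE.
apply/row_full_left=> r x hx; apply/matrixP=> i j; rewrite [RHS]mxE.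
have /matrixP/(_ i ord0) : col j x = 0; last by rewrite !mxE.
by apply/h/genE/canonE; rewrite colE mulmxA [_ *m x]hx mul0mx.
Qed.

Lemma n_generated_surj F G (e : spf_hom F G) n :
  surj e -> n_generated F n -> n_generated G n.
Proof.
move=> se /n_generatedP gF; apply/n_generatedP=> V c hc.
have /row_full_left fe := se V; apply: fe; apply: gF => A X.
by rewrite map_mxM mulmxA hmx_nat -mulmxA hc mulmx0.
Qed.

Lemma n_generated_dsum F G n : n_generated F n -> n_generated G n -> n_generated (dsum F G) n.
Proof.
move=> /n_generatedP gF /n_generatedP gG; apply/n_generatedP=> V c.
rewrite -[c](@vsubmxK _ (dim (F V)) (dim (G V))) => hc.
have {}hc (A : comAlgType k) (X : 'M[A]_(dim (kspace k n), dim V)) :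
    spf_mor F X *m map_mx (in_alg A) (usubmx c) = 0 /\
    spf_mor G X *m map_mx (in_alg A) (dsubmx c) = 0.
  have := hc A X; rewrite map_col_mx [LHS]mul_block_col !mul0mx addr0 add0r.
  by rewrite -[0]col_mx0 => /eq_col_mx.
have -> : usubmx c = 0 by apply: gF => A X; case: (hc A X).
have -> : dsubmx c = 0 by apply: gG => A X; case: (hc A X).
exact: col_mx0.
Qed.

Lemma n_generatedS F n : n_generated F n -> n_generated F n.+1.
Proof.
move=> /n_generatedP gF; apply/n_generatedP=> V c hc; apply: gF => A X.
pose J : 'M[A]_(dim (kspace k n), dim (kspace k n.+1)) := pid_mx n.
pose Y : 'M[A]_(dim (kspace k n.+1), dim V) := (pid_mx n)^T *m X.
have -> : X = J *m Y.
  by rewrite mulmxA tr_pid_mx pid_mx_id ?leqnSn // pid_mx_1 mul1mx.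
by rewrite spf_comp -mulmxA hc mulmx0.
Qed.

Definition retract F G := exists (s : spf_hom F G) (r : spf_hom G F),
  forall V, hmx s V *m hmx r V = 1%:M.

Lemma projective_retract F G : retract F G -> projective G -> projective F.
Proof.
case=> s [r sr] pG; apply: projectiveP => H K e f se.
have [g hg] := projective_lift (hcomp r f) pG se.
by exists (hcomp s g) => V; rewrite -mulmxA hg mulmxA sr mul1mx.
Qed.

Lemma n_generated_retract F G n : retract F G -> n_generated G n -> n_generated F n.
Proof.
by case=> s [r sr]; apply: n_generated_surj => V; apply: row_full_id (esym (sr V)).
Qed.

Lemma retract_trans F G H : retract F G -> retract G H -> retract F H.
Proof.
case=> s [r sr] [s' [r' sr']]; exists (hcomp s s'), (hcomp r' r) => V.
by rewrite mulmxA -[_ *m hmx r' V]mulmxA sr' mulmx1 sr.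
Qed.

End Generation.

Section GammaEval.

Lemma sort_msetK d n (b : mset_tuple d n) : sort_mset (val b) = b.
Proof. by apply/eqP; rewrite -perm_sort_mset. Qed.

(** A product of [d] linear forms in the [y w], expanded along the monomials in
the [y w]: the coefficients are those of the [d]-th divided power. *)
Lemma gamma_eval (R : comNzRingType) d m n (M : 'M[R]_(m, n)) (y : 'I_m -> R)
    (v : d.-tuple 'I_n) :
  \sum_(a : mset_tuple d m) (\prod_(i < d) y (tnth (val a) i)) * gamma_coef M a v =
  \prod_(i < d) \sum_w y w * M w (tnth v i).
Proof.
pose Y : 'M[R]_(1, m) := \row_w y w; pose w0 : d.-tuple 'I_1 := [tuple ord0 | i < d].
transitivity (word_prod (Y *m M) w0 v); last first.
  by apply: eq_bigr => i _; rewrite mxE; apply: eq_bigr => w _; rewrite mxE.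
rewrite word_prodM (partition_big (@sort_mset d m) predT) //=; apply: eq_bigr => a _.
rewrite /gamma_coef mulr_sumr; apply: eq_big => [w | w]; rewrite perm_sort_mset // => /eqP wa.
congr (_ * _); rewrite /word_prod; transitivity (\prod_(i < d) y (tnth w i)).
  rewrite -(big_tuple _ _ w predT y) -(big_tuple _ _ (val a) predT y) /=.
  by apply: perm_big; rewrite perm_sym perm_sort_mset wa.
by apply: eq_bigr => i _; rewrite mxE.
Qed.

End GammaEval.

Section Yoneda.
Variables (k : fieldType) (d : nat).
Implicit Types F G H : hspfunctor k d.

Section TensorIndices.

Lemma sum_mxtens (R : nmodType) p q (f : 'I_(p * q) -> R) :
  \sum_a f a = \sum_i \sum_j f (mxtens_index (i, j)).
Proof.
rewrite (reindex (@mxtens_index p q)) /=; last first.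
  by exists (@mxtens_unindex _ _) => x _; rewrite ?mxtens_indexK ?mxtens_unindexK.
by rewrite pair_bigA; apply: eq_bigr => -[i j].
Qed.

Lemma vec_mxtensE (R : Type) p q (X : 'M[R]_(p, q)) i j :
  vec_mxtens X (mxtens_index (i, j)) = X i j.
Proof. by rewrite /vec_mxtens mxtens_indexK. Qed.

Lemma vec_mxtensM (R : comNzRingType) p q r (X : 'M[R]_(p, q)) (Y : 'M[R]_(q, r)) l :
  vec_mxtens (X *m Y) l = \sum_w vec_mxtens X w * ((1%:M : 'M_p) *t Y) w l.
Proof.
case: (mxtens_indexP l) => i j; rewrite vec_mxtensE mxE sum_mxtens.
rewrite (bigD1 i) //= [X in _ = _ + X]big1 ?addr0 => [|i' i'i].
  by apply: eq_bigr => h _; rewrite tensmxE vec_mxtensE mxE eqxx mul1r.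
by rewrite big1 // => h _; rewrite tensmxE mxE (negPf i'i) mul0r mulr0.
Qed.

End TensorIndices.

Section GammaTensor.
Variables (n : nat) (E : vectType k).

Fact gamE_homogeneous : homogeneous d (spf_tensor (gamma_kHom k d n) (spf_const E)).
Proof.
have := spf_tensor_homogeneous
  (spf_o_homogeneous (@spf_gamma_homogeneous k d) (@spf_kHom_homogeneous k n))
  (@spf_const_homogeneous k E).
by rewrite muln1 addn0.
Qed.

(** [V |-> Gamma^d(Hom(k^n, V)) (x) E] *)
Definition gamE : hspfunctor k d := HSPFunctor gamE_homogeneous.

(** The index of the basis vector [e_a (x) e_x] of [gamE V]. *)
Definition gix (V : vectType k) (a : mset_tuple d (n * dim V)) (x : 'I_(dim E)) :
  'I_(dim (gamE V)) := mxtens_index (enum_rank a, x).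
Arguments gix : clear implicits.

Definition gix_inv (V : vectType k) (i : 'I_(dim (gamE V))) :
    mset_tuple d (n * dim V) * 'I_(dim E) :=
  let ax := @mxtens_unindex #|{: mset_tuple d (n * dim V)}| (dim E) i in (enum_val ax.1, ax.2).

Lemma gixK V a x : gix_inv (gix V a x) = (a, x).
Proof.
by rewrite /gix_inv /gix (@mxtens_indexK #|{: mset_tuple d (n * dim V)}| (dim E)) /= enum_rankK.
Qed.

Lemma gix_invK V : cancel (@gix_inv V) (fun ax => gix V ax.1 ax.2).
Proof.
by move=> i; rewrite /gix_inv /gix enum_valK -surjective_pairing mxtens_unindexK.
Qed.

Lemma gixP (V : vectType k) (P : 'I_(dim (gamE V)) -> Prop) :
  (forall a x, P (gix V a x)) -> forall i, P i.
Proof. by move=> h i; rewrite -[i]gix_invK. Qed.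

Lemma sum_gix (R : nmodType) (V : vectType k) (f : 'I_(dim (gamE V)) -> R) :
  \sum_i f i = \sum_a \sum_x f (gix V a x).
Proof.
rewrite (@sum_mxtens _ #|{: mset_tuple d (n * dim V)}| (dim E)).
rewrite [RHS](reindex _ (onW_bij _ (@enum_val_bij _))) /=.
by apply: eq_bigr => a _; rewrite /gix enum_valK.
Qed.

Lemma gamE_mor (A : comAlgType k) (V W : vectType k) (X : 'M[A]_(dim V, dim W)) a x b y :
  spf_mor gamE X (gix V a x) (gix W b y) =
  gamma_coef ((1%:M : 'M[A]_n) *t X) a (val b) *+ (x == y).
Proof.
rewrite [LHS](tensmxE (gamma_mx d ((1%:M : 'M[A]_n) *t X)) (1%:M : 'M[A]_(dim E))).
by rewrite !mxE !enum_rankK mulr_natr.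
Qed.

(** The family of the elements [X^{(x) d} (x) x] of [gamE V], for [x] in the
basis of [E]. *)
Definition powmx (A : comAlgType k) (V : vectType k) (X : 'M[A]_(dim (kspace k n), dim V)) :
    'M[A]_(dim E, dim (gamE V)) :=
  \matrix_(x, i)
    ((\prod_(j < d) vec_mxtens X (tnth (val (gix_inv i).1) j)) *+ (x == (gix_inv i).2)).

Lemma powmxE (A : comAlgType k) (V : vectType k) (X : 'M[A]_(dim (kspace k n), dim V)) x a y :
  powmx X x (gix V a y) = (\prod_(j < d) vec_mxtens X (tnth (val a) j)) *+ (x == y).
Proof. by rewrite [LHS]mxE gixK. Qed.

Lemma mul_powmx (A : comAlgType k) (V : vectType k) (X : 'M[A]_(dim (kspace k n), dim V))
    q (M : 'M[A]_(dim (gamE V), q)) x j :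
  (powmx X *m M) x j =
  \sum_a (\prod_(i < d) vec_mxtens X (tnth (val a) i)) * M (gix V a x) j.
Proof.
rewrite mxE sum_gix; apply: eq_bigr => a _; rewrite (bigD1 x) //= [X in _ + X]big1 ?addr0.
  by rewrite powmxE eqxx.
by move=> y yx; rewrite powmxE eq_sym (negPf yx) mul0r.
Qed.

Lemma map_powmx (A B : comAlgType k) (phi : {rmorphism A -> B}) (V : vectType k)
    (X : 'M[A]_(dim (kspace k n), dim V)) : map_mx phi (powmx X) = powmx (map_mx phi X).
Proof.
apply/matrixP=> x i; elim/gixP: i => a y; rewrite mxE !powmxE rmorphMn rmorph_prod.
by congr (_ *+ _); apply: eq_bigr => j _; rewrite /vec_mxtens mxE.
Qed.

Lemma powmxM (A : comAlgType k) (V W : vectType k) (Y : 'M[A]_(dim (kspace k n), dim V))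
    (X : 'M[A]_(dim V, dim W)) :
  powmx Y *m spf_mor gamE X = powmx (Y *m X).
Proof.
apply/matrixP=> x i; elim/gixP: i => b y; rewrite mul_powmx powmxE.
under eq_bigr do rewrite gamE_mor mulrnAr.
rewrite sumrMnl gamma_eval; congr (_ *+ _).
by apply: eq_bigr => i _; rewrite vec_mxtensM.
Qed.

(** The coordinates of the generic element [X^{(x) d}] are distinct monomials, so
a linear map out of [gamE V], over any algebra, is determined by its values on
the elements [X^{(x) d} (x) x] over all larger algebras. *)
Lemma powmx_inj (A : comAlgType k) (V : vectType k) q (M N : 'M[A]_(dim (gamE V), q)) :
  (forall (B : comAlgType k) (phi : {lrmorphism A -> B}) (X : 'M[B]_(dim (kspace k n), dim V)),
     powmx X *m map_mx phi M = powmx X *m map_mx phi N) -> M = N.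
Proof.
move=> h; apply/matrixP=> i j; elim/gixP: i => a x.
pose B : comAlgType k := kmpoly A (n * dim V).
pose phi : {lrmorphism A -> B} := @kmpolyC k A (n * dim V).
pose X : 'M[B]_(dim (kspace k n), dim V) :=
  \matrix_(i, j) ('X_(mxtens_index (i, j)) : {mpoly A[n * dim V]}).
have XE l : vec_mxtens X l = ('X_l : {mpoly A[n * dim V]}).
  by case: (mxtens_indexP l) => u v; rewrite vec_mxtensE mxE.
have prodX (b : mset_tuple d (n * dim V)) :
    \prod_(i < d) vec_mxtens X (tnth (val b) i) = ('X_[s2m (val b)] : {mpoly A[n * dim V]}).
  by rewrite -mpolyX_word; apply: eq_bigr=> l _; rewrite XE.
have coefE (L : 'M[A]_(dim (gamE V), q)) :
   (((powmx X *m map_mx phi L) x j : {mpoly A[n * dim V]})@_(s2m (val a))) = L (gix V a x) j.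
  have cX b : ((\prod_(i < d) vec_mxtens X (tnth (val b) i) * map_mx phi L (gix V b x) j
        : {mpoly A[n * dim V]})@_(s2m (val a))) = L (gix V b x) j *+ (b == a).
    rewrite prodX [map_mx _ _ _ _]mxE -[phi _]/((L (gix V b x) j)%:MP : {mpoly A[_]}).
    rewrite [_ * _]mulrC mcoeffCM mcoeffX eq_s2m perm_sort_mset sort_msetK.
    by rewrite mulr_natr.
  rewrite mul_powmx (raddf_sum (mcoeff (s2m (val a)))) (bigD1 a) //= [X in _ + X]big1 ?addr0.
    by rewrite cX eqxx.
  by move=> b ba; rewrite cX (negPf ba).
by rewrite -coefE h coefE.
Qed.

Lemma powmx_inj_alg (V : vectType k) q (M N : 'M[k]_(dim (gamE V), q)) :
  (forall (B : comAlgType k) (X : 'M[B]_(dim (kspace k n), dim V)),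
     powmx X *m map_mx (in_alg B) M = powmx X *m map_mx (in_alg B) N) -> M = N.
Proof.
move=> h; apply: (@powmx_inj k^o) => B phi X.
have e (L : 'M[k]_(dim (gamE V), q)) : map_mx phi (L : 'M[k^o]_(_, _)) = map_mx (in_alg B) L.
  apply/matrixP=> i j; rewrite !mxE.
  by rewrite -[X in phi X]mulr1 [LHS](linearZ_LR phi) rmorph1.
by rewrite !e.
Qed.

Section Evaluation.
Variables (F : hspfunctor k d) (f : 'M[k]_(dim E, dim (F (kspace k n)))).

Definition ev_mx (V : vectType k) : 'M[k]_(dim (gamE V), dim (F V)) :=
  \matrix_(i, j) ((f *m spf_lin F (kspace k n) V (gix_inv i).1) (gix_inv i).2 j).

Lemma ev_mxE V a x j : ev_mx V (gix V a x) j = (f *m spf_lin F (kspace k n) V a) x j.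
Proof. by rewrite [LHS]mxE gixK. Qed.

Lemma powmx_ev (A : comAlgType k) (V : vectType k) (X : 'M[A]_(dim (kspace k n), dim V)) :
  powmx X *m map_mx (in_alg A) (ev_mx V) = map_mx (in_alg A) f *m spf_mor F X.
Proof.
apply/matrixP=> x j; rewrite mul_powmx (spf_mor_lin X (hspfP F)) mulmx_sumr summxE.
apply: eq_bigr => a _; rewrite [map_mx _ _ _ _]mxE ev_mxE -scalemxAr [RHS]mxE.
by rewrite -map_mxM [map_mx _ _ _ _]mxE.
Qed.

Fact ev_nat : @natural_mx k gamE F ev_mx.
Proof.
move=> A V W X; apply: powmx_inj => B phi Y.
rewrite !map_mxM !map_mx_alg !spf_natural !mulmxA powmxM !powmx_ev.
by rewrite spf_comp mulmxA.
Qed.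

(** The transformation [gamE -> F] that the Yoneda lemma attaches to the linear
map [f : E -> F (k^n)]. *)
Definition ev : spf_hom gamE F := mkhom ev_nat.

End Evaluation.

Lemma gamE_n_generated : n_generated gamE n.
Proof.
apply/n_generatedP=> V c hc; apply: powmx_inj_alg => B X.
by rewrite map_mx0 mulmx0 -[X]mul1mx -powmxM -mulmxA hc mulmx0.
Qed.

(** By the Yoneda lemma, lifting a map out of [gamE] amounts to lifting a linear
map into [G (k^n)] along a surjection of vector spaces. *)
Lemma gamE_projective : projective gamE.
Proof.
apply: projectiveP => F G e f se.
pose u : 'M[k]_(dim E, _) := powmx (1%:M : 'M[k^o]_(dim (kspace k n), dim (kspace k n))).
have uE (B : comAlgType k) : map_mx (in_alg B) u = powmx (1%:M : 'M[B]_(dim (kspace k n))).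
  by rewrite [LHS](@map_powmx k^o B (in_alg B)) map_mx1.
have [g hg] := row_full_lift (u *m hmx f (kspace k n)) (se (kspace k n)).
exists (ev g) => V; apply: powmx_inj_alg => B X.
rewrite map_mxM mulmxA [hmx (ev g) V]/(ev_mx _ _) powmx_ev -mulmxA (hmx_nat e) mulmxA -map_mxM -hg.
by rewrite map_mxM uE -mulmxA -(hmx_nat f) mulmxA powmxM mul1mx.
Qed.

End GammaTensor.
Arguments gix {n E} V a x.
Arguments powmx {n E A V} X.

Definition genproj n F := projective F /\ n_generated F n.

Lemma genproj_gamE n E : genproj n (gamE n E).
Proof. by split; [apply: gamE_projective | apply: gamE_n_generated]. Qed.

Lemma ev_id_surj n F : n_generated F n -> surj (@ev n (F (kspace k n)) F 1%:M).
Proof.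
move=> /n_generatedP gF V; apply/row_full_left=> r x hx.
apply/matrixP=> i j; rewrite [RHS]mxE.
have /matrixP/(_ i ord0) : col j x = 0; last by rewrite !mxE.
apply: gF => A X; have := powmx_ev (1%:M : 'M[k]_(dim (F (kspace k n)))) X.
rewrite (map_mx1 (in_alg A)) mul1mx => <-.
by rewrite -mulmxA -map_mxM colE [ev_mx _ _ *m _]mulmxA [ev_mx _ _ *m x]hx mul0mx map_mx0 mulmx0.
Qed.

(** For [F] an [n]-generated functor, evaluation is a surjection from
[gamE n (F (k^n))] onto [F]; it splits when [F] is projective. *)
Lemma genproj_retract n F : genproj n F <-> exists E, retract F (gamE n E).
Proof.
split=> [[pF /ev_id_surj sF] | [E rF]]; last first.
  have [pG gG] := genproj_gamE n E.
  by split; [apply: projective_retract rF pG | apply: n_generated_retract rF gG].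
have [s hs] := projective_lift (hid F) pF sF.
by exists (F (kspace k n)), s, (ev 1%:M).
Qed.

Lemma genproj_dsum n F G : genproj n F -> genproj n G -> genproj n (dsum F G).
Proof.
move=> [pF gF] [pG gG].
by split; [apply: dsum_projective | apply: n_generated_dsum].
Qed.

Lemma n_resolved_cover n F : n_resolved F n -> covered_by (genproj n) (fun G => n_resolved G n) F.
Proof. exact: (@resolved_by_cover _ _ (genproj n)). Qed.

Lemma n_resolved_trans n F : resolved_by (fun G => n_resolved G n) F -> n_resolved F n.
Proof.
by apply: (@resolved_by_trans _ _ (genproj n)) => [P [] | P P'] //; apply: genproj_dsum.
Qed.

End Yoneda.
Arguments gix {k d n E} V a x.
Arguments powmx {k d n E A V} X.

(** * Generation in the degree, and precomposition with tensor products *)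

Section Formal.
Variables (k : fieldType).

Lemma n_resolvedS d (F : hspfunctor k d) n : n_resolved F n -> n_resolved F n.+1.
Proof. by case=> R hR; exists R => i; have [pP /n_generatedS gP] := hR i. Qed.

(** A monomial of degree [d] in the entries of a generic matrix [Y] involves at
most [d] of its rows, so its coefficient in [F Y] is not affected by replacing
the other rows by zero; the matrix so obtained factors through [k^d]. *)
Lemma homogeneous_generated d (F : hspfunctor k d) : n_generated F d.
Proof.
apply/n_generatedP=> V c hc; pose N := dim V.
suff lin0 (b : mset_tuple d (N * N)) : spf_lin F V V b *m c = 0.
  have := spf_mor_lin (1%:M : 'M[k^o]_(dim V)) (hspfP F); rewrite spf_id.
  move/(congr1 (mulmx^~ (map_mx (in_alg k^o) c))); rewrite mul1mx mulmx_suml.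
  rewrite big1 => [|b _]; last by rewrite -scalemxAl -map_mxM lin0 map_mx0 scaler0.
  move=> e; apply/matrixP=> i j; have /matrixP/(_ i j) := e.
  by rewrite !mxE [in_alg _ _]mulr1.
pose R : comAlgType k := {mpoly k[N * N]}; pose Y : 'M[R]_N := Defs.genmx k N N.
pose r (l : 'I_d) : 'I_N := (mxtens_unindex (tnth (val b) l)).1.
pose S1 : 'M[R]_(dim V, dim (kspace k d)) :=
  \matrix_(i, l) (Some l == [pick l | r l == i])%:R.
pose S2 : 'M[R]_(dim (kspace k d), dim V) := \matrix_(l, j) (r l == j)%:R.
have SY l : vec_mxtens (S1 *m (S2 *m Y)) l =
    ('X_l *+ [exists i, r i == (mxtens_unindex l).1] : {mpoly k[N * N]}).
  case: (mxtens_indexP l) => i j; rewrite vec_mxtensE mxtens_indexK /= mulmxA mxE.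
  have SE h : (S1 *m S2) i h = ([exists l, r l == i] && (i == h))%:R.
    rewrite mxE; under eq_bigr do rewrite !mxE -natrM mulnb.
    case: pickP => [l0 rl0 | r0].
      rewrite (bigD1 l0) //= eqxx big1 ?addr0 => [|l1 /negPf ll0]; last first.
        by have -> : (Some l1 == Some l0) = false by [].
      by rewrite (eqP rl0); have -> : [exists l1, r l1 == i] by apply/existsP; exists l0.
    rewrite big1 => [|l1 _] //; case: existsP => // [[l1]]; by rewrite r0.
  rewrite (bigD1 i) //= [X in _ + X]big1 ?addr0 => [|h hi].
    by rewrite SE eqxx andbT mxE mulr_natl.
  by rewrite SE eq_sym (negPf hi) andbF mul0r.
have := hc R (S2 *m Y); move/(congr1 (mulmx (spf_mor F S1))).
rewrite mulmx0 mulmxA -spf_comp (spf_mor_lin _ (hspfP F)) mulmx_suml => e.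
have coefb (b' : mset_tuple d (N * N)) :
    (\prod_(i < d) vec_mxtens (S1 *m (S2 *m Y)) (tnth (val b') i) : {mpoly k[N * N]})@_(s2m (val b))
    = (b' == b)%:R.
  have [h | /forallPn[i hi]] := boolP [forall i, exists l, r l == (mxtens_unindex (tnth (val b') i)).1].
    transitivity (('X_[s2m (val b')] : {mpoly k[N * N]})@_(s2m (val b))).
      rewrite -mpolyX_word; congr (_@__); apply: eq_bigr => i _.
      by rewrite SY (forallP h).
    by rewrite mcoeffX eq_s2m perm_sort_mset sort_msetK.
  rewrite (bigD1 i) //= SY (negPf hi) mulr0n mul0r mcoeff0.
  case: eqP hi => // ->; case/existsP; by exists i.
apply/matrixP=> i j; rewrite [RHS]mxE.
have e0 : ((0 : 'M[R]_(dim (F V), 1)) i j : {mpoly k[N * N]})@_(s2m (val b)) = 0.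
  by rewrite mxE mcoeff0.
rewrite -[RHS]e0 -e summxE raddf_sum /=.
have termE (b' : mset_tuple d (N * N)) :
    ((((\prod_(i < d) vec_mxtens (S1 *m (S2 *m Y)) (tnth (val b') i)) *:
      map_mx (in_alg R) (spf_lin F V V b') *m map_mx (in_alg R) c) i j : {mpoly k[N * N]})@_(s2m (val b)))
    = (spf_lin F V V b' *m c) i j *+ (b' == b).
  rewrite -scalemxAl -map_mxM 2!mxE mulrC mulr_algl mcoeffZ.
  by rewrite [X in _ * X]coefb mulr_natr.
rewrite (bigD1 b) //= [X in _ = _ + X]big1 ?addr0 => [|b' /negPf bb].
  by rewrite termE eqxx.
by rewrite termE bb.
Qed.

Theorem degree_resolved d (F : hspfunctor k d) : n_resolved F d.
Proof.
apply: (@resolved_by_coind _ _ (genproj d) (fun=> True)) => // G _.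
pose e := @ev k d d (G (kspace k d)) G 1%:M.
exists (hker e), (gamE d d (G (kspace k d))), (ker_inc e), e.
split=> //; first exact: genproj_gamE.
exact/ker_ses/ev_id_surj/homogeneous_generated.
Qed.

Section Precomposition.
Variables (d l : nat).
Implicit Types F G : hspfunctor k d.

Fact precomp_hom_nat F G (f : spf_hom F G) :
  @natural_mx k (precomp_ktens l F) (precomp_ktens l G) (fun V => hmx f (spf_ktens k l V)).
Proof. by move=> A V W X; exact: (hmx_nat f (spf_mor (spf_ktens k l) X)). Qed.

Definition precomp_hom F G (f : spf_hom F G) := mkhom (precomp_hom_nat f).

(** Both index sets list the triples [(i, a, s)] in lexicographic order, so the
reindexing between them is the identity on positions. *)
Lemma tens_assoc (R : comNzRingType) n v w (X : 'M[R]_(v, w)) :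
  ((1%:M : 'M_n) *t ((1%:M : 'M_l) *t X)) *m pid_mx (n * (l * w)) =
  pid_mx (n * (l * v)) *m ((1%:M : 'M_(n * l)) *t X).
Proof.
have idx q i a (j : 'I_q) : mxtens_index (i : 'I_n, mxtens_index (a : 'I_l, j)) =
    mxtens_index (mxtens_index (i, a), j) :> nat.
  by rewrite /= mulnDl -mulnA addnA.
apply/matrixP=> x y.
case: (mxtens_indexP x) => i x'; case: (mxtens_indexP x') => {x x'} a s.
case: (mxtens_indexP y) => y' t; case: (mxtens_indexP y') => {y y'} j b.
have pidE p q (u : 'I_p) (u' : 'I_q) : p = q -> (pid_mx p : 'M[R]_(p, q)) u u' = (u == u' :> nat)%:R.
  by move=> _; rewrite mxE ltn_ord andbT.
rewrite mxE (bigD1 (mxtens_index (j, mxtens_index (b, t)))) //= [X in _ + X]big1 ?addr0; last first.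
  move=> u; rewrite pidE ?mulnA // -(idx w) -(inj_eq val_inj) => /negPf ->.
  by rewrite mulr0.
rewrite [RHS]mxE (bigD1 (mxtens_index (mxtens_index (i, a), s))) //= [X in _ = _ + X]big1 ?addr0; last first.
  move=> u; rewrite pidE ?mulnA // (idx v) (inj_eq val_inj) eq_sym => /negPf ->.
  by rewrite mul0r.
rewrite !pidE ?mulnA // -!idx !eqxx mulr1 mul1r !tensmxE !mxE.
by rewrite (can_eq (@mxtens_indexK _ _)) xpair_eqE mulrA -natrM mulnb.
Qed.

(** This is the isomorphism between [Hom(k^n, k^l (x) V)] and [Hom(k^(n l), V)]. *)
Lemma precomp_gamE n (E : vectType k) :
  retract (precomp_ktens l (gamE d n E)) (gamE d (n * l) E).
Proof.
pose S m : 'M[k]_(n * (l * m), n * l * m) := pid_mx (n * (l * m)).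
pose S' m : 'M[k]_(n * l * m, n * (l * m)) := pid_mx (n * (l * m)).
pose M V : 'M[k]_(dim (precomp_ktens l (gamE d n E) V), dim (gamE d (n * l) E V)) :=
  gamma_mx d (S (dim V)) *t (1%:M : 'M_(dim E)).
pose M' V : 'M[k]_(dim (gamE d (n * l) E V), dim (precomp_ktens l (gamE d n E) V)) :=
  gamma_mx d (S' (dim V)) *t (1%:M : 'M_(dim E)).
have SS' m : S m *m S' m = 1%:M by rewrite pid_mx_id ?mulnA // -mulnA pid_mx_1.
have S'S m : S' m *m S m = 1%:M by rewrite pid_mx_id // mulnA pid_mx_1.
have MM' V : M V *m M' V = 1%:M.
  by rewrite [LHS]tensmx_mul mulmx1 -gamma_mxM SS' gamma_mx1 tens1mx.
have M'M V : M' V *m M V = 1%:M.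
  by rewrite [LHS]tensmx_mul mulmx1 -gamma_mxM S'S gamma_mx1 tens1mx.
have natM : natural_mx M.
  move=> A V W X; rewrite !map_mxT !map_mx1 !map_gamma_mx !map_pid_mx.
  by rewrite [LHS]tensmx_mul [RHS]tensmx_mul !mulmx1 -!gamma_mxM tens_assoc.
have natM' : natural_mx M'.
  move=> A V W X; have := congr1 (mulmx^~ (map_mx (in_alg A) (M' W))) (natM A V W X).
  move/(congr1 (mulmx (map_mx (in_alg A) (M' V)))).
  rewrite -!mulmxA -map_mxM MM' map_mx1 mulmx1 => ->.
  by rewrite !mulmxA -map_mxM M'M map_mx1 mul1mx.
by exists (mkhom natM), (mkhom natM') => V; apply: MM'.
Qed.

Lemma precomp_retract F G : retract F G -> retract (precomp_ktens l F) (precomp_ktens l G).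
Proof. by case=> s [r sr]; exists (precomp_hom s), (precomp_hom r) => V; apply: sr. Qed.

Lemma precomp_genproj n F : genproj n F -> genproj (n * l) (precomp_ktens l F).
Proof.
case/genproj_retract=> E rE; apply/genproj_retract; exists E.
exact: retract_trans (precomp_retract rE) (precomp_gamE n E).
Qed.

Theorem precomp_resolved n F : n_resolved F n -> n_resolved (precomp_ktens l F) (n * l).
Proof.
move=> rF; apply: (@resolved_by_coind _ _ (genproj (n * l))
  (fun G => exists2 F, n_resolved F n & G = precomp_ktens l F)); last by exists F.
move=> _ [{rF} {}F /n_resolved_cover[K [P [i [e [QP rK se]]]]] ->].
exists (precomp_ktens l K), (precomp_ktens l P), (precomp_hom i), (precomp_hom e).
by split=> [||V]; [apply: precomp_genproj | exists K | apply: se].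
Qed.

End Precomposition.
End Formal.

(** * Tensor products *)

Section Tensor.
Variable k : fieldType.

Section TensorHom.
Variables (d e : nat).
Implicit Types (F G : hspfunctor k d) (H K : hspfunctor k e).

Lemma tensmxDl (R : comPzRingType) m n p q (A B : 'M[R]_(m, n)) (C : 'M[R]_(p, q)) :
  (A + B) *t C = A *t C + B *t C.
Proof. by apply/matrixP=> i j; rewrite !mxE mulrDl. Qed.

Lemma tensmxDr (R : comPzRingType) m n p q (A B : 'M[R]_(m, n)) (C : 'M[R]_(p, q)) :
  C *t (A + B) = C *t A + C *t B.
Proof. by apply/matrixP=> i j; rewrite !mxE mulrDr. Qed.

Fact tensor_hom_nat F G H K (f : spf_hom F G) (g : spf_hom H K) :
  @natural_mx k (tensor F H) (tensor G K) (fun V => hmx f V *t hmx g V).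
Proof.
move=> A V W X; rewrite !map_mxT [LHS]tensmx_mul [RHS]tensmx_mul.
by rewrite (hmx_nat f) (hmx_nat g).
Qed.

Definition tensor_hom F G H K (f : spf_hom F G) (g : spf_hom H K) :=
  mkhom (tensor_hom_nat f g).

Lemma tensor_retract F G H K :
  retract F G -> retract H K -> retract (tensor F H) (tensor G K).
Proof.
case=> s [r sr] [s' [r' sr']]; exists (tensor_hom s s'), (tensor_hom r r') => V.
by rewrite [LHS]tensmx_mul sr sr' tens1mx.
Qed.

Lemma mexact_split m n q (G : 'M[k]_(m, n)) (F : 'M[k]_(n, q)) :
  mexact G F -> exists y s, y *m G + F *m s = 1%:M.
Proof.
case=> GF ex; have [|y hy] := ex _ (1%:M - F *m pinvmx F).
  by rewrite mulmxBl mul1mx mulmxKpV // subrr.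
by exists y, (pinvmx F); rewrite -hy subrK.
Qed.

(** Tensoring with a fixed functor is exact because short exact sequences split
pointwise. *)
Lemma ses_tensorl F G G' H (i : spf_hom F G) (p : spf_hom G G') :
  ses i p -> ses (tensor_hom i (hid H)) (tensor_hom p (hid H)).
Proof.
move=> sip V; have [/row_freeP[j ij] ex fp] := sip V.
have [y [s ys]] := mexact_split ex; have [ip _] := ex; split.
- by apply/row_freeP; exists (j *t 1%:M); rewrite [LHS]tensmx_mul ij mulmx1 tens1mx.
- split; first by rewrite [LHS]tensmx_mul ip tens0mx.
  move=> r x xp; have x0 : x *m ((hmx p V *m s) *t (1%:M : 'M_(dim (H V)))) = 0.
    by rewrite -[1%:M]mulmx1 -tensmx_mul mulmxA [x *m _]xp mul0mx.
  exists (x *m (y *t 1%:M)); rewrite -mulmxA [_ *m hmx _ V]tensmx_mul mulmx1.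
  by rewrite -[LHS]mulmx1 -tens1mx -ys tensmxDl mulmxDr x0 addr0.
- have [z hz] := row_full_lift 1%:M fp; apply: (@row_full_id _ _ _ _ (z *t 1%:M)).
  by rewrite [RHS]tensmx_mul -hz mulmx1 tens1mx.
Qed.

Lemma ses_tensorr F H K K' (i : spf_hom H K) (p : spf_hom K K') :
  ses i p -> ses (tensor_hom (hid F) i) (tensor_hom (hid F) p).
Proof.
move=> sip V; have [/row_freeP[j ij] ex fp] := sip V.
have [y [s ys]] := mexact_split ex; have [ip _] := ex; split.
- by apply/row_freeP; exists (1%:M *t j); rewrite [LHS]tensmx_mul ij mulmx1 tens1mx.
- split; first by rewrite [LHS]tensmx_mul ip tensmx0.
  move=> r x xp; have x0 : x *m ((1%:M : 'M_(dim (F V))) *t (hmx p V *m s)) = 0.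
    by rewrite -[1%:M]mulmx1 -tensmx_mul mulmxA [x *m _]xp mul0mx.
  exists (x *m (1%:M *t y)); rewrite -mulmxA [_ *m hmx _ V]tensmx_mul mulmx1.
  by rewrite -[LHS]mulmx1 -tens1mx -ys tensmxDr mulmxDr x0 addr0.
- have [z hz] := row_full_lift 1%:M fp; apply: (@row_full_id _ _ _ _ (1%:M *t z)).
  by rewrite [RHS]tensmx_mul -hz mulmx1 tens1mx.
Qed.

End TensorHom.

Definition index_mx (R : pzSemiRingType) p q (mu : 'I_p -> 'I_q) : 'M[R]_(q, p) :=
  \matrix_(i, t) (mu t == i)%:R.

Lemma mul_index_mx (R : pzSemiRingType) p q r (mu : 'I_p -> 'I_q) (L : 'M[R]_(r, q)) i t :
  (L *m index_mx R mu) i t = L i (mu t).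
Proof.
rewrite mxE (bigD1 (mu t)) //= !mxE eqxx mulr1 big1 ?addr0 // => j.
by rewrite !mxE eq_sym => /negPf->; rewrite mulr0.
Qed.

Lemma index_mx_mul (R : pzSemiRingType) p q r (mu : 'I_p -> 'I_q) (L : 'M[R]_(p, r)) i j :
  (index_mx R mu *m L) i j = \sum_(s | mu s == i) L s j.
Proof.
rewrite mxE [RHS]big_mkcond; apply: eq_bigr => s _; rewrite mxE.
by case: eqP; rewrite ?mul1r ?mul0r.
Qed.

Lemma map_index_mx (R S : pzSemiRingType) (f : {rmorphism R -> S}) p q (mu : 'I_p -> 'I_q) :
  map_mx f (index_mx R mu) = index_mx S mu.
Proof. by apply/matrixP=> i j; rewrite !mxE rmorph_nat. Qed.

(** The two hypotheses on the action say that the basis vectors of [G V] indexed by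
[mu] and the remaining ones span complementary subfunctors, the first of which is
[T]. *)
Lemma retract_index d (T G : hspfunctor k d)
    (mu : forall V : vectType k, 'I_(dim (T V)) -> 'I_(dim (G V))) :
    (forall V, injective (mu V)) ->
    (forall (A : comAlgType k) (V W : vectType k) (X : 'M[A]_(dim V, dim W)) i t,
       spf_mor G X i (mu W t) = \sum_(s | mu V s == i) spf_mor T X s t) ->
    (forall (A : comAlgType k) (V W : vectType k) (X : 'M[A]_(dim V, dim W)) s j,
       j \notin codom (mu W) -> spf_mor G X (mu V s) j = 0) ->
  retract T G.
Proof.
move=> mu_inj GT G0.
pose M V : 'M[k]_(dim (G V), dim (T V)) := index_mx k (mu V).
have trE V r (R : pzSemiRingType) (L : 'M[R]_(dim (G V), r)) s j :
    ((index_mx R (mu V))^T *m L) s j = L (mu V s) j.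
  rewrite mxE (bigD1 (mu V s)) //= !mxE eqxx mul1r big1 ?addr0 // => i.
  by rewrite !mxE eq_sym => /negPf->; rewrite mul0r.
have natM : @natural_mx k G T M.
  move=> A V W X; rewrite !(map_index_mx (in_alg A)); apply/matrixP=> i t.
  by rewrite mul_index_mx GT index_mx_mul.
have natMt : @natural_mx k T G (fun V => (M V)^T).
  move=> A V W X; rewrite -!map_trmx !(map_index_mx (in_alg A)); apply/matrixP=> s j; rewrite trE.
  have [/codomP[t ->] | jmu] := boolP (j \in codom (mu W)).
    rewrite GT (big_pred1 s) => [|s']; last by rewrite /= (inj_eq (mu_inj V)).
    rewrite mxE (bigD1 t) //= !mxE eqxx mulr1 big1 ?addr0 // => t' tt'.
    by rewrite !mxE (inj_eq (mu_inj W)) (negPf tt') mulr0.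
  rewrite G0 // mxE big1 // => t _; rewrite !mxE.
  case: eqP => [tj | _]; last by rewrite mulr0.
  by case/negP: jmu; rewrite -tj codom_f.
exists (mkhom natMt), (mkhom natM) => V; apply/matrixP=> s t.
by rewrite [LHS]mul_index_mx !mxE (inj_eq (mu_inj V)) eq_sym.
Qed.

(** A word contributes to the coefficient only when it matches letters of equal
weight. *)
Lemma gamma_coef_weight (R : comNzRingType) d m n (w : 'I_m -> nat) (w' : 'I_n -> nat)
    (M : 'M[R]_(m, n)) (a : mset_tuple d m) (v : d.-tuple 'I_n) :
  (forall i j, w i != w' j -> M i j = 0) ->
  \sum_(i <- val a) w i != \sum_(j <- v) w' j -> gamma_coef M a v = 0.
Proof.
move=> M0 av; apply: big1 => u ua; apply/eqP; apply: contraNT av => Muv.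
have uv i : w (tnth u i) = w' (tnth v i).
  apply/eqP; apply: contraNT Muv => /M0 e; apply/eqP.
  by rewrite /word_prod (bigD1 i) //= e mul0r.
rewrite -(perm_big _ ua) (big_tuple _ _ u predT) (big_tuple _ _ v predT) /=.
by apply/eqP/eq_bigr => i _; rewrite uv.
Qed.

Section Merge.
Variables (d1 d2 n1 n2 v : nat).

Definition inl_index (l : 'I_(n1 * v)) : 'I_((n1 + n2) * v) :=
  mxtens_index (lshift n2 (mxtens_unindex l).1, (mxtens_unindex l).2).
Definition inr_index (l : 'I_(n2 * v)) : 'I_((n1 + n2) * v) :=
  mxtens_index (rshift n1 (mxtens_unindex l).1, (mxtens_unindex l).2).

(** The product of a monomial in the first [n1] rows of variables with one in the
last [n2] rows. *)
Definition merge (a : mset_tuple d1 (n1 * v)) (b : mset_tuple d2 (n2 * v)) :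
    mset_tuple (d1 + d2) ((n1 + n2) * v) :=
  sort_mset [tuple of map inl_index (val a) ++ map inr_index (val b)].

Definition is_inl (l : 'I_((n1 + n2) * v)) : bool := ((mxtens_unindex l).1 < n1)%N.

Lemma inl_indexK l : is_inl (inl_index l).
Proof. by rewrite /is_inl mxtens_indexK; apply: (ltn_ord (mxtens_unindex l).1). Qed.

Lemma inr_indexK l : is_inl (inr_index l) = false.
Proof. by rewrite /is_inl mxtens_indexK ltnNge leq_addr. Qed.

Lemma inl_index_inj : injective inl_index.
Proof.
move=> l l'; case: (mxtens_indexP l) => i j; case: (mxtens_indexP l') => i' j'.
rewrite /inl_index !mxtens_indexK /= => /(can_inj (@mxtens_indexK _ _))[e ->].
by congr (mxtens_index (_, _)); apply: val_inj.
Qed.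

Lemma inr_index_inj : injective inr_index.
Proof.
move=> l l'; case: (mxtens_indexP l) => i j; case: (mxtens_indexP l') => i' j'.
rewrite /inr_index !mxtens_indexK /= => /(can_inj (@mxtens_indexK _ _))[e ->].
by congr (mxtens_index (_, _)); apply: val_inj; apply: (@addnI n1).
Qed.

Lemma merge_perm (a : mset_tuple d1 (n1 * v)) (b : mset_tuple d2 (n2 * v)) :
  perm_eq (map inl_index (val a) ++ map inr_index (val b)) (val (merge a b)).
Proof. by rewrite perm_sym perm_sort. Qed.

Lemma sum_merge a b (w : 'I_((n1 + n2) * v) -> nat) :
  \sum_(l <- val (merge a b)) w l =
  (\sum_(l <- val a) w (inl_index l) + \sum_(l <- val b) w (inr_index l))%N.
Proof. by rewrite -(perm_big _ (merge_perm a b)) big_cat !big_map. Qed.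

Lemma mset_tuple_perm d n (a a' : mset_tuple d n) : perm_eq (val a) (val a') -> a = a'.
Proof. by rewrite perm_sort_mset sort_msetK => /eqP. Qed.

Lemma merge_inj a b a' b' : merge a b = merge a' b' -> a = a' /\ b = b'.
Proof.
move=> e; have := merge_perm a b; rewrite e => h.
have {}h : perm_eq (map inl_index (val a) ++ map inr_index (val b))
    (map inl_index (val a') ++ map inr_index (val b')).
  by apply: perm_trans h _; rewrite perm_sym merge_perm.
have fl (p : pred 'I_((n1 + n2) * v)) s s' : perm_eq s s' -> perm_eq (filter p s) (filter p s').
  by move=> ss'; rewrite perm_filter.
have fT s : filter is_inl (map inl_index s) = map inl_index s.
  by apply/all_filterP; rewrite all_map; apply/allP=> l _; apply: inl_indexK.
have fF s : filter is_inl (map inr_index s) = [::].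
  by rewrite filter_map (eq_filter (a2 := pred0)) ?filter_pred0 // => l; apply: inr_indexK.
have gF s : filter (predC is_inl) (map inl_index s) = [::].
  by rewrite filter_map (eq_filter (a2 := pred0)) ?filter_pred0 // => l; rewrite /= inl_indexK.
have gT s : filter (predC is_inl) (map inr_index s) = map inr_index s.
  by apply/all_filterP; rewrite all_map; apply/allP=> l _; rewrite /= inr_indexK.
split; apply: mset_tuple_perm.
  by apply: (perm_map_inj inl_index_inj); have := fl is_inl _ _ h; rewrite !filter_cat !fT !fF !cats0.
by apply: (perm_map_inj inr_index_inj); have := fl (predC is_inl) _ _ h; rewrite !filter_cat !gT !gF.
Qed.

Lemma merge_codom (c : mset_tuple (d1 + d2) ((n1 + n2) * v)) :
  (\sum_(l <- val c) (is_inl l : nat) = d1)%N -> exists a b, c = merge a b.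
Proof.
have split (s : seq 'I_((n1 + n2) * v)) : exists s1 s2,
    perm_eq s (map inl_index s1 ++ map inr_index s2).
  elim: s => [|l s [s1 [s2 h]]]; first by exists [::], [::].
  case: (mxtens_indexP l) => i j; case: (split_ordP i) => i' ->.
    exists (mxtens_index (i', j) :: s1), s2.
    by rewrite /= {1}/inl_index mxtens_indexK perm_cons.
  exists s1, (mxtens_index (i', j) :: s2).
  by rewrite perm_sym perm_catC /= {1}/inr_index mxtens_indexK perm_cons perm_catC perm_sym.
have [s1 [s2 h]] := split (val c); rewrite (perm_big _ h) big_cat !big_map /= => e.
have s1E : size s1 == d1.
  rewrite -[X in _ == X]e (eq_bigr (fun=> 1%N)) => [|l _]; last by rewrite inl_indexK.
  by rewrite [X in (_ + X)%N]big1 ?addn0 ?sum1_size // => l _; rewrite inr_indexK.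
have s2E : size s2 == d2.
  have := perm_size h; rewrite size_tuple size_cat !size_map (eqP s1E) => /eqP.
  by rewrite eqn_add2l eq_sym.
exists (sort_mset (Tuple s1E)), (sort_mset (Tuple s2E)); apply: mset_tuple_perm.
apply: perm_trans h _; apply: perm_trans (merge_perm _ _).
by apply: perm_cat; apply: perm_map; rewrite perm_sym perm_sort.
Qed.

End Merge.

Section GammaTensor.
Variables (d1 d2 n1 n2 : nat) (E1 E2 : vectType k).
Local Notation T := (tensor (gamE d1 n1 E1) (gamE d2 n2 E2)).
Local Notation G := (gamE (d1 + d2) (n1 + n2) (tens E1 E2)).

Definition merge_index (V : vectType k) (t : 'I_(dim (T V))) : 'I_(dim (G V)) :=
  let ij := @mxtens_unindex (dim (gamE d1 n1 E1 V)) (dim (gamE d2 n2 E2 V)) t in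
  let ax := gix_inv ij.1 in let bY := gix_inv ij.2 in
  gix V (merge ax.1 bY.1) (mxtens_index (ax.2, bY.2)).

Definition tix (V : vectType k) a x b y : 'I_(dim (T V)) :=
  mxtens_index (gix V a x : 'I_(dim (gamE d1 n1 E1 V)), gix V b y : 'I_(dim (gamE d2 n2 E2 V))).
Arguments tix : clear implicits.

Lemma tixP (V : vectType k) (P : 'I_(dim (T V)) -> Prop) :
  (forall a x b y, P (tix V a x b y)) -> forall t, P t.
Proof.
move=> h t; rewrite -[t](@mxtens_unindexK (dim (gamE d1 n1 E1 V)) (dim (gamE d2 n2 E2 V))).
case: (mxtens_unindex t) => i j; elim/gixP: i => a x; elim/gixP: j => b y; exact: h.
Qed.

Lemma merge_indexE V a x b y :
  merge_index (tix V a x b y) = gix V (merge a b) (mxtens_index (x, y)).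
Proof.
rewrite /merge_index /tix (@mxtens_indexK (dim (gamE d1 n1 E1 V)) (dim (gamE d2 n2 E2 V))).
by cbn [fst snd]; rewrite !gixK.
Qed.

Lemma merge_index_inj V : injective (@merge_index V).
Proof.
move=> t t'; elim/tixP: t => a x b y; elim/tixP: t' => a' x' b' y'.
rewrite !merge_indexE => /(congr1 (@gix_inv _ _ _ _ _)); rewrite !gixK => e.
have /(can_inj (@mxtens_indexK _ _))[-> ->] := congr1 snd e.
by have /merge_inj[-> ->] := congr1 fst e.
Qed.

Definition merge_mx (A : comAlgType k) V : 'M[A]_(dim (G V), dim (T V)) :=
  index_mx A (@merge_index V).

(** Restricting the divided power of a pair [(X, Y)] to the monomials of bidegree
[(d1, d2)] gives the tensor product of the divided powers of [X] and of [Y]. *)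
Lemma powmx_merge (A : comAlgType k) (V : vectType k) (X : 'M[A]_(n1, dim V)) (Y : 'M[A]_(n2, dim V)) :
  powmx (d := d1 + d2) (n := n1 + n2) (E := tens E1 E2) (V := V) (col_mx X Y) *m merge_mx A V =
  powmx (d := d1) (n := n1) (E := E1) (V := V) X *t powmx (d := d2) (n := n2) (E := E2) (V := V) Y.
Proof.
apply/matrixP=> z t; elim/tixP: t => a x b y; rewrite mul_index_mx merge_indexE powmxE.
case: (mxtens_indexP z) => x' y'.
rewrite [RHS](tensmxE (powmx (n := n1) (V := V) X) (powmx (n := n2) (V := V) Y)) !powmxE.
rewrite (can_eq (@mxtens_indexK _ _)) xpair_eqE mulrnAl mulrnAr -mulrnA mulnb andbC.
congr (_ *+ _); rewrite -(big_tuple _ _ (val (merge a b)) predT (vec_mxtens (col_mx X Y))) /=.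
rewrite -(perm_big _ (merge_perm a b)) big_cat !big_map /= !big_tuple.
congr (_ * _); apply: eq_bigr => i _; rewrite /vec_mxtens mxtens_indexK /=.
  by rewrite (@col_mxEu _ n1).
by rewrite (@col_mxEd _ n1).
Qed.

Lemma merge_nat (A : comAlgType k) (V W : vectType k) (X : 'M[A]_(dim V, dim W)) :
  spf_mor G X *m merge_mx A W = merge_mx A V *m spf_mor T X.
Proof.
apply: powmx_inj => B phi Z; rewrite !map_mxM !spf_natural !mulmxA powmxM.
have map_merge U : map_mx phi (merge_mx A U) = merge_mx B U.
  exact: map_index_mx.
rewrite !map_merge -[Z](@vsubmxK _ n1 n2) mul_col_mx !powmx_merge.
by rewrite [RHS]tensmx_mul !powmxM.
Qed.

Lemma tensor_gamE : retract T G.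
Proof.
apply: (@retract_index _ _ _ merge_index merge_index_inj) => A V W X.
  by move=> i t; rewrite -index_mx_mul -merge_nat mul_index_mx.
move=> t; elim/gixP=> c z; elim/tixP: t => a x b y; rewrite merge_indexE gamE_mor => cz.
rewrite (gamma_coef_weight (w := fun l => is_inl (n1 := n1) (n2 := n2) l)
  (w' := fun l => is_inl (n1 := n1) (n2 := n2) l)) ?mul0rn //.
  move=> i j; case: (mxtens_indexP i) => i1 i2; case: (mxtens_indexP j) => j1 j2.
  rewrite /is_inl !mxtens_indexK tensmxE mxE.
  by case: (i1 =P j1) => [-> | _ _]; rewrite ?eqxx // mul0r.
rewrite sum_merge; apply: contraNN cz => /eqP e.
have [a' [b' ->]] : exists a' b', c = merge (d1 := d1) (d2 := d2) (n1 := n1) (n2 := n2) a' b'.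
  apply: merge_codom; rewrite -[LHS]e.
  rewrite (eq_bigr (fun=> 1%N)) => [|l _]; last by rewrite inl_indexK.
  rewrite [X in (_ + X)%N]big1 ?addn0 ?sum1_size ?size_tuple // => l _.
  by rewrite inr_indexK.
case: (mxtens_indexP z) => x' y'; apply/codomP; exists (tix W a' x' b' y').
by rewrite merge_indexE.
Qed.

End GammaTensor.

Lemma genproj_tensor d1 d2 n1 n2 (F : hspfunctor k d1) (G : hspfunctor k d2) :
  genproj n1 F -> genproj n2 G -> genproj (n1 + n2) (tensor F G).
Proof.
move=> /genproj_retract[E1 r1] /genproj_retract[E2 r2].
apply/genproj_retract; exists (tens E1 E2).
exact: retract_trans (tensor_retract r1 r2) (tensor_gamE _ _ _ _ _ _).
Qed.

(** First resolve the second factor, the first one being projective; then the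
tensor product of a resolution of the first factor with the second one is a
resolution by [n1 + n2]-resolved functors. *)
Theorem tensor_resolved d1 d2 n1 n2 (F : hspfunctor k d1) (G : hspfunctor k d2) :
  n_resolved F n1 -> n_resolved G n2 -> n_resolved (tensor F G) (n1 + n2).
Proof.
move=> rF rG; have rP (P : hspfunctor k d1) : genproj n1 P -> n_resolved (tensor P G) (n1 + n2).
  move=> gP; apply: (@resolved_by_coind _ _ (genproj (n1 + n2))
    (fun H => exists2 G, n_resolved G n2 & H = tensor P G)); last by exists G.
  move=> _ [{rG} {}G /n_resolved_cover[K [Q [i [e [gQ rK se]]]]] ->].
  exists (tensor P K), (tensor P Q), (tensor_hom (hid P) i), (tensor_hom (hid P) e).
  by split; [apply: genproj_tensor | exists K | apply: ses_tensorr].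
apply: n_resolved_trans.
apply: (@resolved_by_coind _ _ _ (fun H => exists2 F, n_resolved F n1 & H = tensor F G));
  last by exists F.
move=> _ [{rF} {}F /n_resolved_cover[K [P [i [e [gP rK se]]]]] ->].
exists (tensor K G), (tensor P G), (tensor_hom i (hid G)), (tensor_hom e (hid G)).
by split; [apply: rP | exists K | apply: ses_tensorl].
Qed.

End Tensor.

(** * Derivations of nilpotency order p *)

Section Derivation.
Variables (R : comNzRingType) (p : nat) (charp : p \in [pchar R]).
Variable D : {additive R -> R}.
Hypothesis DM : forall f g, D (f * g) = D f * g + f * D g.

Let p_pr : prime p. Proof. by case/andP: charp. Qed.
Let p_gt0 : (0 < p)%N. Proof. exact: prime_gt0. Qed.

Lemma iterDB n f g : iter n D (f - g) = iter n D f - iter n D g.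
Proof. by elim: n => //= n ->; rewrite raddfB. Qed.

Lemma iterD0 n : iter n D 0 = 0.
Proof. by elim: n => //= n ->; rewrite raddf0. Qed.

Lemma iterDD n f g : iter n D (f + g) = iter n D f + iter n D g.
Proof. by elim: n => //= n ->; rewrite raddfD. Qed.

Lemma iterD_sum n (I : Type) (r : seq I) (F : I -> R) :
  iter n D (\sum_(i <- r) F i) = \sum_(i <- r) iter n D (F i).
Proof. by elim/big_rec2: _ => [|i x y _ <-]; rewrite ?iterD0 ?iterDD. Qed.

Lemma iterDN n f : iter n D (- f) = - iter n D f.
Proof. by rewrite -[- f]sub0r iterDB iterD0 sub0r. Qed.

Lemma D1 : D 1 = 0.
Proof.
have := DM 1 1; rewrite !mulr1 mul1r => /eqP.
by rewrite -subr_eq subrr eq_sym => /eqP.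
Qed.

Lemma iterD1 n : (0 < n)%N -> iter n D 1 = 0.
Proof. by case: n => // n _; rewrite iterSr D1 iterD0. Qed.

Lemma DX f n : D (f ^+ n) = f ^+ n.-1 * D f *+ n.
Proof.
elim: n => [|[|n] IH]; first by rewrite expr0 D1 mulr0n.
  by rewrite expr1 expr0 mul1r mulr1n.
by rewrite exprS DM IH /= mulrnAr mulrA -exprS mulrC [in LHS]addrC -mulrSr.
Qed.

Lemma DXp f : D (f ^+ p) = 0.
Proof. by rewrite DX -mulr_natr (pcharf0 charp) mulr0. Qed.

Lemma Leibniz n f g :
  iter n D (f * g) = \sum_(i < n.+1) iter (n - i) D f * iter i D g *+ 'C(n, i).
Proof.
elim: n => [|n IH]; first by rewrite big_ord1 mulr1n.
rewrite iterS IH raddf_sum /=.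
transitivity (\sum_(i < n.+1) (iter (n.+1 - i) D f * iter i D g *+ 'C(n, i)) +
   \sum_(i < n.+1) (iter (n - i) D f * iter i.+1 D g *+ 'C(n, i))).
  rewrite -big_split; apply: eq_bigr => i _; rewrite raddfMn DM mulrnDl.
  by rewrite subSn ?leq_ord.
rewrite [X in X + _ = _]big_ord_recl [X in _ + X = _]big_ord_recr [RHS]big_ord_recl.
rewrite [in RHS]big_ord_recr /= !bin0 !binn -!addrA; congr (_ + _).
rewrite !addrA !subSS subnn; congr (_ + _).
rewrite -big_split; apply: eq_bigr => i _ /=.
by rewrite /bump /= !add1n binS mulrnDr addrC subSS.
Qed.

Lemma iterpDM f g : iter p D (f * g) = iter p D f * g + f * iter p D g.
Proof.
rewrite Leibniz; case: p charp p_pr => // q charq q_pr.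
rewrite big_ord_recl big_ord_recr bin0 [X in 'C(_, X)]/= /bump leq0n add1n binn.
rewrite subn0 subnn !mulr1n big1 => [|i _]; first by rewrite /= add0r.
rewrite -mulr_natr (_ : _%:R = 0) ?mulr0 //; apply/eqP.
by rewrite -(dvdn_pcharf charq) prime_dvd_bin //= /bump leq0n add1n ltnS ltn_ord.
Qed.

Section Acyclicity.

(** The vanishing of the generalized homology [ker D / im D^(p-1)] of the quotient
by [I], within the graded piece [C]. *)
Definition acyclic (C I : R -> Prop) : Prop :=
  forall f, C f -> I (D f) -> exists2 g, C g & I (f - iter p.-1 D g).

Hypothesis Dp0 : forall f, iter p D f = 0.

Definition subgroup (I : R -> Prop) := I 0 /\ forall f g, I f -> I g -> I (f - g).
Definition stable (I : R -> Prop) := subgroup I /\ forall f, I f -> I (D f).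

Lemma subgroupN I f : subgroup I -> I f -> I (- f).
Proof. by case=> I0 IB If; rewrite -[- f]sub0r; apply: IB. Qed.

Lemma subgroupD I f g : subgroup I -> I f -> I g -> I (f + g).
Proof. by move=> sI If Ig; rewrite -[g]opprK; apply: sI.2 => //; apply: subgroupN. Qed.

Lemma stable_iter I n f : stable I -> I f -> I (iter n D f).
Proof. by case=> _ ID If; elim: n => //= n; apply: ID. Qed.

Lemma subgroup_trans I f g h : subgroup I -> I (f - g) -> I (g - h) -> I (f - h).
Proof. by move=> sI fg gh; rewrite -[f](subrK g) -addrA; apply: subgroupD. Qed.

(** For an operator with [D^p = 0], the vanishing of [ker D / im D^(p-1)] entails
that of [ker D^e / im D^(p-e)] for all [e], by induction on [e]. *)
Lemma acyclic_iter C I e f : stable C -> stable I -> acyclic C I -> (0 < e < p)%N ->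
  C f -> I (iter e D f) -> exists2 g, C g & I (f - iter (p - e) D g).
Proof.
move=> sC sI acI; elim: e f => // -[|e] IH f /andP[_ ep] Cf If.
  by rewrite subn1; apply: acI.
have CDf : C (iter e.+1 D f) by apply: stable_iter.
have [g Cg Ig] := acI _ CDf If.
have [||| g' Cg' Ig'] := IH (f - iter (p - e.+2) D g); first exact: ltnW.
- by apply: sC.1.2 => //; apply: stable_iter.
- rewrite iterDB -iterD addnBA ?(ltnW ep) // (_ : (e.+1 + p - e.+2 = p.-1)%N) //.
  by rewrite addSn subSS subnS addKn.
exists (g + D g'); first by apply: (subgroupD sC.1) => //; apply: sC.2.
rewrite iterDD -iterSr opprD addrA; move: Ig'.
by rewrite -(subnSK (ltnW ep)).
Qed.

Section Step.
Variables (C : nat -> R -> Prop) (I J : R -> Prop) (y z : R).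
Hypotheses (sC : forall m, stable (C m)) (sI : stable I) (sJ : stable J).
Hypotheses (I_mul : forall f g, I g -> I (f * g)) (J_mul : forall f g, J g -> J (f * g)).
Hypotheses (IJ : forall f, I f -> J f) (Jz : J z).
Hypotheses (Dy : D y = z) (Dz : I (D z)).
Hypotheses (Cy : forall m f, C m f -> C m.+1 (y * f)) (Cz : forall m f, C m f -> C m.+1 (z * f)).
Hypothesis zI : forall f, I (z * f) -> I f.
Hypothesis JI : forall m f, C m.+1 f -> J f -> exists2 u, C m u & I (f - z * u).

(** Away from [z = 0] the action is free, since [y / z] has derivative [1]. So
[z^(p-1) f] is a boundary for every cycle [f], and the factors [z] are removed
one by one, using acyclicity on the locus [z = 0]. *)
Lemma acyclic_step m : (forall m', (m < m')%N -> acyclic (C m') J) -> acyclic (C m) I.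
Proof.
move=> acJ f Cf If.
have I_mulr u g : I u -> I (u * g) by rewrite mulrC; apply: I_mul.
have I_muln u i : I u -> I (u *+ i) by move=> Iu; rewrite -mulr_natr; apply: (I_mulr).
have IDz u i : I (D (z ^+ i * u) - z ^+ i * D u).
  rewrite DM addrK; apply: (I_mulr); rewrite DX; apply: (I_muln); exact: I_mul.
have IDzn n u : I (iter n D (z * u) - z * iter n D u).
  elim: n => [|n IHn] /=; first by rewrite subrr; apply: sI.1.1.
  have := sI.2 _ IHn; rewrite raddfB => /(subgroup_trans sI.1); apply.
  by rewrite DM addrK; apply: (I_mulr).
(* As [D y = z] and [D z = 0], each derivation trades one factor [y] for a [z]; the
falling factorial ends with [(p-1)! = -1]. *)
have boundary i : (i < p)%N ->
    I (iter i D (y ^+ p.-1 * f) - y ^+ (p.-1 - i) * (z ^+ i * f) *+ (p.-1 ^_ i)).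
  elim: i => [|i IH] ip; first by rewrite subn0 expr0 mul1r ffactn0 mulr1n subrr; apply: sI.1.1.
  have := sI.2 _ (IH (ltnW ip)); rewrite raddfB raddfMn -iterS.
  move/(subgroup_trans sI.1); apply.
  rewrite ffactnSr mulnC mulrnA -mulrnBl; apply: (I_muln); rewrite DM DX Dy.
  have -> : y ^+ (p.-1 - i).-1 * z *+ (p.-1 - i) * (z ^+ i * f) =
      y ^+ (p.-1 - i.+1) * (z ^+ i.+1 * f) *+ (p.-1 - i).
    by rewrite subnS mulrnAl exprS !mulrA.
  rewrite addrAC subrr add0r; apply: I_mul; rewrite DM; apply: (subgroupD sI.1).
    by apply: (I_mulr); rewrite DX; apply: (I_muln); apply: I_mul.
  exact: I_mul.
have CX u m' i : (forall m f, C m f -> C m.+1 (u * f)) -> C m' f -> C (m' + i)%N (u ^+ i * f).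
  by move=> Cu Cf'; elim: i => [|i IH]; rewrite ?addn0 ?mul1r // addnS exprS -mulrA; apply: Cu.
have fact1 : (p.-1)`!%:R = -1 :> R.
  apply/eqP; rewrite -subr_eq0 opprK natr1 -(dvdn_pcharf charp) -Wilson //.
  exact: prime_gt1.
(* On the locus [z = 0] the primitive [g] of a multiple of [z] is itself a cycle for
[D^(p-1)], hence of the form [D h] there; then [z] divides [g - D h]. *)
have descend j : (exists2 g, C (m + j.+1)%N g & I (z ^+ j.+1 * f - iter p.-1 D g)) ->
    exists2 g, C (m + j)%N g & I (z ^+ j * f - iter p.-1 D g).
  rewrite addnS => -[g Cg Ig].
  have [|||h Ch Jh] := @acyclic_iter (C (m + j).+1) J p.-1 g (sC _) sJ _ _ Cg.
  - by apply: acJ; rewrite ltnS leq_addr.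
  - by rewrite -!subn1 subn_gt0 prime_gt1 //= subn1 prednK.
  - rewrite -[iter _ _ _](subKr (z ^+ j.+1 * f)); apply: sJ.1.2; last exact: IJ.
    by rewrite exprS -mulrA mulrC; apply: J_mul.
  have pp1 : (p - p.-1 = 1)%N by rewrite -{1}(prednK p_gt0) subSn // subnn.
  rewrite pp1 /= in Jh.
  have Cgh : C (m + j).+1 (g - D h) by apply: (sC _).1.2 => //; apply: (sC _).2.
  have [u Cu Iu] := JI Cgh Jh.
  exists u => //; apply: zI; rewrite mulrBr mulrA -exprS.
  apply: (subgroup_trans sI.1 Ig); apply: (subgroup_trans sI.1 _ (IDzn p.-1 u)).
  have := stable_iter p.-1 sI Iu; rewrite !iterDB -iterSr prednK // Dp0 subr0.
  exact.
have top : exists2 g, C (m + p.-1)%N g & I (z ^+ p.-1 * f - iter p.-1 D g).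
  exists (- (y ^+ p.-1 * f)); first by apply: (subgroupN (sC _).1); apply: CX.
  have := boundary p.-1; rewrite subnn expr0 mul1r ffactnn -mulr_natr fact1 mulrN1.
  by rewrite opprK iterDN opprK addrC; apply; rewrite prednK.
have all_down i : (exists2 g, C (m + i)%N g & I (z ^+ i * f - iter p.-1 D g)) ->
    exists2 g, C (m + 0)%N g & I (z ^+ 0 * f - iter p.-1 D g).
  by elim: i => // j IH /(descend j)/IH.
by have := all_down _ top; rewrite addn0 mul1r.
Qed.

End Step.
End Acyclicity.
End Derivation.

(** * The shift derivation on polynomials *)

Section Shift.
Variables (R : comNzRingType) (p v : nat).
Local Notation N := (p * v)%N.
Implicit Types (f g : {mpoly R[N]}) (m : 'X_{1..N}) (l : 'I_N).

Definition next_var l : option 'I_N :=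
  omap (fun i => mxtens_index (i, (mxtens_unindex l).2)) (insub (mxtens_unindex l).1.+1).

Definition shift_var l : {mpoly R[N]} := if next_var l is Some l' then 'X_l' else 0.

(** The operator of [k^p] made of one nilpotent Jordan block, tensored with [k^v]
and extended to polynomial functions as a derivation. *)
Definition shiftD f : {mpoly R[N]} := \sum_l shift_var l * f^`M(l).

Fact shiftD_is_zmod : zmod_morphism shiftD.
Proof.
by move=> f g; rewrite /shiftD -sumrB; apply: eq_bigr => l _; rewrite raddfB mulrBr.
Qed.
HB.instance Definition _ :=
  GRing.isZmodMorphism.Build {mpoly R[N]} {mpoly R[N]} shiftD shiftD_is_zmod.

Lemma shiftDB f g : shiftD (f - g) = shiftD f - shiftD g.
Proof. exact: shiftD_is_zmod. Qed.

Lemma shiftDD f g : shiftD (f + g) = shiftD f + shiftD g.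
Proof. exact: (raddfD (shiftD : {additive _ -> _})). Qed.

Lemma shiftDM f g : shiftD (f * g) = shiftD f * g + f * shiftD g.
Proof.
rewrite /shiftD mulr_suml mulr_sumr -big_split; apply: eq_bigr => l _.
by rewrite mderivM mulrDr !mulrA [f * _]mulrC.
Qed.

Lemma shiftDZ c f : shiftD (c *: f) = c *: shiftD f.
Proof. by rewrite /shiftD scaler_sumr; apply: eq_bigr => l _; rewrite mderivZ scalerAr. Qed.

Lemma shiftDX l : shiftD 'X_l = shift_var l.
Proof.
rewrite /shiftD (bigD1 l) //= big1 ?addr0 => [|l' l'l].
  by rewrite mderivX mnm1E eqxx scale1r -[X in (X - _)%MM]add0m addmK mpolyX0 mulr1.
by rewrite mderivX mnm1E eq_sym (negPf l'l) scale0r mulr0.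
Qed.

Lemma shiftDXm m : shiftD 'X_[m] =
  \sum_l (m l)%:R *: (if next_var l is Some l' then 'X_[m - U_(l) + U_(l')] else 0).
Proof.
apply: eq_bigr => l _; rewrite mderivX -scalerAr /shift_var; congr (_ *: _).
by case: next_var => [l'|]; rewrite ?mul0r // mpolyXD mulrC.
Qed.

Lemma next_varP i (j : 'I_v) : next_var (mxtens_index (i, j)) =
  omap (fun i' => mxtens_index (i', j)) (insub i.+1).
Proof. by rewrite /next_var mxtens_indexK. Qed.

Lemma iter_shiftDX n (i : 'I_p) (j : 'I_v) : iter n shiftD 'X_(mxtens_index (i, j)) =
  if insub (i + n)%N is Some i' then 'X_(mxtens_index (i', j)) else 0.
Proof.
elim: n => [|n IH] /=; first by rewrite addn0 valK.
rewrite IH addnS; case: insubP => [i' _ i'E | ge].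
  rewrite shiftDX /shift_var next_varP -i'E.
  by case: insubP.
rewrite raddf0; case: insubP => // i' lt _.
by rewrite (ltn_trans (ltnSn _) lt) in ge.
Qed.

Lemma iter_shiftDZ n c f : iter n shiftD (c *: f) = c *: iter n shiftD f.
Proof. by elim: n => //= n ->; rewrite shiftDZ. Qed.

(** In characteristic [p] the [p]-th iterate of a derivation is a derivation; that
of the shift kills the variables. *)
Lemma iterp_shiftD f : p \in [pchar R] -> iter p shiftD f = 0.
Proof.
move=> charp; have charP : p \in [pchar {mpoly R[N]}] := rmorph_pchar (@mpolyC N R) charp.
have DM := iterpDM charP shiftDM.
have D1 : iter p shiftD 1 = 0.
  by apply: (iterD1 shiftDM); case/andP: charp => /prime_gt0.
rewrite [f]mpolyE iterD_sum big1 // => m _; rewrite iter_shiftDZ mpolyXE_id.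
suff -> : iter p shiftD (\prod_(i < N) 'X_i ^+ m i) = 0 by rewrite scaler0.
elim/big_ind: _ => [//|x y hx hy|l _]; first by rewrite DM hx hy mul0r mulr0 addr0.
elim: (m l) => [//|e IH]; rewrite exprS DM IH mulr0 addr0.
case: (mxtens_indexP l) => i j; rewrite iter_shiftDX.
by rewrite insubN ?mul0r // -leqNgt leq_addl.
Qed.

End Shift.

Section Support.
Variables (k : fieldType) (N : nat).
Implicit Types (f g : {mpoly k[N]}) (P Q : pred 'X_{1..N}).

Definition supp_in P f : Prop := forall m, ~~ P m -> f@_m = 0.

Lemma supp_in0 P : supp_in P 0. Proof. by move=> m _; rewrite mcoeff0. Qed.

Lemma supp_inB P f g : supp_in P f -> supp_in P g -> supp_in P (f - g).
Proof. by move=> hf hg m Pm; rewrite mcoeffB hf ?hg ?subr0. Qed.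

Lemma supp_inD P f g : supp_in P f -> supp_in P g -> supp_in P (f + g).
Proof. by move=> hf hg m Pm; rewrite mcoeffD hf ?hg ?addr0. Qed.

Lemma supp_inZ P c f : supp_in P f -> supp_in P (c *: f).
Proof. by move=> hf m Pm; rewrite mcoeffZ hf ?mulr0. Qed.

Lemma supp_in_sum P (I : Type) (r : seq I) (B : pred I) (F : I -> {mpoly k[N]}) :
  (forall i, B i -> supp_in P (F i)) -> supp_in P (\sum_(i <- r | B i) F i).
Proof. by move=> h; elim/big_ind: _ => //; [apply: supp_in0 | apply: supp_inD]. Qed.

Lemma supp_inX P m : P m -> supp_in P 'X_[m].
Proof. by move=> Pm m'; rewrite mcoeffX; case: eqP => // <-; rewrite Pm. Qed.

Lemma supp_inS P Q f : (forall m, P m -> Q m) -> supp_in P f -> supp_in Q f.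
Proof. by move=> PQ hf m Qm; apply: hf; apply: contra Qm; apply: PQ. Qed.

Lemma supp_in_lin P f (L : {additive {mpoly k[N]} -> {mpoly k[N]}}) Q :
  (forall c g, L (c *: g) = c *: L g) ->
  (forall m, P m -> supp_in Q (L 'X_[m])) -> supp_in P f -> supp_in Q (L f).
Proof.
move=> LZ LX hf; rewrite [f]mpolyE raddf_sum; apply: supp_in_sum => m _; rewrite /= LZ.
have [/LX/supp_inZ // | /hf ->] := boolP (P m).
by rewrite scale0r; apply: supp_in0.
Qed.

Lemma supp_inMX P Q m f : (forall m', P m' -> Q (m + m')%MM) ->
  supp_in P f -> supp_in Q ('X_[m] * f).
Proof.
move=> PQ hf; rewrite [f]mpolyE mulr_sumr; apply: supp_in_sum => m' _.
rewrite -scalerAr -mpolyXD; have [/PQ/supp_inX/supp_inZ // | /hf ->] := boolP (P m').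
by rewrite scale0r; apply: supp_in0.
Qed.

Lemma supp_in_ideal P f g : (forall m m', P m' -> P (m + m')%MM) ->
  supp_in P g -> supp_in P (f * g).
Proof.
move=> PD hg; rewrite [f]mpolyE mulr_suml; apply: supp_in_sum => m _.
rewrite -scalerAl; apply: supp_inZ; apply: supp_inMX hg => m'; exact: PD.
Qed.

Definition mcomp P f : {mpoly k[N]} := \sum_(m <- msupp f | P m) f@_m *: 'X_[m].

Lemma mcompE P f m : (mcomp P f)@_m = if P m then f@_m else 0.
Proof.
rewrite raddf_sum /=; have e m' : (f@_m' *: 'X_[m'])@_m = f@_m' *+ (m' == m).
  by rewrite mcoeffZ mcoeffX mulr_natr.
under eq_bigr do rewrite e.
rewrite big_mkcond /=; have [mf | mf] := boolP (m \in msupp f).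
  rewrite (bigD1_seq m) ?msupp_uniq //= eqxx mulr1n big1 ?addr0 // => m' /negPf->.
  by rewrite mulr0n if_same.
rewrite (memN_msupp_eq0 mf) if_same big1_seq // => m' /andP[_ m'f].
have /negPf-> : m' != m by apply: contraNneq mf => <-.
by rewrite mulr0n if_same.
Qed.

Lemma supp_in_mcomp P f : supp_in P (mcomp P f).
Proof. by move=> m /negPf Pm; rewrite mcompE Pm. Qed.

Lemma mcomp_id P f : supp_in P f -> mcomp P f = f.
Proof. by move=> hf; apply/mpolyP => m; rewrite mcompE; case: ifPn => // /hf. Qed.

Lemma mcomp_disjoint P Q f : (forall m, Q m -> ~~ P m) -> supp_in Q f -> mcomp P f = 0.
Proof.
move=> QP hf; apply/mpolyP => m; rewrite mcompE mcoeff0; case: ifP => // Pm.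
by apply: hf; apply: contraTN Pm => /QP.
Qed.

Lemma mcompB P f g : mcomp P (f - g) = mcomp P f - mcomp P g.
Proof.
by apply/mpolyP => m; rewrite mcoeffB !mcompE; case: ifP; rewrite ?mcoeffB ?subr0.
Qed.

Lemma mcompD P f g : mcomp P (f + g) = mcomp P f + mcomp P g.
Proof.
by apply/mpolyP => m; rewrite mcoeffD !mcompE; case: ifP; rewrite ?mcoeffD ?addr0.
Qed.

Lemma mcompC P f : f = mcomp P f + mcomp (predC P) f.
Proof. by apply/mpolyP => m; rewrite mcoeffD !mcompE /=; case: ifP; rewrite ?addr0 ?add0r. Qed.

Lemma mcomp_comm (L : {additive {mpoly k[N]} -> {mpoly k[N]}}) P Q f :
  (forall g, supp_in P g -> supp_in Q (L g)) ->
  (forall g, supp_in (predC P) g -> supp_in (predC Q) (L g)) ->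
  mcomp Q (L f) = L (mcomp P f).
Proof.
move=> LP LC; rewrite {1}(mcompC P f) raddfD mcompD mcomp_id; last exact/LP/supp_in_mcomp.
by rewrite (@mcomp_disjoint Q (predC Q)) ?addr0 //; apply: LC; apply: supp_in_mcomp.
Qed.

End Support.

Section ShiftSupport.
Variables (k : fieldType) (p v : nat).
Local Notation N := (p * v)%N.
Local Notation D := (@shiftD k p v).
Implicit Types (f g : {mpoly k[N]}) (P Q : pred 'X_{1..N}).

Lemma shiftD_supp P Q f :
  (forall m (i i' : 'I_p) (j : 'I_v), P m -> (m (mxtens_index (i, j)))%:R != 0 :> k -> i' = i.+1 :> nat ->
     Q (m - U_(mxtens_index (i, j)) + U_(mxtens_index (i', j)))%MM) ->
  supp_in P f -> supp_in Q (D f).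
Proof.
move=> PQ; apply: supp_in_lin => [c g | m Pm]; first exact: shiftDZ.
rewrite [X in supp_in _ X]shiftDXm; apply: supp_in_sum => l _; case: (mxtens_indexP l) => i j.
rewrite next_varP; case: insubP => [i' _ i'E | _] /=; last by rewrite scaler0; apply: supp_in0.
have [-> | mij] := eqVneq ((m (mxtens_index (i, j)))%:R : k) 0.
  by rewrite scale0r; apply: supp_in0.
by apply/supp_inZ/supp_inX/PQ.
Qed.

Definition mnm_additive (phi : 'X_{1..N} -> nat) :=
  forall m m', phi (m + m')%MM = (phi m + phi m')%N.

Lemma coef_neq0_le (m : 'X_{1..N}) l : (m l)%:R != 0 :> k -> (U_(l) <= m)%MM.
Proof. by move=> ml; rewrite lep1mP; apply: contraNneq ml => ->. Qed.

Definition wt (m : 'X_{1..N}) : nat := \sum_i \sum_j m (mxtens_index (i, j)) * i.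
Definition bdeg (j : 'I_v) (m : 'X_{1..N}) : nat := \sum_i m (mxtens_index (i, j)).

Lemma wtD : mnm_additive wt.
Proof.
move=> m m'; rewrite /wt -big_split; apply: eq_bigr => i _ /=.
by rewrite -big_split; apply: eq_bigr => j _; rewrite mnmDE mulnDl.
Qed.

Lemma bdegD j : mnm_additive (bdeg j).
Proof. by move=> m m'; rewrite /bdeg -big_split; apply: eq_bigr => i _; rewrite mnmDE. Qed.

Lemma bdegU i j j' : bdeg j' U_(mxtens_index (i, j)) = (j == j').
Proof.
rewrite /bdeg (bigD1 i) //= mnm1E big1 ?addn0 => [|i' i'i].
  by rewrite (can_eq (@mxtens_indexK _ _)) xpair_eqE eqxx.
by rewrite mnm1E (can_eq (@mxtens_indexK _ _)) xpair_eqE eq_sym (negPf i'i).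
Qed.

Lemma wtU i j : wt U_(mxtens_index (i, j)) = i.
Proof.
rewrite /wt (bigD1 i) //= (bigD1 j) //= mnm1E eqxx mul1n big1 => [|j' j'j].
  rewrite addn0 big1 ?addn0 // => i' i'i; rewrite big1 // => j' _.
  by rewrite mnm1E (can_eq (@mxtens_indexK _ _)) xpair_eqE eq_sym (negPf i'i).
by rewrite mnm1E (can_eq (@mxtens_indexK _ _)) xpair_eqE [j == _]eq_sym (negPf j'j) andbF.
Qed.

(** A monomial of [D f] comes from one of [f] by replacing one [x_(i, j)] by
[x_(i+1, j)], so a condition on an additive invariant is tested on the variables.
This serves for the degree [bdeg] in a block of variables [x_(0, j), ...,
x_(p-1, j)], which [D] preserves, and for the weight [wt], which it raises by
one. *)
Lemma shiftD_grading (P Q : pred nat) phi f :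
  mnm_additive phi ->
  (forall (i i' : 'I_p) (j : 'I_v) n, i' = i.+1 :> nat ->
    P (n + phi U_(mxtens_index (i, j))%MM)%N -> Q (n + phi U_(mxtens_index (i', j))%MM)%N) ->
  supp_in (fun m => P (phi m)) f -> supp_in (fun m => Q (phi m)) (D f).
Proof.
move=> phiD PQ; apply: shiftD_supp => m i i' j Pm mij i'E /=.
by rewrite phiD; apply: PQ i'E _; rewrite -phiD submK // coef_neq0_le.
Qed.

End ShiftSupport.

(** * Acyclicity of the shift derivation *)

Section ShiftAcyclic.
Variables (k : fieldType) (p v : nat) (charp : p \in [pchar k]).
Local Notation N := (p * v)%N.
Local Notation D := (@shiftD k p v).
Local Notation expo m i j := ((m : 'X_{1..N}) (mxtens_index (i, j))).
Implicit Types (f g : {mpoly k[N]}) (P Q : pred 'X_{1..N}).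

Let p_pr : prime p. Proof. by case/andP: charp. Qed.
Let p_gt0 : (0 < p)%N. Proof. exact: prime_gt0. Qed.
Let charP : p \in [pchar {mpoly k[N]}] := rmorph_pchar (@mpolyC N k) charp.

(** The monomials in which the block [j] enters through [x_(0, j)^p] only. *)
Definition pure (j : 'I_v) (m : 'X_{1..N}) : bool :=
  [forall i : 'I_p, if i == 0%N :> nat then (p %| (expo m i j))%N else (expo m i j) == 0%N].

Definition pure_on (S : {set 'I_v}) (m : 'X_{1..N}) : bool :=
  [forall j, (j \in S) ==> pure j m].

(** The monomials of the ideal generated by [x_(0, j)^p], [x_(s, j)], ...,
[x_(p-1, j)]. *)
Definition bad (j : 'I_v) (s : nat) (m : 'X_{1..N}) : bool :=
  [exists i : 'I_p, ((i == 0%N :> nat) && (p <= (expo m i j))%N) || ((s <= i)%N && (0 < (expo m i j))%N)].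

Lemma mnm_moveE (m : 'X_{1..N}) (i i' a : 'I_p) (j b : 'I_v) :
  expo (m - U_(mxtens_index (i, j)) + U_(mxtens_index (i', j)))%MM a b =
  ((expo m a b) - ((i == a) && (j == b)) + ((i' == a) && (j == b)))%N.
Proof. by rewrite mnmDE mnmBE !mnm1E !(can_eq (@mxtens_indexK _ _)) !xpair_eqE. Qed.

Lemma subgroup_supp P : subgroup (supp_in (k := k) P).
Proof. by split; [apply: supp_in0 | move=> f g; apply: supp_inB]. Qed.

Lemma shiftD_pure j0 f : supp_in (pure j0) f -> supp_in (pure j0) (D f).
Proof.
apply: shiftD_supp => m i i' j pm mij i'E.
apply/forallP => a; rewrite mnm_moveE; move/forallP/(_ a): (pm).
have [jj0 | _] := eqVneq j j0; last by rewrite !andbF subn0 addn0.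
subst j0; move/forallP/(_ i): pm; case: eqP => [i0 | _ /eqP mij0].
  by rewrite (dvdn_pcharf charp) (negPf mij).
by rewrite mij0 eqxx in mij.
Qed.

Lemma shiftD_pure_on S f : supp_in (pure_on S) f -> supp_in (pure_on S) (D f).
Proof.
move=> hf m; rewrite negb_forall => /existsP[j]; rewrite negb_imply => /andP[jS pm].
apply: (shiftD_pure (j0 := j)) pm; apply: supp_inS hf => m' /forallP/(_ j).
by rewrite jS.
Qed.

Lemma shiftD_bdeg j d f :
  supp_in (fun m => bdeg j m == d) f -> supp_in (fun m => bdeg j m == d) (D f).
Proof.
apply: (shiftD_grading (P := pred1 d) (Q := pred1 d)); first exact: bdegD.
by move=> i i' j' n _ /=; rewrite !bdegU.
Qed.

(** The exponent of [x_(0, j)] drops below [p] only from [p], where the derivative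
of [x_(0, j)^p] vanishes. *)
Lemma shiftD_bad j s f : (0 < s)%N -> supp_in (bad j s) f -> supp_in (bad j s) (D f).
Proof.
move=> s_gt0; apply: shiftD_supp => m i i' j' /existsP[a bada] mij i'E; apply/existsP.
case/orP: bada => [/andP[a0 pm] | /andP[sa ma]].
  exists a; rewrite mnm_moveE a0 /=; apply/orP; left.
  have -> : (i' == a) = false by apply/negbTE; rewrite -(inj_eq val_inj) /= i'E (eqP a0).
  rewrite addn0; have [/andP[/eqP ia /eqP jj] | _] := boolP ((i == a) && (j' == j)); last by rewrite subn0.
  subst a j'; move: mij; rewrite -(dvdn_pcharf charp) => mij.
  have : (expo m i j) != p by apply: contraNneq mij => ->.
  by move: pm; lia.
have [/andP[/eqP ia /eqP jj] | nia] := boolP ((i == a) && (j' == j)).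
  exists i'; apply/orP; right; rewrite mnm_moveE jj !eqxx addn1 i'E ia.
  by apply/andP; split; first exact: leqW.
exists a; apply/orP; right; rewrite sa mnm_moveE (negPf nia) subn0 /=; exact: ltn_addr.
Qed.

Section Block.
Variables (j : 'I_v) (S : {set 'I_v}).
Hypothesis jS : j \notin S.

Definition block_cond d (m : 'X_{1..N}) : bool := (bdeg j m == d) && pure_on S m.
Local Notation C d := (supp_in (k := k) (block_cond d)).

Lemma supp_in_and P Q f : supp_in (fun m => P m && Q m) f <-> supp_in P f /\ supp_in Q f.
Proof.
split=> [h | [hP hQ] m]; last by rewrite negb_and => /orP[/hP | /hQ].
by split; apply: supp_inS h => m /andP[].
Qed.

Lemma stableC d : stable D (C d).
Proof.
split; first exact: subgroup_supp.
move=> f /supp_in_and[hb hp]; apply/supp_in_and; split.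
  exact: shiftD_bdeg.
exact: shiftD_pure_on.
Qed.

Lemma stable_bad s : (0 < s)%N -> stable D (supp_in (bad j s)).
Proof. by move=> s0; split; [apply: subgroup_supp | move=> f; apply: shiftD_bad]. Qed.

Lemma block_condM i d m : block_cond d.+1 (U_(mxtens_index (i, j)) + m)%MM = block_cond d m.
Proof.
rewrite /block_cond bdegD bdegU eqxx add1n eqSS; congr (_ && _).
apply: eq_forallb => j'; have [j'S /= | //] := boolP (j' \in S).
apply: eq_forallb => i'; rewrite mnmDE mnm1E (can_eq (@mxtens_indexK _ _)) xpair_eqE.
have /negPf-> : j != j' by apply: contraNneq jS => ->.
by rewrite andbF add0n.
Qed.

Lemma bad_ideal s m m' : bad j s m' -> bad j s (m + m')%MM.
Proof.
case/existsP=> i h; apply/existsP; exists i; rewrite mnmDE.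
by case/orP: h => /andP[-> h] /=; apply/orP; [left | right]; move: h; lia.
Qed.

Let o0 : 'I_p := Ordinal p_gt0.

Lemma bdeg_pure m : (forall i : 'I_p, (0 < i)%N -> expo m i j = 0%N) -> bdeg j m = expo m o0 j.
Proof.
move=> m0; rewrite /bdeg (bigD1 o0) //= big1 ?addn0 // => i io.
by apply: m0; rewrite lt0n; apply: contra io => /eqP i0; apply/eqP/val_inj.
Qed.

(** Induction on the number [s] of variables of the block that are not killed;
multiplication by the last of them relates the quotients for [s] and [s.+1]. *)
Lemma acyclic_block s d : (0 < s <= p)%N -> (p < d + s)%N ->
  acyclic p D (C d) (supp_in (bad j s)).
Proof.
elim: s d => // -[|s] IH d /andP[_ sp] pds.
  move=> f Cf _; exists 0; first exact: supp_in0.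
  rewrite iterD0 subr0; apply: supp_inS Cf => m /andP[/eqP md _].
  have [/existsP[i i0] | /existsPn h] := boolP [exists i : 'I_p, (0 < i)%N && (0 < expo m i j)%N].
    by apply/existsP; exists i; rewrite i0 orbT.
  apply/existsP; exists o0; apply/orP; left; rewrite /= -bdeg_pure ?md; first by lia.
  by move=> i i0; have := h i; rewrite i0 /= lt0n negbK => /eqP.
pose iz : 'I_p := Ordinal sp; pose iy : 'I_p := Ordinal (ltnW sp).
pose z : {mpoly k[N]} := 'X_(mxtens_index (iz, j)).
pose y : {mpoly k[N]} := 'X_(mxtens_index (iy, j)).
have badS m : bad j s.+2 m -> bad j s.+1 m.
  case/existsP=> i h; apply/existsP; exists i; case/orP: h => [-> // | /andP[si ->]].
  by rewrite (ltnW si) orbT.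
have Dy : D y = z.
  rewrite shiftDX /shift_var next_varP; case: insubP => [i' _ /= i'E | /=]; last by rewrite sp.
  by congr 'X_(mxtens_index (_, j)); apply: val_inj.
have Dz : supp_in (bad j s.+2) (D z).
  rewrite shiftDX /shift_var next_varP; case: insubP => [i' _ /= i'E | _ /=]; last exact: supp_in0.
  apply: supp_inX; apply/existsP; exists i'; rewrite mnm1E eqxx i'E /=.
  by rewrite leqnn.
have zI f : supp_in (bad j s.+2) (z * f) -> supp_in (bad j s.+2) f.
  move=> zf m mb; have := zf (U_(mxtens_index (iz, j)) + m)%MM.
  rewrite mulrC mcoeffMX; apply; apply: contra mb => /existsP[i h].
  apply/existsP; exists i; move: h; rewrite mnmDE mnm1E (can_eq (@mxtens_indexK _ _)) xpair_eqE eqxx andbT.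
  by have [<- /= | _] := eqVneq iz i; rewrite ?addn0 // ltnn.
have JI d' f : C d'.+1 f -> supp_in (bad j s.+1) f ->
    exists2 u, C d' u & supp_in (bad j s.+2) (f - z * u).
  move=> Cf Jf.
  have divz m : bad j s.+1 m -> ~~ bad j s.+2 m -> (U_(mxtens_index (iz, j)) <= m)%MM.
    case/existsP=> i mi /existsPn/(_ i); rewrite negb_or lep1mP => /andP[h1 h2].
    case/orP: mi => [mi | /andP[si mi]]; first by rewrite mi in h1.
    move: h2; rewrite mi andbT -ltnNge ltnS => is1.
    have -> : iz = i by apply/val_inj/eqP; rewrite eqn_leq si.
    by rewrite -lt0n.
  exists (\sum_(m <- msupp f | ~~ bad j s.+2 m) f@_m *: 'X_[m - U_(mxtens_index (iz, j))]).
    apply: supp_in_sum => m mb; have [mc | /Cf ->] := boolP (block_cond d'.+1 m); last first.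
      by rewrite scale0r; apply: supp_in0.
    have [mJ | /Jf ->] := boolP (bad j s.+1 m); last by rewrite scale0r; apply: supp_in0.
    apply/supp_inZ/supp_inX; rewrite -(block_condM iz) addmC submK //; exact: divz.
  rewrite mulr_sumr (eq_bigr (fun m => f@_m *: 'X_[m])) => [|m mb].
    rewrite {1}(mcompC (bad j s.+2) f) [X in _ - X](_ : _ = mcomp (predC (bad j s.+2)) f) // addrK.
    exact: supp_in_mcomp.
  rewrite -scalerAr -mpolyXD; have [mJ | /Jf ->] := boolP (bad j s.+1 m); last by rewrite !scale0r.
  by rewrite addmC submK //; apply: divz.
apply: (acyclic_step charP (@shiftDM _ _ _) (fun f => iterp_shiftD f charp)
  (C := fun d => C d) (I := supp_in (bad j s.+2)) (J := supp_in (bad j s.+1)) (y := y) (z := z)) => //.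
- by move=> d'; apply: stableC.
- exact: stable_bad.
- exact: stable_bad.
- by move=> f g; apply: supp_in_ideal => m m'; apply: bad_ideal.
- by move=> f g; apply: supp_in_ideal => m m'; apply: bad_ideal.
- by move=> f; apply: supp_inS.
- apply: supp_inX; apply/existsP; by exists iz; rewrite /= mnm1E eqxx leqnn.
- by move=> d' f hf; apply: supp_inMX hf => m; rewrite block_condM.
by move=> d' dd'; apply: IH; lia.
Qed.

Lemma expo_le_bdeg m i : (expo m i j <= bdeg j m)%N.
Proof. by rewrite /bdeg (bigD1 i) //= leq_addr. Qed.

Let qm : 'X_{1..N} := (U_(mxtens_index (o0, j)) *+ p)%MM.
Let q : {mpoly k[N]} := 'X_[qm].

Lemma block_condMp n d m :
  block_cond (n + d)%N (U_(mxtens_index (o0, j)) *+ n + m)%MM = block_cond d m.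
Proof. by elim: n => [|n IH]; rewrite ?mulm0n ?add0m // mulmS -addmA block_condM. Qed.

Lemma pure_onMp m : pure_on (j |: S) m -> pure_on (j |: S) (qm + m)%MM.
Proof.
move/forallP=> pm; apply/forallP => j'; apply/implyP => /(implyP (pm j'))/forallP pj.
apply/forallP => i; have := pj i; rewrite mnmDE mulmnE mnm1E (can_eq (@mxtens_indexK _ _)) xpair_eqE.
case: ifP => [_ | i0]; first by move=> h; rewrite dvdn_add // dvdn_mull.
by have -> : (o0 == i) = false by apply: contraFF i0 => /eqP <-.
Qed.

Lemma q_inj f : q * f = 0 -> f = 0.
Proof.
move=> qf; apply/mpolyP => m; rewrite mcoeff0.
by rewrite -(mcoeffMX f qm) mulrC -/q qf mcoeff0.
Qed.

(** A cycle in the block [j] is a boundary modulo the multiples of the invariant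
[x_(0, j)^p], which can be divided out. *)
Lemma cycle_block d f : C d f -> D f = 0 ->
  exists g h, supp_in (pure_on (j |: S)) h /\ f = iter p.-1 D g + h.
Proof.
elim/ltn_ind: d f => -[|d] IH f Cf Df.
  exists 0, f; rewrite iterD0 add0r; split=> //; apply: supp_inS Cf => m /andP[/eqP m0 pm].
  apply/forallP => j'; apply/implyP; rewrite in_setU1 => /orP[/eqP -> | ]; last exact/implyP/(forallP pm).
  apply/forallP => i; have /eqP -> : expo m i j == 0%N.
    by rewrite -leqn0 -m0 expo_le_bdeg.
  by rewrite dvdn0 if_same.
have [|||g Cg bg] := @acyclic_block p d.+1 _ _ f Cf.
- by rewrite p_gt0 leqnn.
- by rewrite addSn ltnS leq_addl.
- by rewrite [X in supp_in _ X]Df; apply: supp_in0.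
pose r := f - iter p.-1 D g.
have Cr : C d.+1 r by apply: supp_inB => //; exact: (stable_iter p.-1 (stableC _) Cg).
have Dr : D r = 0 by rewrite shiftDB Df -iterS prednK // iterp_shiftD // subrr.
have rE m : r@_m != 0 -> (p <= expo m o0 j)%N.
  move=> rm; have /existsP[i] : bad j p m by apply: contraNT rm => /bg ->.
  case/orP=> [/andP[/eqP i0 h] | /andP[pi _]]; last by rewrite leqNgt ltn_ord in pi.
  by have -> : o0 = i by apply: val_inj.
pose f1 := \sum_(m <- msupp r) r@_m *: 'X_[m - qm].
have qle m : r@_m != 0 -> (qm <= m)%MM.
  move/rE => h; apply/mnm_lepP => l; rewrite mulmnE mnm1E.
  by case: eqP => [<- | _]; rewrite ?mul1n ?mul0n.
have rq : r = q * f1.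
  rewrite [LHS]mpolyE mulr_sumr; apply: eq_bigr => m _; rewrite -scalerAr -mpolyXD.
  have [-> | /qle h] := eqVneq r@_m 0; first by rewrite !scale0r.
  by rewrite addmC submK.
have Df1 : D f1 = 0.
  apply: q_inj; have : D (q * f1) = 0 by rewrite -rq.
  by rewrite shiftDM /q /qm -mpolyXn (DXp charP (@shiftDM _ _ _)) mul0r add0r.
have Cf1 : C (d.+1 - p)%N f1.
  apply: supp_in_sum => m _; have [-> | rm] := eqVneq r@_m 0; first by rewrite scale0r; apply: supp_in0.
  have mc : block_cond d.+1 m by apply: contraNT rm => /Cr ->.
  apply/supp_inZ/supp_inX; rewrite -(block_condMp p) -/qm addmC (submK (qle _ rm)).
  rewrite subnKC //; case/andP: mc => /eqP <- _; apply: leq_trans (rE _ rm) _.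
  exact: expo_le_bdeg.
have [|g1 [h1 [ph1 f1E]]] := IH (d.+1 - p)%N _ f1 Cf1 Df1; first by rewrite ltn_subrL p_gt0.
exists (g + q * g1), (q * h1); split; first by apply: supp_inMX ph1 => m; apply: pure_onMp.
have Dq : D q = 0 by rewrite /q /qm -mpolyXn (DXp charP (@shiftDM _ _ _)).
have iterq n : iter n D (q * g1) = q * iter n D g1.
  by elim: n => //= n ->; rewrite shiftDM Dq mul0r add0r.
by rewrite iterDD iterq -addrA -mulrDr -f1E -rq addrC subrK.
Qed.

End Block.

(** The blocks are treated one after the other. A cycle pure in the blocks of [S]
splits into pieces homogeneous in the next block, since [D] preserves this degree,
and [cycle_block] applies to each piece. *)
Lemma cycles_pure f : D f = 0 ->
  exists g h, supp_in (pure_on setT) h /\ f = iter p.-1 D g + h.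
Proof.
move=> Df; suff [g [h [ph fE]]] : exists g h,
    supp_in (pure_on [set j in enum 'I_v]) h /\ f = iter p.-1 D g + h.
  exists g, h; split=> //; apply: supp_inS ph => m.
  by rewrite (_ : [set j in _] = setT) //; apply/setP=> j; rewrite !inE mem_enum.
elim: (enum _) => [|j s [g [h [ph fE]]]].
  exists 0, f; rewrite iterD0 add0r; split=> // m.
  by case/negP; apply/forallP => j; rewrite !inE.
have [js | js] := boolP (j \in s).
  exists g, h; split=> //; rewrite (_ : [set j' in j :: s] = [set j' in s]) //.
  by apply/setP=> j'; rewrite !inE; case: eqP => // ->.
pose S := [set j' in s]; have jS : j \notin S by rewrite inE.
have Dh : D h = 0.
  have : D f = D (iter p.-1 D g) + D h by rewrite fE shiftDD.
  by rewrite Df -iterS prednK // iterp_shiftD // add0r.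
suff bounded n h' : supp_in (fun m => (bdeg j m < n)%N && pure_on S m) h' -> D h' = 0 ->
    exists g1 h1, supp_in (pure_on (j |: S)) h1 /\ h' = iter p.-1 D g1 + h1.
  have [|g1 [h1 [ph1 hE]]] := bounded (msize h) h _ Dh.
    move=> m; rewrite negb_and => /orP[mh | /ph //].
    apply/memN_msupp_eq0/msize_mdeg_ge; apply: leq_trans (_ : bdeg j m <= _)%N; first by rewrite leqNgt.
    rewrite mdegE sum_mxtens; apply: leq_sum => i _.
    by rewrite [X in (_ <= X)%N](bigD1 j) //= leq_addr.
  exists (g + g1), h1; rewrite iterDD -addrA -hE; split=> //.
  by rewrite (_ : [set j' in j :: s] = j |: S) //; apply/setP=> j'; rewrite !inE.
elim: n h' => [|n IH] h' ph' Dh'.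
  exists 0, 0; rewrite iterD0 addr0; split; first exact: supp_in0.
  by apply/mpolyP=> m; rewrite mcoeff0; apply: ph'.
pose P (m : 'X_{1..N}) := bdeg j m == n.
have comm (f' : {mpoly k[N]}) : mcomp P (D f') = D (mcomp P f').
  apply: mcomp_comm => f0; first exact: shiftD_bdeg.
  apply: (shiftD_grading (P := predC1 n) (Q := predC1 n)); first exact: bdegD.
  by move=> i i' j' n' _ /=; rewrite !bdegU.
have [|| g1 [h1 [ph1 h1E]]] := @cycle_block j S jS n (mcomp P h').
- by move=> m; rewrite negb_and mcompE /P; case: eqP => //= _ pm; apply: ph'; rewrite (negPf pm) andbF.
- by rewrite -comm Dh' (mcomp_disjoint (Q := pred0)) //; apply: supp_in0.
have [|| g2 [h2 [ph2 h2E]]] := IH (h' - mcomp P h').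
- move=> m; rewrite mcoeffB mcompE negb_and /P; case: (bdeg j m =P n) => [_ _ | nm mh]; first by rewrite subrr.
  rewrite subr0; apply: ph'; rewrite negb_and; case/orP: mh => [mh | ->]; last by rewrite orbT.
  by rewrite ltnS leq_eqVlt negb_or mh andbT; apply/orP; left; apply/eqP.
- by rewrite shiftDB Dh' -comm Dh' (mcomp_disjoint (Q := pred0)) ?subr0 //; apply: supp_in0.
exists (g1 + g2), (h1 + h2); split; first exact: supp_inD.
by rewrite iterDD addrACA -h1E -h2E addrC subrK.
Qed.

Lemma supp_in_pred0 f : supp_in pred0 f -> f = 0.
Proof. by move=> hf; apply/mpolyP=> m; rewrite mcoeff0; apply: hf. Qed.

Lemma pure_wt m : pure_on setT m -> wt m = 0%N.
Proof.
move=> pm; rewrite /wt big1 // => i _; rewrite big1 // => j _.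
have /forallP/(_ i) := implyP (forallP pm j) (in_setT j).
by case: eqP => [-> _ | _ /eqP ->]; rewrite ?muln0.
Qed.

Lemma shiftD_pure0 h : supp_in (pure_on setT) h -> D h = 0.
Proof.
move=> ph; apply: supp_in_pred0; apply: shiftD_supp ph => m i i' j pm mij _.
have /forallP/(_ i) := implyP (forallP pm j) (in_setT j).
case: eqP => [_ | _ /eqP m0]; last by rewrite m0 eqxx in mij.
by rewrite (dvdn_pcharf charp) (negPf mij).
Qed.

(** The offset [e] stands for weight [w - e]; no monomial qualifies when [w < e]. *)
Definition graded M w e (m : 'X_{1..N}) : bool := (mdeg m == M) && (wt m + e == w)%N.

Lemma mcomp_shiftD M w n e f :
  mcomp (graded M w n) (iter e D f) = iter e D (mcomp (graded M w (n + e)%N) f).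
Proof.
elim: e n f => [|e IH] n f; first by rewrite addn0.
rewrite iterSr IH addnS -[in RHS]addSn iterSr; congr (iter e D _).
have move_ok (m : 'X_{1..N}) (i i' : 'I_p) (j : 'I_v) : (m (mxtens_index (i, j)))%:R != 0 :> k ->
    i' = i.+1 :> nat ->
    graded M w (n + e)%N (m - U_(mxtens_index (i, j)) + U_(mxtens_index (i', j)))%MM =
    graded M w (n.+1 + e)%N m.
  move=> /coef_neq0_le le_m i'E; rewrite /graded -[in RHS](submK le_m) !mdegD !mdeg1.
  by rewrite !wtD !wtU i'E; congr (_ && (_ == _)); lia.
apply: mcomp_comm => g; apply: shiftD_supp => m i i' j hm mij i'E /=; by rewrite move_ok.
Qed.

(** A boundary [D^(p-1) g] has weight at least [p-1], so there is none in weight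
zero. *)
Lemma graded_cycle0 M f : supp_in (graded M 0 0) f -> D f = 0 -> supp_in (pure_on setT) f.
Proof.
move=> gf /cycles_pure[g [h [ph fE]]].
have := mcomp_id gf; rewrite {1}fE mcompD mcomp_shiftD.
rewrite (_ : mcomp _ g = 0) ?iterD0 ?add0r => [<- m pm | ]; first by rewrite mcompE ph // if_same.
apply/mpolyP=> m; rewrite mcompE mcoeff0 /graded add0n.
have -> : (wt m + p.-1 == 0)%N = false by have := prime_gt1 p_pr; lia.
by rewrite andbF.
Qed.

(** The homology of [D] is carried by the pure monomials, which have weight zero.
A primitive found modulo these is made homogeneous by projecting it to the right
weight. *)
Lemma graded_acyclic M w e f : (0 < e < p)%N -> (0 < w)%N ->
  supp_in (graded M w 0) f -> iter e D f = 0 ->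
  exists g, supp_in (graded M w (p - e)%N) g /\ f = iter (p - e) D g.
Proof.
move=> ep w0 gf Df; pose I := supp_in (k := k) (pure_on setT).
have sI : stable D I.
  by split; [apply: subgroup_supp | move=> h /shiftD_pure0 Dh; rewrite [X in I X]Dh; apply: supp_in0].
have sT : stable D (fun=> True) by [].
have acT : acyclic p D (fun=> True) I.
  move=> g _ Ig; have Dg : D g = 0.
    apply: supp_in_pred0 => m _; have [/pure_wt m0 | /Ig //] := boolP (pure_on setT m).
    have : supp_in (fun m => 0 < wt m)%N (D g).
      apply: (@shiftD_grading k p v predT (fun n => 0 < n)%N (@wt p v)) => //.
        exact: wtD.
      by move=> i i' j n i'E _; rewrite wtU i'E addnS.
    by apply; rewrite m0.
  have [g1 [h [ph ->]]] := cycles_pure Dg.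
  by exists g1 => //; rewrite addrAC subrr add0r.
have [|g _ Ig] := @acyclic_iter _ _ _ _ _ e f sT sI acT ep (Logic.I); first by rewrite Df; apply: supp_in0.
exists (mcomp (graded M w (p - e)%N) g); split; first exact: supp_in_mcomp.
have -> : iter (p - e) D (mcomp (graded M w (p - e)%N) g) = mcomp (graded M w 0) (iter (p - e) D g).
  by rewrite mcomp_shiftD add0n.
apply/eqP; rewrite -subr_eq0 -{1}(mcomp_id gf) -mcompB; apply/eqP.
apply: mcomp_disjoint Ig => m /pure_wt m0; rewrite /graded m0 addn0.
by rewrite negb_and orbC; case: (w) w0.
Qed.

End ShiftAcyclic.

(** * Divided powers and polynomials *)

Section Columns.
Variables (R : comNzRingType) (d N : nat).
Local Notation ix := (@enum_rank (mset_tuple d N)).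

Lemma s2m_inj : injective (fun b : mset_tuple d N => s2m (val b)).
Proof. by move=> b c /eqP; rewrite eq_s2m perm_sort_mset sort_msetK => /eqP. Qed.

Lemma s2m_onto (m : 'X_{1..N}) : mdeg m = d -> exists b : mset_tuple d N, s2m (val b) = m.
Proof.
move=> md; have sz : size (m2s m) == d by rewrite size_m2s md.
by exists (Sub (Tuple sz) (srt_m2s m)); rewrite /= s2mK.
Qed.

Lemma additive_s2m (phi : 'X_{1..N} -> nat) (w : seq 'I_N) :
  (forall m m', phi (m + m')%MM = (phi m + phi m')%N) ->
  phi (s2m w) = (\sum_(l <- w) phi U_(l)%MM)%N.
Proof.
move=> phiD; elim: w => [|l w IH]; rewrite (big_nil, big_cons).
  have -> : s2m [::] = 0%MM :> 'X_{1..N} by apply/mnmP=> i; rewrite [LHS]mnmE mnm0E.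
  by have := phiD 0%MM 0%MM; rewrite addm0; lia.
rewrite -IH -phiD; congr phi; apply/mnmP=> i; rewrite mnmDE mnm1E.
by rewrite [s2m w i]mnmE [LHS]mnmE.
Qed.

Lemma mdeg_s2m (w : d.-tuple 'I_N) : mdeg (s2m w) = d.
Proof.
rewrite (additive_s2m _ (@mdegD N)) (eq_bigr (fun=> 1%N)) => [|l _]; last exact: mdeg1.
by rewrite sum1_size size_tuple.
Qed.

(** A linear form on the [d]-th divided power of [k^N], read as a homogeneous
polynomial of degree [d] in [N] variables. *)
Definition col_poly (c : 'cV[R]_#|{: mset_tuple d N}|) : {mpoly R[N]} :=
  \sum_b c (ix b) 0 *: 'X_[s2m (val b)].

Lemma col_poly_coef c (b : mset_tuple d N) : (col_poly c)@_(s2m (val b)) = c (ix b) 0.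
Proof.
rewrite raddf_sum (bigD1 b) //= mcoeffZ mcoeffX eqxx mulr1 big1 ?addr0 // => b' b'b.
by rewrite mcoeffZ mcoeffX (inj_eq s2m_inj) (negPf b'b) mulr0.
Qed.

Lemma col_poly_inj : injective col_poly.
Proof.
move=> c c' e; apply/matrixP=> i j; rewrite ord1 -[i]enum_valK.
by rewrite -!col_poly_coef e.
Qed.

Lemma col_poly0 : col_poly 0 = 0.
Proof. by rewrite /col_poly big1 // => b _; rewrite mxE scale0r. Qed.

Lemma col_poly_deg c m : mdeg m != d -> (col_poly c)@_m = 0.
Proof.
move=> md; rewrite raddf_sum big1 //= => b _; rewrite mcoeffZ mcoeffX.
case: (s2m (val b) =P m) => [bm | _]; last by rewrite mulr0.
by case/eqP: md; rewrite -bm mdeg_s2m.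
Qed.

Lemma col_poly_onto f : (forall m, mdeg m != d -> f@_m = 0) -> exists c, f = col_poly c.
Proof.
move=> hf; exists (\col_(i < #|{: mset_tuple d N}|) f@_(s2m (val (enum_val i)))); apply/mpolyP=> m.
have [/s2m_onto[b <-] | md] := eqVneq (mdeg m) d; last by rewrite hf // col_poly_deg.
by rewrite col_poly_coef mxE enum_rankK.
Qed.

End Columns.

Section Substitution.
Variables (R : comNzRingType) (N N' : nat) (M : 'M[R]_(N, N')).

(** The substitution [x_l := sum_u M u l x_u], the action of [M] on polynomial
functions. *)
Definition mx_subst (f : {mpoly R[N']}) : {mpoly R[N]} :=
  mmap (@mpolyC N R) (fun l => \sum_u 'X_u * (M u l)%:MP) f.

HB.instance Definition _ := GRing.RMorphism.copy mx_subst
  (mmap (@mpolyC N R) (fun l => \sum_u 'X_u * (M u l)%:MP)).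

Lemma mx_substX l : mx_subst 'X_l = \sum_u 'X_u * (M u l)%:MP.
Proof. by rewrite /mx_subst mmapX mmap1U. Qed.

Lemma mx_substC c : mx_subst c%:MP = c%:MP.
Proof. exact: mmapC. Qed.

Lemma mx_substZ c f : mx_subst (c *: f) = c *: mx_subst f.
Proof. by rewrite -!mul_mpolyC rmorphM /= mx_substC. Qed.

(** The action of a divided power on linear forms is substitution in
polynomials. *)
Lemma col_poly_gamma d (c : 'cV[R]_#|{: mset_tuple d N'}|) :
  col_poly (gamma_mx d M *m c) = mx_subst (col_poly c).
Proof.
rewrite /col_poly raddf_sum /=.
transitivity (\sum_a \sum_(b : mset_tuple d N')
    (gamma_coef M a (val b) * c (enum_rank b) 0) *: ('X_[s2m (val a)] : {mpoly R[N]})).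
  apply: eq_bigr => a _; rewrite -scaler_suml; congr (_ *: _).
  rewrite mxE (reindex _ (onW_bij _ (@enum_rank_bij _))) /=.
  by apply: eq_bigr => b _; rewrite mxE !enum_rankK.
rewrite exchange_big /=; apply: eq_bigr => b _; rewrite mx_substZ.
rewrite -mpolyX_word rmorph_prod /=; under [X in _ = _ *: X]eq_bigr do rewrite mx_substX.
have := gamma_eval (map_mx (@mpolyC N R) M) (fun u => 'X_u) (val b).
under [X in _ = X -> _]eq_bigr do under eq_bigr do rewrite mxE.
move=> <-; rewrite scaler_sumr; apply: eq_bigr => a _.
have -> : gamma_coef (map_mx (@mpolyC N R) M) a (val b) = (gamma_coef M a (val b))%:MP.
  rewrite rmorph_sum /=; apply: eq_bigr => w _; rewrite rmorph_prod.
  by apply: eq_bigr => i _; rewrite mxE.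
by rewrite mpolyX_word [_ * _%:MP]mulrC mul_mpolyC scalerA mulrC.
Qed.

End Substitution.

Section Operators.
Variables (R : comNzRingType) (d d' N N' : nat).

Definition op_mx (L : {mpoly R[N]} -> {mpoly R[N']}) :
    'M[R]_(#|{: mset_tuple d' N'}|, #|{: mset_tuple d N}|) :=
  \matrix_(a < #|{: mset_tuple d' N'}|, b < #|{: mset_tuple d N}|)
    (L 'X_[s2m (val (enum_val b))])@_(s2m (val (enum_val a))).

Lemma col_poly_op (L : {additive {mpoly R[N]} -> {mpoly R[N']}}) c :
  (forall a f, L (a *: f) = a *: L f) ->
  (forall m, mdeg m = d -> forall m', mdeg m' != d' -> (L 'X_[m])@_m' = 0) ->
  col_poly (op_mx L *m c) = L (col_poly c).
Proof.
move=> LZ Ld; apply/mpolyP=> m; rewrite [in RHS]/col_poly [in RHS]raddf_sum [RHS]raddf_sum /=.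
have [/s2m_onto[b <-] | md] := eqVneq (mdeg m) d'.
  rewrite col_poly_coef mxE (reindex _ (onW_bij _ (@enum_rank_bij _))) /=.
  by apply: eq_bigr => a _; rewrite mxE !enum_rankK LZ mcoeffZ mulrC.
rewrite col_poly_deg // big1 // => b _; rewrite LZ mcoeffZ Ld ?mulr0 //; exact: mdeg_s2m.
Qed.

End Operators.

Lemma mpoly_rmorph_ext (R : comNzRingType) (S : nzRingType) N (f g : {rmorphism {mpoly R[N]} -> S}) :
  (forall c, f c%:MP = g c%:MP) -> (forall l, f 'X_l = g 'X_l) -> f =1 g.
Proof.
move=> fgC fgX h; rewrite [h]mpolyE !rmorph_sum; apply: eq_bigr => m _.
rewrite -mul_mpolyC !rmorphM fgC; congr (_ * _); rewrite mpolyXE_id !rmorph_prod.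
by apply: eq_bigr => l _; rewrite !rmorphXn fgX.
Qed.

(** * Idempotents *)

Section Idempotent.
Variables (k : fieldType) (d : nat).
Implicit Types F G : hspfunctor k d.

(** The image of an idempotent [pi] is the kernel of [1 - pi]. *)
Lemma idempotent_split F (pi : spf_hom F F) : (forall V, hmx pi V *m hmx pi V = hmx pi V) ->
  exists (G : hspfunctor k d) (s : spf_hom G F) (r : spf_hom F G),
    (forall V, hmx s V *m hmx r V = 1%:M) /\ (forall V, hmx r V *m hmx s V = hmx pi V).
Proof.
move=> pp.
have nat1 : @natural_mx k F F (fun V => 1%:M - hmx pi V).
  move=> A V W X; rewrite !map_mxB !(map_mx1 (in_alg A)) mulmxBr mulmxBl mulmx1 mul1mx.
  by rewrite (hmx_nat pi).
pose e := mkhom nat1; pose s := ker_inc e.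
have [r hr] : exists r : spf_hom F (hker e), forall V, hmx r V *m hmx s V = hmx pi V.
  apply: kernel_lift (@ker_inc_free _ _ _ _ e) (@ker_inc_exact _ _ _ _ e) _ => V.
  by rewrite [LHS]mulmxBr mulmx1 pp subrr.
exists (hker e), s, r; split=> // V; apply: (row_free_inj (ker_inc_free e V)).
rewrite -mulmxA hr mul1mx; have [s0 _] := ker_inc_exact e V.
by move: s0; rewrite [X in X = _ -> _]mulmxBr mulmx1 => /eqP; rewrite subr_eq0 => /eqP.
Qed.

(** A direct summand of [F] has a resolution by copies of [F], along an idempotent
and its complement. *)
Lemma n_resolved_retract F G n : retract G F -> n_resolved F n -> n_resolved G n.
Proof.
move=> rGF rF; apply: n_resolved_trans.
apply: (@resolved_by_coind _ _ _ (fun H => retract H F)) rGF => {G} G [s [r sr]].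
have sr_surj : surj r by move=> V; apply: row_full_id (esym (sr V)).
have nat1 : @natural_mx k F F (fun V => 1%:M - hmx r V *m hmx s V).
  move=> A V W X; have := hmx_nat (hcomp r s) X.
  rewrite !map_mxB !(map_mx1 (in_alg A)) mulmxBr mulmxBl mulmx1 mul1mx => ->.
  by [].
pose e := mkhom nat1; exists (hker r), F, (ker_inc r), r.
split=> //; last exact: ker_ses.
have [t ht] : exists t : spf_hom F (hker r), forall V, hmx t V *m hmx (ker_inc r) V = hmx e V.
  apply: kernel_lift (@ker_inc_free _ _ _ _ r) (@ker_inc_exact _ _ _ _ r) _ => V.
  by rewrite [LHS]mulmxBl mul1mx -mulmxA sr mulmx1 subrr.
exists (ker_inc r), t => V; apply: (row_free_inj (ker_inc_free r V)).
rewrite -mulmxA ht mul1mx [LHS]mulmxBr mulmx1 mulmxA.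
by case: (ker_inc_exact r V) => -> _; rewrite mul0mx subr0.
Qed.

Lemma n_resolved_cast d' F (h : homogeneous d' F) n :
  d = d' -> n_resolved F n -> n_resolved (HSPFunctor h) n.
Proof.
move=> e; subst d' => -[R hR].
by exists (@Resolution k d (HSPFunctor h) R (res_diff R) (res_aug R) (@res_aug_onto _ _ _ R)
  (@res_exact0 _ _ _ R) (@res_exactS _ _ _ R)).
Qed.

End Idempotent.

(** * A resolution of twisted divided powers *)

(** Operators on polynomials that commute with substitutions thus give natural
transformations between divided powers: columns are read as polynomials. *)
Lemma op_mx_natural (R : comNzRingType) d d' N1 N1' N2 N2'
    (M : 'M[R]_(N1, N2)) (M' : 'M[R]_(N1', N2'))
    (L1 : {additive {mpoly R[N1']} -> {mpoly R[N1]}})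
    (L2 : {additive {mpoly R[N2']} -> {mpoly R[N2]}}) :
  (forall a f, L1 (a *: f) = a *: L1 f) -> (forall a f, L2 (a *: f) = a *: L2 f) ->
  (forall m, mdeg m = d' -> forall m', mdeg m' != d -> (L1 'X_[m])@_m' = 0) ->
  (forall m, mdeg m = d' -> forall m', mdeg m' != d -> (L2 'X_[m])@_m' = 0) ->
  (forall f, mx_subst M (L2 f) = L1 (mx_subst M' f)) ->
  gamma_mx d M *m op_mx d' d L2 = op_mx d' d L1 *m gamma_mx d' M'.
Proof.
move=> L1Z L2Z L1d L2d comm; apply/trmx_inj/row_matrixP => i; apply: trmx_inj.
rewrite -!tr_col !trmxK !colE -!mulmxA; apply: col_poly_inj.
by rewrite col_poly_gamma !col_poly_op // col_poly_gamma comm.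
Qed.

Section ShiftOperator.
Variables (p v d : nat).
Local Notation N := (p * v)%N.

Lemma shiftD_coef (R : comNzRingType) (m m' : 'X_{1..N}) :
  (shiftD ('X_[m] : {mpoly R[N]}))@_m' =
  (\sum_l m l * (if next_var l is Some l' then (m - U_(l) + U_(l') == m')%MM : nat else 0))%:R.
Proof.
rewrite shiftDXm raddf_sum natr_sum; apply: eq_bigr => l _; rewrite /= mcoeffZ natrM.
by case: next_var => [l'|]; rewrite ?mcoeffX ?mcoeff0.
Qed.

Lemma shiftD_homog (R : comNzRingType) (m m' : 'X_{1..N}) :
  mdeg m = d -> mdeg m' != d -> (shiftD ('X_[m] : {mpoly R[N]}))@_m' = 0.
Proof.
move=> md md'; rewrite shiftD_coef big1 // => l _.
have [-> | ml] := eqVneq (m l) 0%N; first by rewrite mul0n.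
case: next_var => [l'|]; last by rewrite muln0.
case: eqP => [mm' | _]; last by rewrite muln0.
have le_m : (U_(l) <= m)%MM by rewrite lep1mP.
by case/eqP: md'; rewrite -mm' -md -[in RHS](submK le_m) !mdegD !mdeg1.
Qed.

Definition shift_mx (R : comNzRingType) := op_mx d d (@shiftD R p v).

Lemma map_shift_mx (R S : comNzRingType) (f : {rmorphism R -> S}) :
  map_mx f (shift_mx R) = shift_mx S.
Proof. by apply/matrixP=> a b; rewrite !mxE !shiftD_coef rmorph_nat. Qed.

Lemma col_poly_shift (R : comNzRingType) c :
  col_poly (shift_mx R *m c) = shiftD (col_poly c).
Proof. by apply: col_poly_op => [a f | m md m' md']; [apply: shiftDZ | apply: shiftD_homog]. Qed.

End ShiftOperator.

Lemma shiftD_subst (R : comNzRingType) p v w (Y : 'M[R]_(v, w)) (f : {mpoly R[p * w]}) :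
  mx_subst ((1%:M : 'M_p) *t Y) (shiftD f) = shiftD (mx_subst ((1%:M : 'M_p) *t Y) f).
Proof.
set s := mx_subst _; have s0 : s 0 = 0 by apply: rmorph0.
have s1 : s 1 = 1 by apply: rmorph1.
have sM g h : s (g * h) = s g * s h by apply: rmorphM.
have sD g h : s (g + h) = s g + s h by apply: rmorphD.
have sX i j : s 'X_(mxtens_index (i, j)) = \sum_h Y h j *: 'X_(mxtens_index (i, h)).
  rewrite /s mx_substX sum_mxtens (bigD1 i) //= [X in _ + X]big1 ?addr0 => [|i' i'i].
    by apply: eq_bigr => h _; rewrite tensmxE mxE eqxx mul1r mulrC mul_mpolyC.
  by rewrite big1 // => h _; rewrite tensmxE mxE (negPf i'i) mul0r mpolyC0 mulr0.
have DsX l : s (shiftD 'X_l) = shiftD (s 'X_l).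
  case: (mxtens_indexP l) => i j; rewrite sX shiftDX /shift_var next_varP raddf_sum /=.
  under [RHS]eq_bigr do rewrite shiftDZ shiftDX /shift_var next_varP.
  case: insubP => [i' _ _ | _] /=; first exact: sX.
  by rewrite s0 big1 // => h _; rewrite scaler0.
have Ds1 : s (shiftD 1) = shiftD (s 1) by rewrite s1 !(D1 (@shiftDM _ _ _)) s0.
have DsM g h : s (shiftD g) = shiftD (s g) -> s (shiftD h) = shiftD (s h) ->
    s (shiftD (g * h)) = shiftD (s (g * h)).
  by move=> eg eh; rewrite shiftDM sD !sM shiftDM eg eh.
rewrite [f]mpolyE; elim/big_ind: _ => [|g h eg eh|m _].
- by rewrite s0 !raddf0 s0.
- by rewrite sD !shiftDD sD eg eh.
rewrite shiftDZ /s !mx_substZ shiftDZ -/s; congr (_ *: _); rewrite mpolyXE_id.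
elim/big_ind: _ => // l _; elim: (m l) => [|e IH]; first by rewrite expr0.
by rewrite exprS; apply: DsM.
Qed.

Section WeightOperator.
Variables (k : fieldType) (p v d : nat).
Local Notation N := (p * v)%N.

Definition weight_mx (R : comNzRingType) w : 'M[R]_#|{: mset_tuple d N}| :=
  diag_mx (\row_(i < #|{: mset_tuple d N}|) (wt (s2m (val (enum_val i))) == w)%:R).

Lemma map_weight_mx (R S : comNzRingType) (f : {rmorphism R -> S}) w :
  map_mx f (weight_mx R w) = weight_mx S w.
Proof. by apply/matrixP=> a b; rewrite !mxE rmorphMn rmorph_nat. Qed.

Lemma col_poly_weight w c :
  col_poly (weight_mx k w *m c) = mcomp (fun m => wt m == w) (col_poly c).
Proof.
apply/mpolyP=> m; rewrite mcompE.
have [/s2m_onto[b <-] | md] := eqVneq (mdeg m) d; last by rewrite !col_poly_deg // if_same.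
rewrite !col_poly_coef mul_diag_mx !mxE enum_rankK.
by case: ifP; rewrite ?mul1r ?mul0r.
Qed.

Lemma weight_mxK w : weight_mx k w *m weight_mx k w = weight_mx k w.
Proof.
apply/matrixP=> a b; rewrite mul_diag_mx !mxE.
by case: (wt _ == w); rewrite ?mul1r ?mul0r ?mul0rn.
Qed.

End WeightOperator.

Lemma weight_natural (R : comNzRingType) p v w d e (Y : 'M[R]_(v, w)) :
  gamma_mx d ((1%:M : 'M_p) *t Y) *m weight_mx p w d R e =
  weight_mx p v d R e *m gamma_mx d ((1%:M : 'M_p) *t Y).
Proof.
apply/matrixP=> a b; rewrite mul_mx_diag mul_diag_mx !mxE.
have wtE u (c : mset_tuple d (p * u)) :
    wt (s2m (val c)) = (\sum_(l <- val c) (mxtens_unindex l).1)%N.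
  rewrite (additive_s2m _ (@wtD p u)); apply: eq_bigr => l _.
  by case: (mxtens_indexP l) => i j; rewrite wtU mxtens_indexK.
have [-> | ab] := eqVneq (wt (s2m (val (enum_val a)))) (wt (s2m (val (enum_val b)))).
  exact: mulrC.
rewrite (gamma_coef_weight (w := fun l => (mxtens_unindex l).1) (w' := fun l => (mxtens_unindex l).1)).
- by rewrite mul0r mulr0.
- move=> i j; case: (mxtens_indexP i) => i1 i2; case: (mxtens_indexP j) => j1 j2.
  rewrite !mxtens_indexK tensmxE mxE /=.
  by case: (i1 =P j1) => [-> | _ _]; rewrite ?eqxx // mul0r.
by rewrite -!wtE.
Qed.

Section FrobeniusLift.
Variables (p v : nat) (p_gt0 : (0 < p)%N).
Local Notation N := (p * v)%N.
Let o0 : 'I_p := Ordinal p_gt0.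

(** Its image is the span of the pure monomials. It carries the substitution by the
Frobenius twist of [Y] to the substitution by [Y] in all the blocks, which is why
the resolved functor is twisted once more. *)
Definition frob_lift (R : comNzRingType) (f : {mpoly R[v]}) : {mpoly R[N]} :=
  mmap (@mpolyC N R) (fun j => 'X_(mxtens_index (o0, j)) ^+ p) f.

HB.instance Definition _ (R : comNzRingType) := GRing.RMorphism.copy (@frob_lift R)
  (mmap (@mpolyC N R) (fun j => 'X_(mxtens_index (o0, j)) ^+ p)).

Definition frob_mnm (mu : 'X_{1..v}) : 'X_{1..N} :=
  (\sum_j U_(mxtens_index (o0, j)) *+ (p * mu j))%MM.

Lemma frob_mnmE mu i j : frob_mnm mu (mxtens_index (i, j)) = if i == o0 then (p * mu j)%N else 0%N.
Proof.
rewrite mnm_sumE (bigD1 j) //= mulmnE mnm1E big1 ?addn0 => [|j' j'j].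
  rewrite (can_eq (@mxtens_indexK _ _)) xpair_eqE eqxx andbT eq_sym.
  by case: eqP; rewrite ?mul1n ?mul0n.
by rewrite mulmnE mnm1E (can_eq (@mxtens_indexK _ _)) xpair_eqE (negPf j'j) andbF.
Qed.

Lemma frob_mnm_inj : injective frob_mnm.
Proof.
move=> mu nu e; apply/mnmP=> j; have := congr1 (fun m : 'X_{1..N} => m (mxtens_index (o0, j))) e.
by rewrite /= !frob_mnmE eqxx => /eqP; rewrite eqn_pmul2l // => /eqP.
Qed.

Lemma mdeg_frob_mnm mu : mdeg (frob_mnm mu) = (p * mdeg mu)%N.
Proof.
rewrite mdeg_sum mdegE big_distrr /=; apply: eq_bigr => j _.
by rewrite mdegMn mdeg1 mul1n.
Qed.

Lemma frob_liftZ (R : comNzRingType) c (f : {mpoly R[v]}) : frob_lift (c *: f) = c *: frob_lift f.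
Proof. by rewrite -!mul_mpolyC rmorphM /= [frob_lift c%:MP]mmapC. Qed.

Lemma frob_liftX (R : comNzRingType) mu : frob_lift ('X_[mu] : {mpoly R[v]}) = 'X_[frob_mnm mu].
Proof.
rewrite /frob_lift mmapX /mmap1 /frob_mnm -mprodXE; apply: eq_bigr => j _.
by rewrite -exprM mpolyXn.
Qed.

Lemma frob_lift_coef (R : comNzRingType) (f : {mpoly R[v]}) mu :
  (frob_lift f)@_(frob_mnm mu) = f@_mu.
Proof.
have -> : frob_lift f = \sum_(nu <- msupp f) f@_nu *: 'X_[frob_mnm nu].
  rewrite {1}(mpolyE f) [LHS]rmorph_sum; apply: eq_bigr => nu _.
  by rewrite [LHS]frob_liftZ frob_liftX.
rewrite [in RHS](mpolyE f) [LHS]raddf_sum [RHS]raddf_sum /=; apply: eq_bigr => nu _.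
by rewrite !mcoeffZ !mcoeffX (inj_eq frob_mnm_inj).
Qed.

End FrobeniusLift.

Lemma frob_lift_subst p v w (p_gt0 : (0 < p)%N) (R : comNzRingType) (Y : 'M[R]_(v, w))
    (f : {mpoly R[w]}) : p \in [pchar R] ->
  mx_subst ((1%:M : 'M_p) *t Y) (frob_lift p_gt0 f) =
  frob_lift p_gt0 (mx_subst (map_mx (fun a => a ^+ p) Y) f).
Proof.
move=> charR; pose o0 := Ordinal p_gt0.
pose g1 : {rmorphism {mpoly R[w]} -> {mpoly R[p * v]}} :=
  mx_subst ((1%:M : 'M_p) *t Y) \o frob_lift p_gt0 (v := w) (R := R).
pose g2 : {rmorphism {mpoly R[w]} -> {mpoly R[p * v]}} :=
  frob_lift p_gt0 (v := v) (R := R) \o mx_subst (map_mx (fun a => a ^+ p) Y).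
apply: (@mpoly_rmorph_ext _ _ _ g1 g2) => [c | j].
  by rewrite /= mx_substC [frob_lift p_gt0 _]mmapC [frob_lift p_gt0 _]mmapC mx_substC.
have charP : p \in [pchar {mpoly R[p * v]}] := rmorph_pchar (@mpolyC _ R) charR.
have frob_sum (I : finType) (F : I -> {mpoly R[p * v]}) : (\sum_i F i) ^+ p = \sum_i F i ^+ p.
  by rewrite -(pFrobenius_autE charP) raddf_sum; apply: eq_bigr => i _; rewrite /= pFrobenius_autE.
rewrite /= [frob_lift p_gt0 'X_j]mmapX mmap1U rmorphXn /= !mx_substX frob_sum sum_mxtens.
rewrite (bigD1 o0) //= [X in _ + X]big1 ?addr0 => [|i io]; last first.
  by rewrite big1 // => h _; rewrite tensmxE mxE (negPf io) mul0r mpolyC0 mulr0 expr0n gtn_eqF.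
rewrite raddf_sum /=; apply: eq_bigr => h _.
rewrite tensmxE [1%:M _ _]mxE eqxx mul1r rmorphM /= mxE exprMn.
rewrite [frob_lift p_gt0 'X_h]mmapX mmap1U [frob_lift p_gt0 _]mmapC. congr (_ * _); exact: (esym (rmorphXn (@mpolyC (p * v) R) p (Y h j))).
Qed.

Section Complex.
Variables (k : fieldType) (p : nat) (charp : p \in [pchar k]) (r d : nat).

Let p_pr : prime p. Proof. by case/andP: charp. Qed.
Let p_gt0 : (0 < p)%N. Proof. exact: prime_gt0. Qed.
Let o0 : 'I_p := Ordinal p_gt0.

Local Notation M := (precomp_ktens p (twist charp r (Gamma k (d * p)))).

Fact twistS_homogeneous : homogeneous (d * p * p ^ r) (twist charp r.+1 (Gamma k d)).
Proof. by rewrite -mulnA -expnS; apply: hspfP. Qed.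
Local Notation T := (HSPFunctor twistS_homogeneous).

Lemma M_mor (A : comAlgType k) (V W : vectType k) (X : 'M[A]_(dim V, dim W)) :
  spf_mor M X = gamma_mx (d * p) ((1%:M : 'M[A]_p) *t map_mx (fun a => a ^+ (p ^ r)) X).
Proof.
rewrite -[LHS]/(gamma_mx (d * p) (map_mx (frob charp r A) ((1%:M : 'M[A]_p) *t X))).
by rewrite map_mxT map_mx1.
Qed.

Lemma T_mor (A : comAlgType k) (V W : vectType k) (X : 'M[A]_(dim V, dim W)) :
  spf_mor T X =
  gamma_mx d (map_mx (fun a => a ^+ p) (map_mx (fun a => a ^+ (p ^ r)) X)).
Proof.
rewrite -[LHS]/(gamma_mx d (map_mx (fun a => a ^+ (p ^ r.+1)) X)); congr gamma_mx.
by apply/matrixP=> i j; rewrite !mxE -exprM expnSr.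
Qed.

Fact shift_nat : @natural_mx k M M (fun V => shift_mx p (dim V) (d * p) k).
Proof.
move=> A V W X; rewrite M_mor !(map_shift_mx _ _ _ (in_alg A)).
apply: op_mx_natural; try exact: shiftDZ; try by move=> m md m' md'; apply: shiftD_homog md md'.
by move=> f; rewrite shiftD_subst.
Qed.

Definition shift_hom : spf_hom M M := mkhom shift_nat.

Fixpoint shift_pow (e : nat) : spf_hom M M :=
  if e is e'.+1 then hcomp (shift_pow e') shift_hom else hid M.

Fact weight_nat w : @natural_mx k M M (fun V => weight_mx p (dim V) (d * p) k w).
Proof.
by move=> A V W X; rewrite M_mor !(map_weight_mx _ _ _ (in_alg A)) weight_natural.
Qed.

Definition weight_hom w : spf_hom M M := mkhom (weight_nat w).

Definition frob_mx (R : comNzRingType) v := op_mx d (d * p) (@frob_lift p v p_gt0 R).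

Lemma frob_lift_homog (R : comNzRingType) v (m : 'X_{1..v}) : mdeg m = d ->
  forall m', mdeg m' != (d * p)%N -> (frob_lift p_gt0 ('X_[m] : {mpoly R[v]}))@_m' = 0.
Proof.
move=> md m' md'; rewrite frob_liftX mcoeffX; case: eqP => // mm'.
by rewrite -mm' mdeg_frob_mnm md mulnC eqxx in md'.
Qed.

Lemma map_frob_mx (R S : comNzRingType) (f : {rmorphism R -> S}) v :
  map_mx f (frob_mx R v) = frob_mx S v.
Proof. by apply/matrixP=> a b; rewrite !mxE !frob_liftX !mcoeffX rmorph_nat. Qed.

Lemma col_poly_frob (R : comNzRingType) v c :
  col_poly (frob_mx R v *m c) = frob_lift p_gt0 (col_poly c).
Proof. by apply: col_poly_op; [apply: frob_liftZ | apply: frob_lift_homog]. Qed.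

Fact frob_nat : @natural_mx k M T (fun V => frob_mx k (dim V)).
Proof.
move=> A V W X; rewrite M_mor T_mor !(map_frob_mx (in_alg A)).
apply: op_mx_natural; try exact: frob_liftZ; try exact: frob_lift_homog.
by move=> f; rewrite frob_lift_subst // alg_pchar.
Qed.

Definition frob_hom : spf_hom M T := mkhom frob_nat.

Definition frob_root v (m : 'X_{1..p * v}) : 'X_{1..v} :=
  [multinom (m (mxtens_index (o0, j)) %/ p)%N | j < v].

Lemma pure_frob v (m : 'X_{1..p * v}) : pure_on setT m -> frob_mnm p_gt0 (frob_root m) = m.
Proof.
move=> pm; apply/mnmP=> l; case: (mxtens_indexP l) => i j; rewrite frob_mnmE mnmE.
have /forallP/(_ i) := implyP (forallP pm j) (in_setT j).
case: (i =P o0) => [-> /= h | io]; first by rewrite [LHS]mulnC divnK.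
by case: eqP => [i0 | _ /eqP //]; case: io; apply: val_inj.
Qed.

Lemma frob_mnm_pure v (mu : 'X_{1..v}) : pure_on setT (frob_mnm p_gt0 mu).
Proof.
apply/forallP => j; apply/implyP => _; apply/forallP => i; rewrite frob_mnmE.
case: (i =P o0) => [-> /= | io]; first exact: dvdn_mulr.
by case: ifP => // _; rewrite dvdn0.
Qed.

Lemma frob_lift_pure v (f : {mpoly k[v]}) : supp_in (pure_on setT) (frob_lift p_gt0 f).
Proof.
rewrite [f]mpolyE rmorph_sum; apply: supp_in_sum => m _.
rewrite [X in supp_in _ X]frob_liftZ frob_liftX; exact/supp_inZ/supp_inX/frob_mnm_pure.
Qed.

Section AtV.
Variable V : vectType k.
Implicit Types c : 'cV[k]_(dim (M V)).

Local Notation pol := (@col_poly k (d * p) (p * dim V)).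

Lemma pol_shift_pow e c : pol (hmx (shift_pow e) V *m c) = iter e (@shiftD k p (dim V)) (pol c).
Proof.
elim: e c => [|e IH] c; first by rewrite [hmx _ _ *m c]mul1mx.
by rewrite -[hmx _ _ *m c]mulmxA IH [pol _]col_poly_shift -iterSr.
Qed.

Lemma weight_fixed w c :
  hmx (weight_hom w) V *m c = c <-> supp_in (graded (d * p) w 0) (pol c).
Proof.
have wE : pol (hmx (weight_hom w) V *m c) = mcomp (fun m => wt m == w) (pol c).
  exact: col_poly_weight.
split=> [e m | h].
  rewrite negb_and addn0 => /orP[md | wm]; first exact: col_poly_deg.
  by rewrite -e wE mcompE (negPf wm).
apply: col_poly_inj; rewrite [LHS]wE mcomp_id //; apply: supp_inS h => m.
by case/andP=> _; rewrite addn0.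
Qed.

Lemma shift_weight w e c : hmx (weight_hom w) V *m c = c ->
  hmx (weight_hom (w + e)%N) V *m (hmx (shift_pow e) V *m c) = hmx (shift_pow e) V *m c.
Proof.
move=> /weight_fixed gc; apply/weight_fixed; rewrite pol_shift_pow.
have h : supp_in (graded (d * p) (w + e)%N (0 + e)) (pol c).
  by apply: supp_inS gc => m; rewrite /graded addn0 add0n eqn_add2r.
have := congr1 (iter e (@shiftD k p (dim V))) (mcomp_id h); rewrite -mcomp_shiftD // => <-.
exact: supp_in_mcomp.
Qed.

Lemma shift_powp e e' c : (e + e' = p)%N ->
  hmx (shift_pow e) V *m (hmx (shift_pow e') V *m c) = 0.
Proof.
move=> ee'; apply: col_poly_inj; rewrite [LHS]pol_shift_pow pol_shift_pow -iterD ee'.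
by rewrite iterp_shiftD // col_poly0.
Qed.

Lemma shift_exact w e e' c : (e + e' = p)%N -> (0 < e)%N -> (0 < e')%N ->
  hmx (weight_hom (w + e')%N) V *m c = c -> hmx (shift_pow e) V *m c = 0 ->
  exists c', hmx (weight_hom w) V *m c' = c' /\ c = hmx (shift_pow e') V *m c'.
Proof.
move=> ee' e0 e'0 /weight_fixed gc ec.
have [|||g [gg gE]] := @graded_acyclic k p (dim V) charp (d * p) (w + e')%N e (pol c) _ _ gc.
- by rewrite e0 -ee' -[X in (X < _)%N]addn0 ltn_add2l.
- by rewrite addn_gt0 e'0 orbT.
- by rewrite -pol_shift_pow ec col_poly0.
have e'E : (p - e = e')%N by rewrite -ee' addKn.
rewrite e'E in gg gE; have [|c' c'E] := @col_poly_onto k (d * p) (p * dim V) g.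
  by move=> m md; apply: gg; rewrite /graded (negPf md).
exists c'; split; last by apply: col_poly_inj; rewrite [RHS]pol_shift_pow -c'E.
apply/weight_fixed; rewrite -c'E; apply: supp_inS gg => m.
by rewrite /graded addn0 eqn_add2r.
Qed.

Lemma frob_inj (c : 'cV[k]_(dim (T V))) : hmx frob_hom V *m c = 0 -> c = 0.
Proof.
move=> /(congr1 pol); rewrite [pol _]col_poly_frob col_poly0 => e.
apply: col_poly_inj; rewrite col_poly0; apply/mpolyP=> m.
by rewrite -(frob_lift_coef p_gt0) e !mcoeff0.
Qed.

Lemma frob_weight (c : 'cV[k]_(dim (T V))) :
  hmx (weight_hom 0) V *m (hmx frob_hom V *m c) = hmx frob_hom V *m c.
Proof.
apply/weight_fixed => m; rewrite negb_and addn0 => /orP[md | wm]; first exact: col_poly_deg.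
rewrite [pol _]col_poly_frob; apply: frob_lift_pure.
by apply: contra wm => /pure_wt ->.
Qed.

Lemma shift_frob (c : 'cV[k]_(dim (T V))) : hmx (shift_pow 1) V *m (hmx frob_hom V *m c) = 0.
Proof.
apply: col_poly_inj; rewrite [LHS]pol_shift_pow /= [pol _]col_poly_frob col_poly0.
exact: shiftD_pure0 charp _ (frob_lift_pure _).
Qed.

Lemma shift_exact0 c : hmx (weight_hom 0) V *m c = c -> hmx (shift_pow 1) V *m c = 0 ->
  exists c' : 'cV_(dim (T V)), c = hmx frob_hom V *m c'.
Proof.
move=> /weight_fixed gc Dc.
have /(graded_cycle0 charp gc) pc : @shiftD k p (dim V) (pol c) = 0.
  by have := pol_shift_pow 1 c; rewrite Dc col_poly0.
pose f := \sum_(m <- msupp (pol c)) (pol c)@_m *: ('X_[frob_root m] : {mpoly k[dim V]}).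
have [|c' c'E] := @col_poly_onto k d (dim V) f.
  move=> mu mud; rewrite raddf_sum big1_seq //= => m mc.
  rewrite mcoeffZ mcoeffX; case: eqP => [e | _]; last by rewrite mulr0.
  have pm : pure_on setT m by apply: contraLR mc => /pc; rewrite -mcoeff_eq0 => ->.
  have md : mdeg m = (d * p)%N.
    by apply/eqP; apply: contraLR mc => md; rewrite -mcoeff_eq0 col_poly_deg.
  case/eqP: mud; apply/eqP; rewrite -(eqn_pmul2r p_gt0) -md -(pure_frob pm) mdeg_frob_mnm e.
  by rewrite mulnC.
exists c'; apply: col_poly_inj; rewrite [RHS]col_poly_frob -c'E rmorph_sum.
rewrite {1}[pol c]mpolyE; apply: eq_big_seq => m mc.
have pm : pure_on setT m by apply: contraLR mc => /pc; rewrite -mcoeff_eq0 => ->.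
by rewrite [RHS]frob_liftZ frob_liftX pure_frob.
Qed.

End AtV.

Let exponent i := if odd i then p.-1 else 1%N.
Let weight i := (i./2 * p + odd i)%N.

Let weightS i : (weight i + exponent i)%N = weight i.+1.
Proof.
rewrite /weight /exponent /= uphalf_half; case: (odd i); last by rewrite add0n addn0.
by rewrite addn0 -addnA add1n prednK // add1n mulSn addnC.
Qed.

Let exponentS i : (exponent i.+1 + exponent i)%N = p.
Proof. by rewrite /exponent /=; case: (odd i); rewrite ?addn1 ?add1n prednK. Qed.

Let exponent_gt0 i : (0 < exponent i)%N.
Proof. by rewrite /exponent; case: odd => //; rewrite -subn1 subn_gt0 prime_gt1. Qed.

(** The columns of [M] are the polynomials of degree [d * p] in [p] blocks of
variables, and [weight_hom w] projects them to weight [w]. The weights [0], [1],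
[p], [p + 1], [2 p], ... are joined alternately by [D] and by [D^(p-1)]; this is an
exact sequence, whose first kernel is spanned by the [p]-th powers that
[frob_hom] embeds. Read on rows, the arrows are reversed and the sequence is a
resolution of [T] by direct summands of [M]. *)
Lemma twistS_resolved n : n_resolved M n -> n_resolved T n.
Proof.
move=> rM; pose splitting w (x : {G : hspfunctor k (d * p * p ^ r) & (spf_hom G M * spf_hom M G)%type}) :=
  (forall V, hmx (projT2 x).1 V *m hmx (projT2 x).2 V = 1%:M) /\
  (forall V, hmx (projT2 x).2 V *m hmx (projT2 x).1 V = hmx (weight_hom w) V).
have pick i : {x | splitting (weight i) x}.
  apply: constructive_indefinite_description.
  have [|G [s [t [st ts]]]] := @idempotent_split _ _ M (weight_hom (weight i)).
    by move=> V; apply: weight_mxK.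
  by exists (existT _ G (s, t)).
pose G i := projT1 (sval (pick i)).
pose s i : spf_hom (G i) M := (projT2 (sval (pick i))).1.
pose t i : spf_hom M (G i) := (projT2 (sval (pick i))).2.
have st i V : hmx (s i) V *m hmx (t i) V = 1%:M by case: (svalP (pick i)).
have ts i V : hmx (t i) V *m hmx (s i) V = hmx (weight_hom (weight i)) V by case: (svalP (pick i)).
have tw i V (c : 'cV_(dim (G i V))) :
    hmx (weight_hom (weight i)) V *m (hmx (t i) V *m c) = hmx (t i) V *m c.
  by rewrite -ts -mulmxA (mulmxA (hmx (s i) V)) st mul1mx.
pose diff i : spf_hom (G i.+1) (G i) := hcomp (s i.+1) (hcomp (shift_pow (exponent i)) (t i)).
pose aug : spf_hom (G 0%N) T := hcomp (s 0%N) frob_hom.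
have diffE i V (c : 'cV_(dim (G i V))) :
    hmx (t i.+1) V *m (hmx (diff i) V *m c) = hmx (shift_pow (exponent i)) V *m (hmx (t i) V *m c).
  rewrite /hmx /= -!mulmxA (mulmxA (f2mx (t i.+1 V))) [f2mx (t i.+1 V) *m _]ts -weightS.
  exact: shift_weight (tw _ _ _).
have augE V (c : 'cV_(dim (T V))) : hmx (t 0%N) V *m (hmx aug V *m c) = hmx frob_hom V *m c.
  rewrite -[hmx aug V *m c]mulmxA mulmxA ts; exact: frob_weight.
have t0 i V (c : 'cV_(dim (G i V))) : hmx (t i) V *m c = 0 -> c = 0.
  by move=> tc; rewrite -[c]mul1mx -(st i V) -mulmxA tc mulmx0.
have onto V : limg (aug V) = fullv.
  apply/limg_fullP/row_full_left=> q x ax; apply/matrixP=> a b.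
  have : col b x = 0; last by move/matrixP/(_ a ord0); rewrite !mxE.
  apply: frob_inj; rewrite -augE colE (mulmxA (hmx aug V)) [hmx aug V *m x]ax.
  by rewrite mul0mx mulmx0.
have col0 m q (X : 'M[k]_(m, q)) : (forall c : 'cV_q, X *m c = 0) -> X = 0.
  move=> X0; apply/matrixP=> a b; have /matrixP/(_ a ord0) := X0 (delta_mx b ord0).
  by rewrite -colE !mxE.
have ex0 V : limg (diff 0%N V) = lker (aug V).
  apply/limg_lkerP/mexact_col => [|c dc].
    apply: col0 => c; apply: (t0 1%N V); rewrite -mulmxA [LHS]diffE augE; exact: shift_frob.
  have [||c' c'E] := shift_exact0 (V := V) (c := hmx (t 0%N) V *m c); first exact: (tw 0%N).
    by rewrite -[LHS](diffE 0%N V c) dc mulmx0.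
  exists c'; rewrite -[LHS]mul1mx -(st 0%N V) -mulmxA c'E; exact: mulmxA.
have exS i V : limg (diff i.+1 V) = lker (diff i V).
  apply/limg_lkerP/mexact_col => [|c dc].
    apply: col0 => c; apply: (t0 i.+2 V); rewrite -mulmxA [LHS]diffE.
    rewrite [hmx (t i.+1) V *m _]diffE; exact/shift_powp/exponentS.
  have [||||c' [wc' c'E]] := @shift_exact V (weight i) _ _ (hmx (t i.+1) V *m c) (exponentS i).
  - exact: exponent_gt0.
  - exact: exponent_gt0.
  - by rewrite weightS; apply: tw.
  - by rewrite -diffE dc mulmx0.
  exists (hmx (s i) V *m c'); apply: (can_inj (g := mulmx (hmx (s i.+1) V)) (f := mulmx (hmx (t i.+1) V))).
    by move=> x; rewrite mulmxA st mul1mx.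
  by rewrite [RHS]diffE (mulmxA (hmx (t i) V)) ts wc' c'E.
apply: n_resolved_trans; exists (@Resolution _ _ T G diff aug onto ex0 exS) => i.
by apply: n_resolved_retract rM; exists (s i), (t i); apply: st.
Qed.

End Complex.

(** A rectangular identity matrix between equal but not convertible dimensions acts
as a cast; unlike [castmx] it can be handled by matrix algebra. *)
Lemma castmx_pid (R : pzRingType) v v' w w' (X : 'M[R]_(v, w)) (e : (v = v') * (w = w')) :
  X *m pid_mx w = pid_mx v *m castmx e X.
Proof.
case: e => ev ew; case: v' / ev; case: w' / ew.
by rewrite castmx_id !pid_mx_1 mulmx1 mul1mx.
Qed.

Lemma pid_mxK (R : pzRingType) m n r : m = r -> n = r ->
  (pid_mx r : 'M[R]_(m, n)) *m (pid_mx r : 'M[R]_(n, m)) = 1%:M.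
Proof. by move=> -> ->; rewrite pid_mx_1 mulmx1. Qed.

Section Untwisted.
Variables (k : fieldType) (p : nat) (charp : p \in [pchar k]) (d : nat).

Fact twist0_homogeneous : homogeneous d (twist charp 0 (Gamma k d)).
Proof. by rewrite -[X in homogeneous X _]muln1; apply: hspfP. Qed.

(** This is the identification of [Gamma^d] with [Gamma^d(Hom(k, -)) (x) k]. *)
Lemma twist0_genproj : genproj 1 (HSPFunctor twist0_homogeneous).
Proof.
apply/genproj_retract; exists (kspace k 1).
pose c v := #|{: mset_tuple d v}|.
pose S (V : vectType k) : 'M[k]_(c (dim V), c (1 * dim V) * 1)%N :=
  gamma_mx d (pid_mx (dim V) : 'M_(_, 1 * dim V)) *m (pid_mx (c (1 * dim V)%N) : 'M_(c _, _)).
pose S' (V : vectType k) : 'M[k]_(c (1 * dim V) * 1, c (dim V))%N :=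
  (pid_mx (c (1 * dim V)%N) : 'M_(_, c _)) *m gamma_mx d (pid_mx (dim V) : 'M_(1 * dim V, _)).
have SS' V : S V *m S' V = 1%:M.
  rewrite mulmxA -(mulmxA (gamma_mx _ _)) pid_mxK ?muln1 // mulmx1 -gamma_mxM.
  by rewrite pid_mxK ?mul1n // gamma_mx1.
have S'S V : S' V *m S V = 1%:M.
  rewrite mulmxA -(mulmxA (pid_mx _ : 'M_(_, c _))) -gamma_mxM pid_mxK ?mul1n // gamma_mx1.
  by rewrite mulmx1 pid_mxK ?muln1.
have natS : @natural_mx k (HSPFunctor twist0_homogeneous) (gamE d 1 (kspace k 1)) S.
  move=> A V W X.
  have -> : spf_mor (HSPFunctor twist0_homogeneous) X = gamma_mx d X.
    by congr gamma_mx; apply/matrixP=> i j; rewrite mxE.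
  rewrite !map_mxM !map_gamma_mx !map_pid_mx mulmxA -gamma_mxM.
  rewrite (castmx_pid _ (esym (mul1n _), esym (mul1n _))) -tens_scalar1mx gamma_mxM -!mulmxA.
  congr (_ *m _); rewrite (castmx_pid _ (esym (muln1 _), esym (muln1 _))).
  by congr (_ *m _); rewrite [RHS]tens_mx_scalar scale1r.
have natS' : @natural_mx k (gamE d 1 (kspace k 1)) (HSPFunctor twist0_homogeneous) S'.
  move=> A V W X; have := congr1 (mulmx^~ (map_mx (in_alg A) (S' W))) (natS A V W X).
  move/(congr1 (mulmx (map_mx (in_alg A) (S' V)))).
  rewrite -!mulmxA -map_mxM SS' map_mx1 mulmx1 => ->.
  by rewrite !mulmxA -map_mxM S'S map_mx1 mul1mx.
by exists (mkhom natS), (mkhom natS') => V; apply: SS'.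
Qed.

End Untwisted.

Lemma genproj_resolved (k : fieldType) d (F : hspfunctor k d) n : genproj n F -> n_resolved F n.
Proof.
apply: (@resolved_by_coind _ _ (genproj n)) => {}F gF.
exists (hker (hid F)), F, (ker_inc (hid F)), (hid F); split=> //; last first.
  by apply: ker_ses => V; apply: (@row_full_id _ _ _ _ 1%:M); rewrite mul1mx.
suff rF : retract (hker (hid F)) F.
  by case: gF => pF nF; split; [apply: projective_retract rF pF | apply: n_generated_retract rF nF].
exists (ker_inc (hid F)), (hzero F (hker (hid F))) => V; rewrite [LHS]mulmx0.
apply: (row_free_inj (ker_inc_free (hid F) V)); rewrite mul0mx mul1mx.
by have [+ _] := ker_inc_exact (hid F) V; rewrite [X in X = _ -> _]mulmx1.
Qed.

(** Inductively, [Gamma^(d p)] twisted [r] times is [p^r]-resolved, so its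
precomposition with [k^p (x) -] is [p^(r+1)]-resolved, and [twistS_resolved]
applies. *)
Theorem twist_resolved (k : fieldType) p (charp : p \in [pchar k]) r d :
  n_resolved (twist charp r (Gamma k d)) (p ^ r).
Proof.
elim: r d => [|r IH] d.
  apply: (@n_resolved_cast _ _ (d * p ^ 0) (HSPFunctor (twist0_homogeneous charp d)) (hspfP _)).
    by rewrite muln1.
  exact/genproj_resolved/twist0_genproj.
rewrite [X in n_resolved _ X]expnSr.
apply: (@n_resolved_cast _ _ (d * p ^ r.+1) (HSPFunctor (twistS_homogeneous charp r d)) (hspfP _)).
  by rewrite -mulnA -expnS.
exact/twistS_resolved/precomp_resolved.
Qed.

Theorem proposition6p11 (k : fieldType) (p : nat) (charp : p \in [pchar k]) :
  [/\ (* (i) *)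
      forall r d : nat, n_resolved (twist charp r (Gamma k d)) (p ^ r),
      (* (ii) *)
      forall (d : nat) (F : hspfunctor k d), (1 <= d)%N -> n_resolved F d,
      (* (iii) *)
      forall (d1 d2 : nat) (F1 : hspfunctor k d1) (F2 : hspfunctor k d2)
        (n1 n2 : nat), (0 < n1)%N -> (0 < n2)%N ->
        n_resolved F1 n1 -> n_resolved F2 n2 ->
        n_resolved (tensor F1 F2) (n1 + n2),
      (* (iv) *)
      forall (d : nat) (F : hspfunctor k d) (n : nat), (0 < n)%N ->
        n_resolved F n -> n_resolved F n.+1
    & (* (v) *)
      forall (d : nat) (F : hspfunctor k d) (n l : nat),
        (0 < n)%N -> (0 < l)%N ->
        n_resolved F n -> n_resolved (precomp_ktens l F) (n * l)].
Proof.
split=> [r d|d F _|d1 d2 F1 F2 n1 n2 _ _|d F n _|d F n l _ _].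
- exact: twist_resolved.
- exact: degree_resolved.
- exact: tensor_resolved.
- exact: n_resolvedS.
- exact: precomp_resolved.
Qed.
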